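(* Let $0<q<1$. (i) Let $a,b\in\mathbb{C}\setminus\{0\}$, $\nu,\mu\in\mathbb{C}$ with $|q^{\nu-\mu}b/a|<1$. Define the operator $$\bigl(W_{\nu,\mu}(a,b)f\bigr)(x)=\frac{(-x;q)_\infty}{(-xq^{-\mu};q)_\infty}q^{-\mu^2}\Bigl(\frac ba\Bigr)^\mu x^{\mu+\nu}\sum_{p=0}^\infty f(xq^{-\mu-p})\,q^{-p\nu}\frac{(q^\nu;q)_p}{(q;q)_p}\;{}_3\varphi_2\left({q^{-p},\,q^{-\mu},\,-q^{1+\mu-\nu}a/bx\atop q^{1-p-\nu},\,-q^{\mu+1}/x};q,q^{1-\mu}\frac ba\right)$$ for any function $f$ with $|f(xq^{-p})|=\mathcal{O}(q^{p(\epsilon+\nu)})$ for some $\epsilon>0$. Then $$W_{\nu,\mu}(a,b)\circ\mathcal{L}^{(a,b)}=\mathcal{L}^{(aq^{-\nu},bq^{-\mu})}\circ W_{\nu,\mu}(a,b)$$ on the space of compactly supported functions, and for $|a\sigma|<q^\nu$ $$\bigl(W_{\nu,\mu}(a,b)\Phi_\sigma(\cdot;a,b;q)\bigr)(yq^k)=y^{\mu+\nu}\,\frac{(a\sigma,b\sigma;q)_\infty}{(aq^{-\nu}\sigma,bq^{-\mu}\sigma;q)_\infty}\,\Phi_\sigma(yq^k;aq^{-\nu},bq^{-\mu};q).$$ (ii) Let $a,b>0$, $ab<1$, $\nu>0$ and $\mu\in\mathbb{C}\setminus\mathbb{Z}_{\le0}$. Define the operator $$\bigl(A_{\nu,\mu}(a,b)f\bigr)(x)=\frac{(-bxq^\mu/a;q)_\infty}{(-bxq^{\mu-\nu}/a;q)_\infty}\sum_{k=0}^\infty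 f(xq^{\mu+k})\,(ab)^k\frac{(q^\nu,-xq^\mu;q)_k}{(q,-bxq^\mu/a;q)_k}\;{}_3\varphi_2\left({q^{-k},\,q^\mu,\,-bxq^{\mu-\nu}/a\atop q^{1-\nu-k},\,-xq^\mu};q,q\right)$$ for any bounded function $f$. Then $$\mathcal{L}^{(aq^\nu,bq^\mu)}\circ A_{\nu,\mu}(a,b)=A_{\nu,\mu}(a,b)\circ\mathcal{L}^{(a,b)}$$ on the space of functions compactly supported in $(0,\infty)$. Moreover, $$\bigl(A_{\nu,\mu}(a,b)\phi_\lambda(\cdot;a,b;q)\bigr)(x)=\frac{(abq^{\nu+\mu};q)_\infty}{(ab;q)_\infty}\,\phi_\lambda(x;aq^\nu,bq^\mu;q).$$
   Context: Notation: $(a;q)_j=\prod_{i=0}^{j-1}(1-aq^i)$ for $j\in\mathbb{Z}_{\ge0}\cup\{\infty\}$, and $(a_1,\dots,a_m;q)_j=(a_1;q)_j\cdots(a_m;q)_j$; $a/bx$ means $a/(bx)$. ${}_{m+1}\varphi_m\left({a_1,\dots,a_{m+1}\atop b_1,\dots,b_m};q,z\right)=\sum_{j=0}^\infty\frac{(a_1,\dots,a_{m+1};q)_j}{(q,b_1,\dots,b_m;q)_j}z^j$, with the one-valued analytic continuation in $z$ to $\mathbb{C}\setminus\mathbb{R}_{\ge1}$ used outside the disc of convergence. With $T_q^{\pm1}f(x)=f(q^{\pm1}x)$, the second order hypergeometric $q$-difference operator is $$\mathcal{L}^{(a,b)}=\frac a2\Bigl(1+\frac1x\Bigr)T_q-\Bigl(\frac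 a{2x}+\frac q{2bx}\Bigr)\mathrm{Id}+\frac1{2a}\Bigl(1+\frac{aq}{bx}\Bigr)T_q^{-1}.$$ The little $q$-Jacobi function is $\phi_\lambda(x;a,b;q)={}_2\varphi_1\left({a\sigma,a/\sigma\atop ab};q,-\frac{bx}a\right)$, where $\lambda=\tfrac12(\sigma+\sigma^{-1})$. The asymptotically free solution is, for $y>0$, $k\in\mathbb{Z}$ and $\sigma^2\notin q^{\mathbb{Z}}$, $$\Phi_\sigma(yq^k;a,b;q)=(a\sigma)^{-k}\,{}_2\varphi_1\left({a\sigma,q\sigma/b\atop q\sigma^2};q,-\frac{q^{1-k}}y\right).$$ It is an eigenfunction of $\mathcal{L}^{(a,b)}$ on $yq^{\mathbb{Z}}$ with eigenvalue $\lambda=\tfrac12(\sigma+\sigma^{-1})$.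
   Formalization: In (i) the 3φ2 upper parameter q^{-μ} is corrected to q^{μ}; WΦ gains the factor q^{-μ²}(b/a)^μ(-y,-q/y;q)_∞/(-yq^{-μ},-q^{1+μ}/y;q)_∞, with Φ_σ based at yq^{-μ} (not negative); x must avoid zero denominators and cuts. *)

(* Defs.v *)
From Stdlib Require Import Reals ZArith List ClassicalEpsilon.
From Coquelicot Require Import Coquelicot.
Import ListNotations.

Local Open Scope C_scope.

(* Coordinatewise values; meaningful when the sequence (series) converges. *)
Definition CLim_seq (u : nat -> C) : C :=
  (real (Lim_seq (fun n => Re (u n))), real (Lim_seq (fun n => Im (u n)))).

Definition CSeries (u : nat -> C) : C :=
  (Series (fun n => Re (u n)), Series (fun n => Im (u n))).

Definition Cis_series (u : nat -> C) (l : C) : Prop :=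
  @is_series C_AbsRing C_NormedModule u l.

Definition Cex_series (u : nat -> C) : Prop :=
  @ex_series C_AbsRing C_NormedModule u.

Definition Cexp (z : C) : C :=
  ((exp (Re z) * cos (Im z))%R, (exp (Re z) * sin (Im z))%R).

(* Principal argument, in (-PI, PI], for z <> 0. *)
Definition Carg (z : C) : R :=
  if Rle_dec 0 (Im z) then acos (Re z / Cmod z) else (- acos (Re z / Cmod z))%R.

Definition CLog (z : C) : C := (ln (Cmod z), Carg z).

(* Principal power z ^ s for z <> 0; it satisfies
   cpow (t * z) s = cpow t s * cpow z s for real t > 0. *)
Definition cpow (z s : C) : C := Cexp (s * CLog z).

Definition CpowZ (z : C) (n : Z) : C :=
  match n with
  | Z0 => 1
  | Zpos p => Cpow z (Pos.to_nat p)
  | Zneg p => / Cpow z (Pos.to_nat p)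
  end.

Fixpoint qpoch (q : R) (z : C) (n : nat) : C :=
  match n with
  | O => 1
  | S m => qpoch q z m * (1 - z * Cpow q m)
  end.

Definition qpoch_inf (q : R) (z : C) : C := CLim_seq (qpoch q z).

(* No factor of (z;q)_infinity vanishes. *)
Definition qregular (q : R) (z : C) : Prop := forall n : nat, z * Cpow q n <> 1.

Definition qpochs (q : R) (l : list C) (n : nat) : C :=
  fold_right Cmult 1 (map (fun z => qpoch q z n) l).

Definition qpochs_inf (q : R) (l : list C) : C :=
  fold_right Cmult 1 (map (qpoch_inf q) l).

Definition qhyp_term (q : R) (al bl : list C) (z : C) (j : nat) : C :=
  qpochs q al j / qpochs q (RtoC q :: bl) j * Cpow z j.

(* The sum of the basic hypergeometric series.  If q^-p is an upper parameter,
   the terms j > p are zero, also when a lower parameter equals some q^-n with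
   n >= p (0 / 0 is 0 here), so that the series terminates at j = p. *)
Definition qhyp_sum (q : R) (al bl : list C) (z : C) : C :=
  CSeries (qhyp_term q al bl z).

Definition analytic_at (F : C -> C) (z0 : C) : Prop :=
  exists (c : nat -> C) (r : R), (0 < r)%R /\
    forall z : C, (Cmod (z - z0) < r)%R ->
      Cis_series (fun n => c n * Cpow (z - z0) n) (F z).

(* The complex plane cut along [1, +infinity). *)
Definition cut_plane (z : C) : Prop := ~ (Im z = 0%R /\ (1 <= Re z)%R).

Definition is_qhyp_continuation (q : R) (al bl : list C) (F : C -> C) : Prop :=
  (forall z : C, cut_plane z -> analytic_at F z) /\
  (forall z : C, (Cmod z < 1)%R -> Cis_series (qhyp_term q al bl z) (F z)).

(* The one-valued analytic continuation; by the identity theorem its values on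
   the cut plane do not depend on the choice made by epsilon. *)
Definition qhyp (q : R) (al bl : list C) : C -> C :=
  epsilon (inhabits (fun _ : C => RtoC 0)) (is_qhyp_continuation q al bl).

Definition Lop (q : R) (a b : C) (f : C -> C) (x : C) : C :=
  a / 2 * (1 + 1 / x) * f (q * x)
  - (a / (2 * x) + q / (2 * b * x)) * f x
  + 1 / (2 * a) * (1 + a * q / (b * x)) * f (x / q).

(* The little q-Jacobi function with lambda = (sigma + 1/sigma)/2; being
   symmetric in sigma and 1/sigma, it depends on sigma through lambda only. *)
Definition little_q_jacobi (q : R) (a b sigma x : C) : C :=
  qhyp q [a * sigma; a / sigma] [a * b] (- (b * x / a)).

(* The asymptotically free solution at the point y * q^k.  It is a function of
   the pair (y, k), not of the product: replacing (y, k) by (q y, k - 1)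
   multiplies it by a * sigma. *)
Definition Phi (q : R) (a b sigma y : C) (k : Z) : C :=
  CpowZ (a * sigma) (- k) *
  qhyp q [a * sigma; q * sigma / b] [q * (sigma * sigma)]
    (- (CpowZ q (1 - k) / y)).

Definition W_kernel_generic (q : R) (nu mu a b x : C) (p : nat) : C :=
  qpoch q (cpow q nu) p / qpoch q q p *
  qhyp_sum q
    [cpow q (- INR p); cpow q mu; - (cpow q (1 + mu - nu) * a / (b * x))]
    [cpow q (1 - INR p - nu); - (cpow q (mu + 1) / x)]
    (cpow q (1 - mu) * b / a).

(* If q^nu is one of 1, q^-1, q^-2, ..., the formula contains 0 / 0 for large p,
   but it is a rational function of q^nu with a removable singularity there and
   is read by continuity in nu.

   The upper parameter q^mu makes the argument q^(1-mu) b/a equal to the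
   quotient (product of the lower parameters)/(product of the upper ones).
   With q^-mu in its place, as this operator is sometimes printed, the
   intertwining relation is false: comparing the coefficients of f(x q^-mu) on
   both sides forces this parameter to be q^mu. *)
Definition W_kernel (q : R) (nu mu a b x : C) (p : nat) : C :=
  if excluded_middle_informative (qregular q (cpow q nu))
  then W_kernel_generic q nu mu a b x p
  else CLim_seq (fun n => W_kernel_generic q (nu + / INR (S n)) mu a b x p).

Definition W_term (q : R) (nu mu a b : C) (f : C -> C) (x : C) (p : nat) : C :=
  f (x * cpow q (- mu - INR p)) * cpow q (- (INR p * nu)) *
  W_kernel q nu mu a b x p.

Definition Wop (q : R) (nu mu a b : C) (f : C -> C) (x : C) : C :=
  qpoch_inf q (- x) / qpoch_inf q (- (x * cpow q (- mu))) *
  cpow q (- (mu * mu)) * cpow (b / a) mu * cpow x (mu + nu) *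
  CSeries (W_term q nu mu a b f x).

(* x is such that no denominator -x q^-mu, -q^(mu+1)/x in Wop is degenerate. *)
Definition W_regular (q : R) (mu x : C) : Prop :=
  x <> 0 /\ forall n : Z, - (x * cpow q (- mu)) <> CpowZ q n.

Definition W_decay (q : R) (nu : C) (f : C -> C) : Prop :=
  exists eps : R, (0 < eps)%R /\
    forall x : C, x <> 0 ->
      exists M : R, forall p : nat,
        (Cmod (f (x * cpow q (- INR p))%C)
         <= M * Cmod (cpow q (INR p * (eps + nu))%C))%R.

(* W maps Phi_sigma(.;a,b;q) on y q^-mu q^Z to y^(mu+nu) times the quotient of
   q-products times this number times Phi_sigma(.;a q^-nu,b q^-mu;q) on y q^Z;
   it is 1 for mu = 0.  It comes from the normalization of Wop: on y q^Z the
   factor (-x;q)_inf/(-x q^-mu;q)_inf x^mu is, by the quasi-periodicity of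
   (-x,-q/x;q)_inf, a constant times
   (-q^(1+mu)/x;q)_inf/(-q/x;q)_inf. *)
Definition W_norm (q : R) (mu a b y : C) : C :=
  cpow q (- (mu * mu)) * cpow (b / a) mu *
  (qpochs_inf q [- y; - (q / y)] /
   qpochs_inf q [- (y * cpow q (- mu)); - (cpow q (1 + mu) / y)]).

Definition A_term (q : R) (nu mu a b : C) (f : C -> C) (x : C) (k : nat) : C :=
  f (x * cpow q (mu + INR k)) * Cpow (a * b) k *
  (qpochs q [cpow q nu; - (x * cpow q mu)] k /
   qpochs q [RtoC q; - (b * x * cpow q mu / a)] k) *
  qhyp_sum q
    [cpow q (- INR k); cpow q mu; - (b * x * cpow q (mu - nu) / a)]
    [cpow q (1 - nu - INR k); - (x * cpow q mu)]
    q.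

Definition Aop (q : R) (nu mu a b : C) (f : C -> C) (x : C) : C :=
  qpoch_inf q (- (b * x * cpow q mu / a)) /
  qpoch_inf q (- (b * x * cpow q (mu - nu) / a)) *
  CSeries (A_term q nu mu a b f x).

(* Support in a bounded subset of C; nothing is required near 0. *)
Definition compactly_supported (f : C -> C) : Prop :=
  exists M : R, forall z : C, (M < Cmod z)%R -> f z = 0.

Definition compactly_supported_pos (f : C -> C) : Prop :=
  exists r M : R, (0 < r)%R /\
    forall z : C, f z <> 0 -> Im z = 0%R /\ (r <= Re z <= M)%R.

Definition bounded_fun (f : C -> C) : Prop :=
  exists M : R, forall z : C, (Cmod (f z) <= M)%R.

(* Main.v *)
Require Import Defs.
From Stdlib Require Import Reals ZArith List Lra Lia ClassicalEpsilon FunctionalExtensionality.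
From Coquelicot Require Import Coquelicot.
Import ListNotations.
Local Open Scope C_scope.

(** Put c = q^nu and m = q^mu.  Why the statements hold:

    Reversing the shifted factorials that contain q^-p turns each of the two
    terminating 3phi2 kernels into a Cauchy product, whose factors are
    (c;q)_i/(q;q)_i and a multiple of (m;q)_j/(q;q)_j.  Summing the resulting double
    series by rows instead of diagonals splits both operators into a part that depends
    on nu only and a part that depends on mu only ([Wop_factorization],
    [Aop_factorization]).  It also removes the apparent singularity of W at
    q^nu = q^-N, and it gives the convergence statements.

    For each of the four factors the intertwining relation is an identity between
    three series in the values of f on one q-lattice.  Its coefficients cancel because
    of the recursion of the q-binomial coefficients ([Vop_intertwines],
    [Uop_intertwines], [A1op_intertwines], [A2op_intertwines]).

    In the variable of the hypergeometric series, the nu-factor of W and the mu-factor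
    of A are series in powers of the dilation T f(z) = f(qz).  They act on z^n by a
    scalar which the q-binomial theorem evaluates, so they shift one parameter of a
    2phi1.  Euler's transformation 2phi1(A,B;C;z) -> 2phi1(C/A,C/B;C;ABz/C)
    exchanges a and b, and conjugates the two remaining factors into series of the
    same kind.  This computes the images of the eigenfunctions, but only where all
    the series converge.

    Outside the disc the 2phi1 stands for an analytic continuation.  It exists because
    its coefficients are values at q^j of an absolutely convergent power series,
    up to finitely many of them; this yields an expansion in partial fractions with
    poles in q^-n.  By the identity theorem the continuation still satisfies the
    second order q-difference equation ([qhyp_hyp_eq]).  Both sides of an
    eigenfunction formula therefore satisfy the same three-term recursion along a
    q-lattice, and agree near the end of the lattice where the series converge.
    As the outer coefficient of the recursion does not vanish, they agree on the whole
    lattice.  For W the recursion of the left-hand side is the intertwining relation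
    itself; for A the terms of that relation may diverge separately, and the equation is
    transported by [hyp_eq_dilation_series] instead. *)

(** * Limits and series of complex numbers *)

Definition Clim (u : nat -> C) (l : C) : Prop :=
  is_lim_seq (fun n => Re (u n)) (Re l) /\ is_lim_seq (fun n => Im (u n)) (Im l).

Lemma C_eq (z w : C) : Re z = Re w -> Im z = Im w -> z = w.
Proof. destruct z, w; simpl; intros; subst; reflexivity. Qed.

Lemma Im_le_Cmod (z : C) : (Rabs (Im z) <= Cmod z)%R.
Proof. eapply Rle_trans; [apply Rmax_r | apply Rmax_Cmod]. Qed.

Lemma Cmod_le_Re_Im (z : C) : (Cmod z <= Rabs (Re z) + Rabs (Im z))%R.
Proof.
  assert (E : z = RtoC (Re z) + Ci * RtoC (Im z)) by (apply C_eq; simpl; ring).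
  rewrite E at 1. eapply Rle_trans; [apply Cmod_triangle |].
  rewrite Cmod_mult, Cmod_Ci, !Cmod_R; lra.
Qed.

Lemma Clim_Cmod (u : nat -> C) (l : C) :
  Clim u l <-> is_lim_seq (fun n => Cmod (u n - l)) 0.
Proof.
  split.
  - intros [H1 H2].
    apply is_lim_seq_le_le with (fun _ => 0%R)
      (fun n => (Rabs (Re (u n) - Re l) + Rabs (Im (u n) - Im l))%R).
    + intro n; split; [apply Cmod_ge_0 |].
      exact (Cmod_le_Re_Im (u n - l)).
    + apply is_lim_seq_const.
    + replace (Finite 0) with (Finite (0 + 0)) by (f_equal; ring).
      apply is_lim_seq_plus'; apply -> is_lim_seq_abs_0.
      * replace (Finite 0) with (Finite (Re l - Re l)) by (f_equal; ring).
        apply is_lim_seq_minus'; [exact H1 | apply is_lim_seq_const].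
      * replace (Finite 0) with (Finite (Im l - Im l)) by (f_equal; ring).
        apply is_lim_seq_minus'; [exact H2 | apply is_lim_seq_const].
  - intro H.
    assert (aux : forall (g : nat -> R) (m : R),
               (forall n, Rabs (g n - m) <= Cmod (u n - l))%R -> is_lim_seq g m).
    { intros g m Hg.
      apply is_lim_seq_ext with (fun n => ((g n - m) + m)%R); [intro; ring |].
      replace (Finite m) with (Finite (0 + m)) by (f_equal; ring).
      apply is_lim_seq_plus'; [| apply is_lim_seq_const].
      apply is_lim_seq_abs_0.
      apply is_lim_seq_le_le with (fun _ => 0%R) (fun n => Cmod (u n - l)).
      - intro n; split; [apply Rabs_pos | apply Hg].
      - apply is_lim_seq_const.
      - exact H. }
    split; apply aux; intro n.
    + exact (re_le_Cmod (u n - l)).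
    + exact (Im_le_Cmod (u n - l)).
Qed.

Lemma Clim_CLim_seq (u : nat -> C) (l : C) : Clim u l -> CLim_seq u = l.
Proof.
  intros [H1 H2]. unfold CLim_seq.
  rewrite (is_lim_seq_unique _ _ H1), (is_lim_seq_unique _ _ H2).
  simpl; destruct l; reflexivity.
Qed.

Lemma Clim_unique (u : nat -> C) (l m : C) : Clim u l -> Clim u m -> l = m.
Proof. intros H1 H2. rewrite <- (Clim_CLim_seq _ _ H1). apply Clim_CLim_seq, H2. Qed.

Lemma Clim_const (l : C) : Clim (fun _ => l) l.
Proof. split; apply is_lim_seq_const. Qed.

Lemma Clim_ext_ev (u v : nat -> C) (l : C) :
  (exists N, forall n, (N <= n)%nat -> u n = v n) -> Clim u l -> Clim v l.
Proof.
  intros [N HN] [H1 H2]; split.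
  - apply is_lim_seq_ext_loc with (fun n => Re (u n)); [| exact H1].
    exists N; intros n Hn; rewrite HN; auto.
  - apply is_lim_seq_ext_loc with (fun n => Im (u n)); [| exact H2].
    exists N; intros n Hn; rewrite HN; auto.
Qed.

Lemma Clim_ext (u v : nat -> C) (l : C) :
  (forall n, u n = v n) -> Clim u l -> Clim v l.
Proof. intros H; apply Clim_ext_ev; exists O; auto. Qed.

Lemma Clim_plus (u v : nat -> C) (l m : C) :
  Clim u l -> Clim v m -> Clim (fun n => u n + v n) (l + m).
Proof. intros [H1 H2] [H3 H4]; split; simpl; apply is_lim_seq_plus'; auto. Qed.

Lemma Clim_mult (u v : nat -> C) (l m : C) :
  Clim u l -> Clim v m -> Clim (fun n => u n * v n) (l * m).
Proof.
  intros [H1 H2] [H3 H4]; split; simpl.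
  - apply is_lim_seq_minus'; apply is_lim_seq_mult'; auto.
  - apply is_lim_seq_plus'; apply is_lim_seq_mult'; auto.
Qed.

Lemma Clim_scal (k : C) (u : nat -> C) (l : C) :
  Clim u l -> Clim (fun n => k * u n) (k * l).
Proof. apply Clim_mult, Clim_const. Qed.

Lemma Clim_opp (u : nat -> C) (l : C) : Clim u l -> Clim (fun n => - u n) (- l).
Proof.
  intro H. replace (- l) with (- (1) * l) by ring.
  apply Clim_ext with (fun n => - (1) * u n); [intro; ring |]. now apply Clim_scal.
Qed.

Lemma Clim_minus (u v : nat -> C) (l m : C) :
  Clim u l -> Clim v m -> Clim (fun n => u n - v n) (l - m).
Proof. intros; apply Clim_plus; [| apply Clim_opp]; auto. Qed.

Lemma Clim_incr (k : nat) (u : nat -> C) (l : C) :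
  Clim u l <-> Clim (fun n => u (n + k)%nat) l.
Proof.
  unfold Clim. rewrite (is_lim_seq_incr_n (fun n => Re (u n)) k),
    (is_lim_seq_incr_n (fun n => Im (u n)) k). tauto.
Qed.

Lemma Clim_Cmod_lim (u : nat -> C) (l : C) :
  Clim u l -> is_lim_seq (fun n => Cmod (u n)) (Cmod l).
Proof.
  intro H. apply Clim_Cmod in H.
  apply is_lim_seq_ext with (fun n => ((Cmod (u n) - Cmod l) + Cmod l)%R);
    [intro; ring |].
  replace (Finite (Cmod l)) with (Finite (0 + Cmod l)) by (f_equal; ring).
  apply is_lim_seq_plus'; [| apply is_lim_seq_const].
  apply is_lim_seq_abs_0.
  apply is_lim_seq_le_le with (fun _ => 0%R) (fun n => Cmod (u n - l));
    [| apply is_lim_seq_const | exact H].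
  intro n; split; [apply Rabs_pos |].
  pose proof (Cmod_triangle (u n - l) l) as T1.
  pose proof (Cmod_triangle (l - u n) (u n)) as T2.
  replace (u n - l + l) with (u n) in T1 by ring.
  replace (l - u n + u n) with l in T2 by ring.
  replace (l - u n) with (- (u n - l)) in T2 by ring.
  rewrite Cmod_opp in T2. apply Rabs_le; lra.
Qed.

Lemma Clim_Cmod_le (u : nat -> C) (l : C) (M : R) :
  Clim u l -> (exists N, forall n, (N <= n)%nat -> (Cmod (u n) <= M)%R) ->
  (Cmod l <= M)%R.
Proof.
  intros H [N HN]. apply Clim_Cmod_lim in H.
  apply (is_lim_seq_incr_n _ N) in H.
  apply (is_lim_seq_le (fun n => Cmod (u (n + N)%nat)) (fun _ => M) (Cmod l) M);
    [intro; apply HN; lia | exact H | apply is_lim_seq_const].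
Qed.

Lemma Clim_Cmod_ge (u : nat -> C) (l : C) (M : R) :
  Clim u l -> (exists N, forall n, (N <= n)%nat -> (M <= Cmod (u n))%R) ->
  (M <= Cmod l)%R.
Proof.
  intros H [N HN]. apply Clim_Cmod_lim in H.
  apply (is_lim_seq_incr_n _ N) in H.
  apply (is_lim_seq_le (fun _ => M) (fun n => Cmod (u (n + N)%nat)) M (Cmod l));
    [intro; apply HN; lia | apply is_lim_seq_const | exact H].
Qed.

Lemma Clim_0_le (u : nat -> C) (v : nat -> R) :
  (forall n, (Cmod (u n) <= v n)%R) -> is_lim_seq v 0 -> Clim u 0.
Proof.
  intros H Hv. apply Clim_Cmod.
  apply is_lim_seq_le_le with (fun _ => 0%R) v; [| apply is_lim_seq_const | exact Hv].
  intro n; split; [apply Cmod_ge_0 |].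
  replace (u n - 0) with (u n) by ring. apply H.
Qed.

Fixpoint psum (u : nat -> C) (n : nat) : C :=
  match n with O => 0 | S m => psum u m + u m end.

Lemma psum_ext (u v : nat -> C) (n : nat) :
  (forall k, (k < n)%nat -> u k = v k) -> psum u n = psum v n.
Proof.
  induction n; simpl; intros H; [reflexivity |].
  rewrite IHn, (H n); auto.
Qed.

Lemma psum_plus (u v : nat -> C) (n : nat) :
  psum (fun k => u k + v k) n = psum u n + psum v n.
Proof. induction n; simpl; [ring | rewrite IHn; ring]. Qed.

Lemma psum_scal (c : C) (u : nat -> C) (n : nat) :
  psum (fun k => c * u k) n = c * psum u n.
Proof. induction n; simpl; [ring | rewrite IHn; ring]. Qed.

Lemma psum_add (u : nat -> C) (n m : nat) :
  psum u (n + m) = psum u n + psum (fun k => u (n + k)%nat) m.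
Proof.
  induction m; simpl; [rewrite Nat.add_0_r; ring |].
  rewrite Nat.add_succ_r; simpl; rewrite IHm; ring.
Qed.

Lemma psum_0 (u : nat -> C) (n : nat) : (forall k, (k < n)%nat -> u k = 0) -> psum u n = 0.
Proof.
  induction n; simpl; intros H; [reflexivity |].
  rewrite IHn, (H n); auto; ring.
Qed.

Lemma Cmod_psum_le (u : nat -> C) (M : nat -> R) (n : nat) :
  (forall k, (k < n)%nat -> (Cmod (u k) <= M k)%R) ->
  (Cmod (psum u (S n)) <= sum_n M n + (Cmod (u n) - M n))%R.
Proof.
  induction n; intros H.
  - simpl. rewrite sum_O. replace (0 + u O) with (u O) by ring. lra.
  - rewrite sum_Sn. simpl psum at 1.
    eapply Rle_trans; [apply Cmod_triangle |].
    assert (H1 := IHn (fun k Hk => H k (Nat.lt_lt_succ_r _ _ Hk))).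
    specialize (H n (Nat.lt_succ_diag_r n)). unfold plus; simpl in *; lra.
Qed.

Lemma sum_n_psum (u : nat -> C) (n : nat) :
  @sum_n C_AbelianMonoid u n = psum u (S n).
Proof.
  induction n; [rewrite sum_O; simpl psum; now rewrite Cplus_0_l |].
  rewrite sum_Sn, IHn. reflexivity.
Qed.

Definition hasum (u : nat -> C) (l : C) : Prop := Clim (psum u) l.

Lemma Re_psum (u : nat -> C) (n : nat) : Re (psum u (S n)) = sum_n (fun k => Re (u k)) n.
Proof.
  induction n; [rewrite sum_O; simpl psum; now rewrite Cplus_0_l |].
  rewrite sum_Sn, <- IHn. reflexivity.
Qed.

Lemma Im_psum (u : nat -> C) (n : nat) : Im (psum u (S n)) = sum_n (fun k => Im (u k)) n.
Proof.
  induction n; [rewrite sum_O; simpl psum; now rewrite Cplus_0_l |].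
  rewrite sum_Sn, <- IHn. reflexivity.
Qed.

Lemma hasum_parts (u : nat -> C) (l : C) :
  hasum u l <->
  is_series (fun n => Re (u n)) (Re l) /\ is_series (fun n => Im (u n)) (Im l).
Proof.
  unfold hasum. rewrite (Clim_incr 1). unfold Clim, is_series.
  assert (E : forall n, (n + 1)%nat = S n) by (intro; lia).
  split; intros [H1 H2]; split.
  - eapply filterlim_ext; [| exact H1]; intro n; simpl; now rewrite E, Re_psum.
  - eapply filterlim_ext; [| exact H2]; intro n; simpl; now rewrite E, Im_psum.
  - eapply filterlim_ext; [| exact H1]; intro n; simpl; now rewrite E, Re_psum.
  - eapply filterlim_ext; [| exact H2]; intro n; simpl; now rewrite E, Im_psum.
Qed.

Lemma hasum_CSeries (u : nat -> C) (l : C) : hasum u l -> CSeries u = l.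
Proof.
  intro H. apply hasum_parts in H. destruct H as [H1 H2]. unfold CSeries.
  rewrite (is_series_unique _ _ H1), (is_series_unique _ _ H2).
  destruct l; reflexivity.
Qed.

Lemma hasum_Cis_series (u : nat -> C) (l : C) : hasum u l <-> Cis_series u l.
Proof.
  unfold hasum. rewrite (Clim_incr 1). unfold Cis_series, is_series, Clim.
  assert (E : forall n, (n + 1)%nat = S n) by (intro; lia).
  rewrite <- !is_lim_seq_spec. split.
  - intros [H1 H2]. apply filterlim_locally. intro eps.
    destruct (H1 eps) as [N1 HN1]. destruct (H2 eps) as [N2 HN2].
    exists (N1 + N2)%nat. intros n Hn. rewrite sum_n_psum, <- E.
    split; [apply HN1 | apply HN2]; lia.
  - intro H. pose proof (proj1 (filterlim_locally _ _) H) as H0.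
    split; intro eps; destruct (H0 eps) as [N HN]; exists N; intros n Hn;
      specialize (HN n Hn); rewrite sum_n_psum, <- E in HN; destruct HN as [A B];
      [exact A | exact B].
Qed.

Lemma CSeries_ext (u v : nat -> C) : (forall n, u n = v n) -> CSeries u = CSeries v.
Proof. intro H. f_equal. now apply functional_extensionality. Qed.

Lemma hasum_ext (u v : nat -> C) (l : C) :
  (forall n, u n = v n) -> hasum u l -> hasum v l.
Proof. intro H. replace v with u; [auto | now apply functional_extensionality]. Qed.

Lemma hasum_plus (u v : nat -> C) (l m : C) :
  hasum u l -> hasum v m -> hasum (fun n => u n + v n) (l + m).
Proof.
  intros; unfold hasum. apply Clim_ext with (fun n => psum u n + psum v n).
  - intro; now rewrite psum_plus.
  - now apply Clim_plus.
Qed.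

Lemma hasum_scal (k : C) (u : nat -> C) (l : C) :
  hasum u l -> hasum (fun n => k * u n) (k * l).
Proof.
  intros; unfold hasum. apply Clim_ext with (fun n => k * psum u n).
  - intro; now rewrite psum_scal.
  - now apply Clim_scal.
Qed.

Lemma hasum_incr (k : nat) (u : nat -> C) (l : C) :
  hasum (fun n => u (k + n)%nat) l <-> hasum u (psum u k + l).
Proof.
  unfold hasum. rewrite (Clim_incr k (psum u)). split; intro H.
  - apply Clim_ext with (fun n => psum u k + psum (fun n => u (k + n)%nat) n).
    + intro n. rewrite <- psum_add. f_equal; lia.
    + apply Clim_plus; [apply Clim_const | exact H].
  - apply Clim_ext with (fun n => psum u (n + k) - psum u k).
    + intro n. rewrite (Nat.add_comm n k), psum_add. ring.
    + replace l with (psum u k + l - psum u k) by ring.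
      apply Clim_minus; [exact H | apply Clim_const].
Qed.

Lemma hasum_finite (N : nat) (u : nat -> C) :
  (forall n, (N <= n)%nat -> u n = 0) -> hasum u (psum u N).
Proof.
  intros H. unfold hasum.
  apply Clim_ext_ev with (fun _ => psum u N); [| apply Clim_const].
  exists N. intros n Hn. replace n with (N + (n - N))%nat by lia.
  rewrite psum_add, (psum_0 (fun k => u (N + k)%nat)); [ring |].
  intros k _. apply H; lia.
Qed.

(** ** Absolute convergence *)

Definition Cabs (u : nat -> C) : Prop := ex_series (fun n => Cmod (u n)).

Lemma Cabs_le (u : nat -> C) (M : nat -> R) :
  (forall n, (Cmod (u n) <= M n)%R) -> ex_series M -> Cabs u.
Proof.
  intros H HM. apply (ex_series_le (K := R_AbsRing) (V := R_CompleteNormedModule)) with M; auto.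
  intro n. change (Rabs (Cmod (u n)) <= M n)%R.
  rewrite Rabs_pos_eq; [apply H | apply Cmod_ge_0].
Qed.

Lemma ex_series_scal_R (k : R) (a : nat -> R) :
  ex_series a -> ex_series (fun n => (k * a n)%R).
Proof. apply (ex_series_scal_l (K := R_AbsRing) (V := R_NormedModule)). Qed.

Lemma ex_series_geom_scal (K rho : R) :
  (0 <= rho < 1)%R -> ex_series (fun n => (K * rho ^ n)%R).
Proof.
  intro H. apply (ex_series_scal_R K).
  apply ex_series_geom. rewrite Rabs_pos_eq; lra.
Qed.

Lemma Cabs_geom (u : nat -> C) (K rho : R) :
  (0 <= rho < 1)%R -> (forall n, (Cmod (u n) <= K * rho ^ n)%R) -> Cabs u.
Proof. intros H Hu. exact (Cabs_le u _ Hu (ex_series_geom_scal K rho H)). Qed.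

Lemma Cabs_hasum (u : nat -> C) : Cabs u -> hasum u (CSeries u).
Proof.
  intro H. apply hasum_parts. split; apply Series_correct;
    (apply (ex_series_le (K := R_AbsRing) (V := R_CompleteNormedModule)) with (2 := H)).
  - intro n. apply re_le_Cmod.
  - intro n. apply Im_le_Cmod.
Qed.

Lemma Cabs_ext (u v : nat -> C) : (forall n, u n = v n) -> Cabs u -> Cabs v.
Proof. intro H. replace v with u; [auto | now apply functional_extensionality]. Qed.

Lemma Cabs_plus (u v : nat -> C) : Cabs u -> Cabs v -> Cabs (fun n => u n + v n).
Proof.
  intros Hu Hv. apply Cabs_le with (fun n => (Cmod (u n) + Cmod (v n))%R).
  - intro; apply Cmod_triangle.
  - now apply (ex_series_plus (K := R_AbsRing) (V := R_NormedModule)).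
Qed.

Lemma Cabs_scal (k : C) (u : nat -> C) : Cabs u -> Cabs (fun n => k * u n).
Proof.
  intros Hu. apply Cabs_le with (fun n => (Cmod k * Cmod (u n))%R).
  - intro; rewrite Cmod_mult; lra.
  - now apply ex_series_scal_R.
Qed.

Lemma Cabs_incr (k : nat) (u : nat -> C) : Cabs u <-> Cabs (fun n => u (k + n)%nat).
Proof. apply (ex_series_incr_n (K := R_AbsRing) (V := R_NormedModule) (fun n => Cmod (u n))). Qed.

Lemma Cabs_finite (N : nat) (u : nat -> C) :
  (forall n, (N <= n)%nat -> u n = 0) -> Cabs u.
Proof.
  intros H. apply (Cabs_incr N).
  apply Cabs_geom with 0%R 0%R; [lra |].
  intro n. rewrite H by lia. rewrite Cmod_0; lra.
Qed.

Lemma Cabs_bounded_mult (u v : nat -> C) (M : R) :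
  (forall n, (Cmod (u n) <= M)%R) -> Cabs v -> Cabs (fun n => u n * v n).
Proof.
  intros HM Hv. apply Cabs_le with (fun n => (M * Cmod (v n))%R).
  - intro; rewrite Cmod_mult; apply Rmult_le_compat_r; [apply Cmod_ge_0 | auto].
  - now apply ex_series_scal_R.
Qed.

Lemma Cabs_Cex_series (u : nat -> C) : Cabs u -> Cex_series u.
Proof. intro H. exists (CSeries u). now apply hasum_Cis_series, Cabs_hasum. Qed.

Lemma CSeries_plus (u v : nat -> C) :
  Cabs u -> Cabs v -> CSeries (fun n => u n + v n) = CSeries u + CSeries v.
Proof. intros; apply hasum_CSeries, hasum_plus; now apply Cabs_hasum. Qed.

Lemma CSeries_scal (k : C) (u : nat -> C) :
  Cabs u -> CSeries (fun n => k * u n) = k * CSeries u.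
Proof. intros; apply hasum_CSeries, hasum_scal; now apply Cabs_hasum. Qed.

Lemma CSeries_incr (k : nat) (u : nat -> C) :
  Cabs u -> CSeries u = psum u k + CSeries (fun n => u (k + n)%nat).
Proof.
  intros. apply hasum_CSeries, hasum_incr, Cabs_hasum. now apply -> (Cabs_incr k).
Qed.

Lemma CSeries_S (u : nat -> C) :
  Cabs u -> CSeries u = u O + CSeries (fun n => u (S n)).
Proof. intros. rewrite (CSeries_incr 1 u); auto. simpl. ring. Qed.

Lemma CSeries_finite (N : nat) (u : nat -> C) :
  (forall n, (N <= n)%nat -> u n = 0) -> CSeries u = psum u N.
Proof. intro. now apply hasum_CSeries, hasum_finite. Qed.

Lemma CSeries_0 (u : nat -> C) : (forall n, u n = 0) -> CSeries u = 0.
Proof. intro H. rewrite (CSeries_finite 0 u); auto. Qed.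

Lemma Cmod_CSeries_le (u : nat -> C) (M : nat -> R) :
  (forall n, (Cmod (u n) <= M n)%R) -> ex_series M ->
  (Cmod (CSeries u) <= Series M)%R.
Proof.
  intros H HM.
  assert (Hu := Cabs_hasum _ (Cabs_le _ _ H HM)).
  unfold hasum in Hu. apply (Clim_incr 1), Clim_Cmod_lim in Hu.
  assert (HS := Series_correct _ HM).
  apply (is_lim_seq_le (fun n => Cmod (psum u (n + 1))) (sum_n M) (Cmod (CSeries u)) (Series M));
    auto.
  intro n. rewrite Nat.add_1_r.
  pose proof (Cmod_psum_le u M n (fun k _ => H k)). specialize (H n). lra.
Qed.

Lemma Cmod_CSeries_tail_le (u : nat -> C) (M : nat -> R) (k : nat) :
  (forall n, (Cmod (u n) <= M n)%R) -> ex_series M ->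
  (Cmod (CSeries u - psum u k) <= Series (fun n => M (k + n)%nat))%R.
Proof.
  intros H HM. rewrite (CSeries_incr k u) by now apply (Cabs_le _ M).
  replace (_ - _) with (CSeries (fun n => u (k + n)%nat)) by ring.
  apply Cmod_CSeries_le; [auto |].
  now apply -> (ex_series_incr_n (K := R_AbsRing) (V := R_NormedModule) M k).
Qed.

Lemma Series_tail_lim (M : nat -> R) :
  ex_series M -> is_lim_seq (fun k => Series (fun n => M (k + n)%nat)) 0.
Proof.
  intro HM. apply (is_lim_seq_incr_n _ 1).
  apply is_lim_seq_ext with (fun k => (Series M - sum_n M k)%R).
  - intro k. rewrite Nat.add_1_r, (Series_incr_n M (S k)); auto with arith.
    simpl Init.Nat.pred. rewrite sum_n_Reals. ring.
  - replace (Finite 0) with (Finite (Series M - Series M)) by (f_equal; ring).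
    apply is_lim_seq_minus'; [apply is_lim_seq_const |].
    apply (Series_correct M HM).
Qed.

(** Tannery's theorem: dominated convergence for series.  Every interchange of
    summations below is reduced to it. *)
Lemma tannery (v : nat -> nat -> C) (w : nat -> C) (M : nat -> R) :
  ex_series M -> (forall N n, (Cmod (v N n) <= M n)%R) ->
  (forall n, Clim (fun N => v N n) (w n)) ->
  Clim (fun N => CSeries (v N)) (CSeries w).
Proof.
  intros HM Hv Hw.
  assert (Hwb : forall n, (Cmod (w n) <= M n)%R).
  { intro n. apply (Clim_Cmod_le _ _ _ (Hw n)). exists O; auto. }
  assert (Hp : forall k, Clim (fun N => psum (v N) k) (psum w k)).
  { induction k; simpl; [apply Clim_const | apply Clim_plus; auto]. }
  apply Clim_Cmod. apply is_lim_seq_spec. intro eps.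
  assert (Ht := Series_tail_lim M HM). apply is_lim_seq_spec in Ht.
  destruct (Ht (pos_div_2 (pos_div_2 eps))) as [k Hk].
  specialize (Hk k (le_n k)).
  specialize (Hp k). apply Clim_Cmod, is_lim_seq_spec in Hp.
  destruct (Hp (pos_div_2 eps)) as [N HN]. exists N. intros n Hn.
  specialize (HN n Hn). simpl in *. rewrite Rminus_0_r in *.
  rewrite Rabs_pos_eq in * by apply Cmod_ge_0.
  pose proof (Rle_abs (Series (fun n => M (k + n)%nat))).
  pose proof (Cmod_CSeries_tail_le (v n) M k (Hv n) HM) as T1.
  pose proof (Cmod_CSeries_tail_le w M k Hwb HM) as T2.
  replace (CSeries (v n) - CSeries w) with
    ((CSeries (v n) - psum (v n) k) + ((psum (v n) k - psum w k) + - (CSeries w - psum w k)))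
    by ring.
  eapply Rle_lt_trans; [apply Cmod_triangle |].
  eapply Rle_lt_trans; [apply Rplus_le_compat_l, Cmod_triangle |].
  rewrite Cmod_opp. lra.
Qed.

Lemma psum_const_R (M : nat -> R) (n : nat) (S : R) :
  (forall k, (0 <= M k)%R) -> is_series M S -> (sum_n M n <= S)%R.
Proof.
  intros Hp HS.
  assert (H : is_lim_seq (sum_n M) S) by exact HS.
  apply (is_lim_seq_incr_compare (sum_n M) S H).
  intro k. rewrite sum_Sn. unfold plus; simpl. specialize (Hp (Datatypes.S k)); lra.
Qed.

Lemma Cmod_psum_le_Series (u : nat -> C) (M : nat -> R) (n : nat) :
  (forall k, (Cmod (u k) <= M k)%R) -> ex_series M ->
  (Cmod (psum u n) <= Series M)%R.
Proof.
  intros H HM.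
  assert (Hp : forall k, (0 <= M k)%R)
    by (intro k; eapply Rle_trans; [apply Cmod_ge_0 | apply H]).
  destruct n.
  - simpl. rewrite Cmod_0.
    eapply Rle_trans; [| apply (psum_const_R M 0 _ Hp (Series_correct _ HM))].
    rewrite sum_O; auto.
  - eapply Rle_trans; [apply (Cmod_psum_le u M n (fun k _ => H k)) |].
    pose proof (psum_const_R M n _ Hp (Series_correct _ HM)).
    specialize (H n). lra.
Qed.

Lemma Series_ge_0 (M : nat -> R) :
  (forall k, (0 <= M k)%R) -> ex_series M -> (0 <= Series M)%R.
Proof.
  intros Hp HM.
  eapply Rle_trans; [| apply (psum_const_R M 0 _ Hp (Series_correct _ HM))].
  rewrite sum_O; auto.
Qed.

Lemma CSeries_psum (a : nat -> nat -> C) (n : nat) :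
  (forall j, (j < n)%nat -> Cabs (fun i => a i j)) ->
  CSeries (fun i => psum (a i) n) = psum (fun j => CSeries (fun i => a i j)) n /\
  Cabs (fun i => psum (a i) n).
Proof.
  induction n; intros H.
  - split; [simpl; now apply CSeries_0 | apply (Cabs_finite 0); auto].
  - destruct IHn as [E A]; [auto |]. simpl. split.
    + rewrite CSeries_plus, E; auto.
    + apply Cabs_plus; auto.
Qed.

(** Double series dominated by a product of convergent series may be summed by
    rows, by columns or along the diagonals. *)
Lemma fubini_swap (a : nat -> nat -> C) (al be : nat -> R) :
  (forall i j, (Cmod (a i j) <= al i * be j)%R) -> ex_series al -> ex_series be ->
  (forall i, (0 <= al i)%R) -> (forall j, (0 <= be j)%R) ->
  hasum (fun j => CSeries (fun i => a i j)) (CSeries (fun i => CSeries (a i))).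
Proof.
  intros H Hal Hbe Pal Pbe. unfold hasum.
  assert (Hj : forall j, Cabs (fun i => a i j)).
  { intro j. apply Cabs_le with (fun i => (be j * al i)%R);
      [intro i; rewrite Rmult_comm; apply H |].
    now apply ex_series_scal_R. }
  assert (Hi : forall i, ex_series (fun j => (al i * be j)%R)).
  { intro i. now apply ex_series_scal_R. }
  apply Clim_ext with (fun n => CSeries (fun i => psum (a i) n)).
  { intro n. apply CSeries_psum; auto. }
  apply tannery with (fun i => (Series be * al i)%R).
  - now apply ex_series_scal_R.
  - intros N i. eapply Rle_trans;
      [apply (Cmod_psum_le_Series (a i) (fun j => (al i * be j)%R)); auto |].
    rewrite Series_scal_l. lra.
  - intro i. apply Cabs_hasum. apply Cabs_le with (2 := Hi i); auto.
Qed.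

Definition diag (a : nat -> nat -> C) (p : nat) : C := psum (fun i => a i (p - i)%nat) (S p).

Lemma psum_diag (a : nat -> nat -> C) (n : nat) :
  psum (diag a) n = psum (fun i => psum (a i) (n - i)) n.
Proof.
  induction n; [reflexivity |].
  simpl psum at 1. rewrite IHn.
  change (diag a n) with (psum (fun i => a i (n - i)%nat) n + a n (n - n)%nat).
  rewrite Nat.sub_diag.
  change (psum (fun i => psum (a i) (S n - i)) (S n))
    with (psum (fun i => psum (a i) (S n - i)) n + psum (a n) (S n - n)).
  replace (S n - n)%nat with 1%nat by lia. simpl (psum (a n) 1).
  rewrite (psum_ext (fun i => psum (a i) (S n - i))
             (fun i => psum (a i) (n - i) + a i (n - i)%nat)).
  - rewrite psum_plus. ring.
  - intros k Hk. replace (S n - k)%nat with (S (n - k)) by lia. reflexivity.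
Qed.

Lemma fubini_diag (a : nat -> nat -> C) (al be : nat -> R) :
  (forall i j, (Cmod (a i j) <= al i * be j)%R) -> ex_series al -> ex_series be ->
  (forall i, (0 <= al i)%R) -> (forall j, (0 <= be j)%R) ->
  hasum (diag a) (CSeries (fun i => CSeries (a i))).
Proof.
  intros H Hal Hbe Pal Pbe. unfold hasum.
  assert (Hi : forall i, ex_series (fun j => (al i * be j)%R)).
  { intro i. now apply ex_series_scal_R. }
  apply Clim_ext with (fun n => CSeries (fun i => psum (a i) (n - i))).
  { intro n. rewrite psum_diag. apply CSeries_finite.
    intros k Hk. replace (n - k)%nat with O by lia. reflexivity. }
  apply tannery with (fun i => (Series be * al i)%R).
  - now apply ex_series_scal_R.
  - intros N i. eapply Rle_trans;
      [apply (Cmod_psum_le_Series (a i) (fun j => (al i * be j)%R)); auto |].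
    rewrite Series_scal_l. lra.
  - intro i. apply (Clim_incr i).
    apply Clim_ext with (psum (a i)); [intro; f_equal; lia |].
    apply Cabs_hasum. apply Cabs_le with (2 := Hi i); auto.
Qed.

Lemma Cmod_psum_RtoC (u : nat -> C) (M : nat -> R) (n : nat) :
  (forall k, (Cmod (u k) <= M k)%R) ->
  (Cmod (psum u n) <= Re (psum (fun k => RtoC (M k)) n))%R.
Proof.
  intro H. induction n; simpl; [rewrite Cmod_0; lra |].
  eapply Rle_trans; [apply Cmod_triangle |]. exact (Rplus_le_compat _ _ _ _ IHn (H n)).
Qed.

Lemma Cabs_diag (a : nat -> nat -> C) (al be : nat -> R) :
  (forall i j, (Cmod (a i j) <= al i * be j)%R) -> ex_series al -> ex_series be ->
  (forall i, (0 <= al i)%R) -> (forall j, (0 <= be j)%R) ->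
  Cabs (diag a).
Proof.
  intros H Hal Hbe Pal Pbe.
  set (b := fun i j => RtoC (al i * be j)%R).
  assert (Hb : hasum (diag b) (CSeries (fun i => CSeries (b i)))).
  { apply fubini_diag with al be; auto.
    intros i j. unfold b. rewrite Cmod_R, Rabs_pos_eq; [lra |].
    now apply Rmult_le_pos. }
  apply hasum_parts in Hb. destruct Hb as [Hb _].
  apply Cabs_le with (fun p => Re (diag b p)); [| eexists; exact Hb].
  intro p. unfold diag. apply Cmod_psum_RtoC. intro k. apply H.
Qed.

(** * q-shifted factorials *)

Lemma RtoC_neq_0 (r : R) : r <> 0%R -> RtoC r <> 0.
Proof. intros H E. apply H. now apply RtoC_inj. Qed.

Lemma Cdiv_neq_0 (u v : C) : u <> 0 -> v <> 0 -> u / v <> 0.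
Proof.
  intros Hu Hv E. apply Hu. transitivity (u / v * v); [field; auto | rewrite E; ring].
Qed.

Lemma q_neq_0 (q : R) : (0 < q < 1)%R -> RtoC q <> 0.
Proof. intros; apply RtoC_neq_0; lra. Qed.

Lemma Cmod_qpow (q : R) (n : nat) : (0 < q < 1)%R -> Cmod (q ^ n) = (q ^ n)%R.
Proof. intros. rewrite Cmod_pow, Cmod_R, Rabs_pos_eq; lra. Qed.

Lemma qpow_le_1 (q : R) (n : nat) : (0 < q < 1)%R -> (0 < q ^ n <= 1)%R.
Proof.
  intros Hq. split; [apply pow_lt; lra |].
  rewrite <- (pow1 n). apply pow_incr; lra.
Qed.

Lemma qpow_small (q : R) (eps : R) :
  (0 < q < 1)%R -> (0 < eps)%R -> exists N, forall n, (N <= n)%nat -> (q ^ n < eps)%R.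
Proof.
  intros Hq He.
  assert (H : is_lim_seq (fun n => q ^ n)%R 0)
    by (apply is_lim_seq_geom; rewrite Rabs_pos_eq; lra).
  apply is_lim_seq_spec in H. destruct (H (mkposreal eps He)) as [N HN].
  exists N. intros n Hn. specialize (HN n Hn). simpl in HN.
  rewrite Rminus_0_r, Rabs_pos_eq in HN; auto. apply pow_le; lra.
Qed.

Lemma qpow_lim_0 (q : R) : (0 < q < 1)%R -> Clim (fun n => q ^ n) 0.
Proof.
  intros Hq. apply Clim_0_le with (fun n => q ^ n)%R.
  - intro; rewrite Cmod_qpow; lra.
  - apply is_lim_seq_geom. rewrite Rabs_pos_eq; lra.
Qed.

Lemma qpow_S_neq_1 (q : R) (n : nat) : (0 < q < 1)%R -> 1 - q ^ S n <> 0.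
Proof.
  intros Hq. apply Cminus_eq_contra. intro E. symmetry in E.
  assert (H : (q ^ S n = 1)%R).
  { apply RtoC_inj. rewrite RtoC_pow. exact E. }
  simpl in H. pose proof (qpow_le_1 q n Hq).
  assert (q * q ^ n <= q * 1)%R by (apply Rmult_le_compat_l; lra). lra.
Qed.

Lemma qpoch_S (q : R) (z : C) (n : nat) :
  qpoch q z (S n) = qpoch q z n * (1 - z * q ^ n).
Proof. reflexivity. Qed.

Lemma qpoch_add (q : R) (z : C) (n m : nat) :
  qpoch q z (n + m) = qpoch q z n * qpoch q (z * q ^ n) m.
Proof.
  induction m.
  - rewrite Nat.add_0_r; simpl; ring.
  - rewrite Nat.add_succ_r, !qpoch_S, IHm, Cpow_add_r. ring.
Qed.

Lemma qpoch_S_l (q : R) (z : C) (n : nat) :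
  qpoch q z (S n) = (1 - z) * qpoch q (z * q) n.
Proof.
  change (S n) with (1 + n)%nat. rewrite qpoch_add, Cpow_1_r. simpl. ring.
Qed.

Lemma qpoch_Cmod_le (q : R) (z : C) (n : nat) :
  (0 < q < 1)%R -> (Cmod (qpoch q z n) <= exp (Cmod z / (1 - q)))%R.
Proof.
  intros Hq.
  assert (H : (Cmod (qpoch q z n) <= exp (Cmod z * ((1 - q ^ n) / (1 - q))))%R).
  { induction n.
    - simpl. rewrite Cmod_1.
      replace (Cmod z * ((1 - 1) / (1 - q)))%R with 0%R by (field; lra). rewrite exp_0; lra.
    - rewrite qpoch_S, Cmod_mult.
      replace (Cmod z * ((1 - q ^ S n) / (1 - q)))%R with
        (Cmod z * ((1 - q ^ n) / (1 - q)) + Cmod z * q ^ n)%R by (simpl; field; lra).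
      rewrite exp_plus. apply Rmult_le_compat; auto using Cmod_ge_0.
      eapply Rle_trans; [apply Cmod_triangle |].
      rewrite Cmod_1, Cmod_opp, Cmod_mult, Cmod_qpow by lra.
      destruct (Req_dec (Cmod z * q ^ n) 0) as [E | E].
      + rewrite E, exp_0; lra.
      + left. apply exp_ineq1; auto. }
  eapply Rle_trans; [exact H |].
  assert (Hle : (Cmod z * ((1 - q ^ n) / (1 - q)) <= Cmod z / (1 - q))%R).
  { unfold Rdiv. rewrite <- Rmult_assoc. apply Rmult_le_compat_r.
    - left; apply Rinv_0_lt_compat; lra.
    - pose proof (qpow_le_1 q n Hq). pose proof (Cmod_ge_0 z). nra. }
  destruct Hle as [Hle | ->]; [left; now apply exp_increasing | lra].
Qed.

(** The differences of consecutive partial products are bounded by a geometric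
    sequence. *)
Lemma qpoch_lim (q : R) (z : C) :
  (0 < q < 1)%R -> Clim (qpoch q z) (qpoch_inf q z).
Proof.
  intros Hq.
  assert (Ha : Cabs (fun k => qpoch q z k * z * q ^ k)).
  { apply Cabs_geom with (exp (Cmod z / (1 - q)) * Cmod z)%R q; [lra |].
    intro n. rewrite !Cmod_mult, Cmod_qpow by auto.
    apply Rmult_le_compat_r; [apply pow_le; lra |].
    apply Rmult_le_compat_r; [apply Cmod_ge_0 | now apply qpoch_Cmod_le]. }
  assert (H : Clim (qpoch q z) (1 - CSeries (fun k => qpoch q z k * z * q ^ k))).
  { apply Clim_ext with (fun n => 1 - psum (fun k => qpoch q z k * z * q ^ k) n).
    - induction n; simpl in *; [ring | rewrite <- IHn; ring].
    - apply Clim_minus; [apply Clim_const | now apply Cabs_hasum]. }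
  unfold qpoch_inf. now rewrite (Clim_CLim_seq _ _ H).
Qed.

Lemma qpoch_inf_split (q : R) (z : C) (n : nat) :
  (0 < q < 1)%R -> qpoch_inf q z = qpoch q z n * qpoch_inf q (z * q ^ n).
Proof.
  intros Hq. apply Clim_unique with (fun k => qpoch q z (k + n)).
  - apply -> Clim_incr. now apply qpoch_lim.
  - apply Clim_ext with (fun k => qpoch q z n * qpoch q (z * q ^ n) k).
    + intro k. now rewrite Nat.add_comm, qpoch_add.
    + apply Clim_scal. now apply qpoch_lim.
Qed.

Lemma qpoch_inf_S (q : R) (z : C) :
  (0 < q < 1)%R -> qpoch_inf q z = (1 - z) * qpoch_inf q (z * q).
Proof.
  intros Hq. rewrite (qpoch_inf_split q z 1) by auto. rewrite Cpow_1_r. simpl. ring.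
Qed.

Lemma qregular_shift (q : R) (z : C) (n : nat) :
  qregular q z -> qregular q (z * q ^ n).
Proof.
  intros H m E. apply (H (n + m)%nat). rewrite Cpow_add_r, <- E. ring.
Qed.

Lemma qpoch_neq_0 (q : R) (z : C) (n : nat) : qregular q z -> qpoch q z n <> 0.
Proof.
  intros H. induction n; [apply C1_nz |].
  rewrite qpoch_S. apply Cmult_neq_0; auto.
  apply Cminus_eq_contra. intro E. now apply (H n).
Qed.

(** Weierstrass' inequality: the modulus of a product of factors 1 - t_i is at least
    1 minus the sum of the moduli of the t_i, here at least 1/2. *)
Lemma qpoch_Cmod_ge (q : R) (z : C) (n : nat) :
  (0 < q < 1)%R -> (Cmod z <= (1 - q) / 2)%R -> (/ 2 <= Cmod (qpoch q z n))%R.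
Proof.
  intros Hq Hz.
  assert (Hs : forall k, (0 <= Cmod z * ((1 - q ^ k) / (1 - q)) <= / 2)%R).
  { intro k. pose proof (qpow_le_1 q k Hq). pose proof (Cmod_ge_0 z).
    assert (0 <= (1 - q ^ k) / (1 - q) <= / (1 - q))%R.
    { unfold Rdiv. assert (0 < / (1 - q))%R by (apply Rinv_0_lt_compat; lra). nra. }
    split; [nra |].
    apply Rle_trans with ((1 - q) / 2 * / (1 - q))%R; [apply Rmult_le_compat; lra |].
    right. field; lra. }
  assert (H : (1 - Cmod z * ((1 - q ^ n) / (1 - q)) <= Cmod (qpoch q z n))%R).
  { induction n.
    - simpl. rewrite Cmod_1. unfold Rdiv. rewrite Rminus_diag. lra.
    - rewrite qpoch_S, Cmod_mult.
      pose proof (Hs n) as H1. pose proof (Hs (S n)) as H2.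
      assert (E : (Cmod z * ((1 - q ^ S n) / (1 - q)) =
        Cmod z * ((1 - q ^ n) / (1 - q)) + Cmod z * q ^ n)%R) by (simpl; field; lra).
      rewrite E in H2 |- *. set (s := (Cmod z * ((1 - q ^ n) / (1 - q)))%R) in *.
      assert (H3 : (1 - Cmod z * q ^ n <= Cmod (1 - z * q ^ n))%R).
      { pose proof (Cmod_triangle (1 - z * q ^ n) (z * q ^ n)) as T.
        replace (1 - z * q ^ n + z * q ^ n) with (RtoC 1) in T by ring.
        rewrite Cmod_1, (Cmod_mult z), Cmod_qpow in T by auto. lra. }
      assert (H4 : (0 <= Cmod z * q ^ n)%R)
        by (apply Rmult_le_pos; [apply Cmod_ge_0 | apply pow_le; lra]).
      apply Rle_trans with ((1 - s) * (1 - Cmod z * q ^ n))%R; [nra |].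
      apply Rmult_le_compat; lra. }
  specialize (Hs n). lra.
Qed.

Lemma qpow_mult_small (q : R) (z : C) (eps : R) :
  (0 < q < 1)%R -> (0 < eps)%R ->
  exists N, forall n, (N <= n)%nat -> (Cmod (z * q ^ n) < eps)%R.
Proof.
  intros Hq He. pose proof (Cmod_ge_0 z) as Hz.
  destruct (qpow_small q (eps / (Cmod z + 1)) Hq) as [N HN].
  { apply Rdiv_lt_0_compat; lra. }
  exists N. intros n Hn. specialize (HN n Hn).
  rewrite Cmod_mult, Cmod_qpow by auto.
  pose proof (qpow_le_1 q n Hq).
  apply Rle_lt_trans with ((Cmod z + 1) * q ^ n)%R; [nra |].
  replace eps with ((Cmod z + 1) * (eps / (Cmod z + 1)))%R by (field; lra).
  apply Rmult_lt_compat_l; lra.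
Qed.

(** Weierstrass' inequality covers all factors but finitely many. *)
Lemma qpoch_lower (q : R) (z : C) :
  (0 < q < 1)%R -> qregular q z ->
  exists d, (0 < d)%R /\ forall n, (d <= Cmod (qpoch q z n))%R.
Proof.
  intros Hq Hz.
  destruct (qpow_mult_small q z ((1 - q) / 2) Hq) as [N HN]; [lra |].
  assert (Hfin : forall K, exists d, (0 < d)%R /\
            forall n, (n <= K)%nat -> (d <= Cmod (qpoch q z n))%R).
  { induction K as [| K [d [Hd HK]]].
    - exists 1%R. split; [lra |]. intros n Hn. replace n with O by lia.
      simpl. rewrite Cmod_1; lra.
    - exists (Rmin d (Cmod (qpoch q z (S K)))). split.
      + apply Rmin_glb_lt; auto. now apply Cmod_gt_0, qpoch_neq_0.
      + intros n Hn. destruct (Nat.eq_dec n (S K)) as [-> | Hne]; [apply Rmin_r |].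
        eapply Rle_trans; [apply Rmin_l | apply HK; lia]. }
  destruct (Hfin N) as [d [Hd HdN]]. exists (d * / 2)%R. split; [lra |].
  intro n. destruct (le_lt_dec n N) as [Hn | Hn].
  - specialize (HdN n Hn). lra.
  - replace n with (N + (n - N))%nat by lia. rewrite qpoch_add, Cmod_mult.
    apply Rmult_le_compat; [lra | lra | auto |].
    apply qpoch_Cmod_ge; auto. left. apply HN; lia.
Qed.

Lemma qpoch_inf_neq_0 (q : R) (z : C) :
  (0 < q < 1)%R -> qregular q z -> qpoch_inf q z <> 0.
Proof.
  intros Hq Hz. destruct (qpoch_lower q z Hq Hz) as [d [Hd H]].
  apply Cmod_gt_0. apply Rlt_le_trans with d; auto.
  apply (Clim_Cmod_ge _ _ d (qpoch_lim q z Hq)). exists O; auto.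
Qed.

Lemma qregular_small (q : R) (z : C) :
  (0 < q < 1)%R -> (Cmod z < 1)%R -> qregular q z.
Proof.
  intros Hq Hz n E. assert (H := Cmod_1). rewrite <- E, Cmod_mult, Cmod_qpow in H by auto.
  pose proof (qpow_le_1 q n Hq). pose proof (Cmod_ge_0 z). nra.
Qed.

Lemma qregular_q (q : R) : (0 < q < 1)%R -> qregular q q.
Proof. intros Hq. apply qregular_small; auto. rewrite Cmod_R, Rabs_pos_eq; lra. Qed.

Lemma qregular_factor (q : R) (z : C) (n : nat) : qregular q z -> 1 - z * q ^ n <> 0.
Proof. intros H. apply Cminus_eq_contra. intro E. now apply (H n). Qed.

Lemma qpoch_div_bounded (q : R) (a b : C) :
  (0 < q < 1)%R -> qregular q b ->
  exists M, (0 <= M)%R /\ forall n, (Cmod (qpoch q a n / qpoch q b n) <= M)%R.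
Proof.
  intros Hq Hb. destruct (qpoch_lower q b Hq Hb) as [d [Hd H]].
  exists (exp (Cmod a / (1 - q)) * / d)%R. split.
  - apply Rmult_le_pos; [left; apply exp_pos | left; now apply Rinv_0_lt_compat].
  - intro n. rewrite Cmod_div by now apply qpoch_neq_0.
    apply Rmult_le_compat; [apply Cmod_ge_0 | | now apply qpoch_Cmod_le |].
    + left. apply Rinv_0_lt_compat, Cmod_gt_0. now apply qpoch_neq_0.
    + apply Rinv_le_contravar; auto.
Qed.

(** * Power series at the origin *)

Definition ps (c : nat -> C) (z : C) : C := CSeries (fun n => c n * z ^ n).

Lemma Cabs_ps (c : nat -> C) (rho : R) (z : C) :
  Cabs (fun n => c n * RtoC rho ^ n) -> (Cmod z <= rho)%R -> Cabs (fun n => c n * z ^ n).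
Proof.
  intros H Hz. apply Cabs_le with (2 := H). intro n.
  rewrite !Cmod_mult. apply Rmult_le_compat_l; [apply Cmod_ge_0 |].
  rewrite !Cmod_pow, Cmod_R. apply pow_incr. split; [apply Cmod_ge_0 |].
  eapply Rle_trans; [exact Hz | apply Rle_abs].
Qed.

Lemma Cabs_ps_bounded (c : nat -> C) (M : R) (z : C) :
  (forall n, (Cmod (c n) <= M)%R) -> (Cmod z < 1)%R -> Cabs (fun n => c n * z ^ n).
Proof.
  intros H Hz. apply Cabs_geom with M (Cmod z); [split; [apply Cmod_ge_0 | auto] |].
  intro n. rewrite Cmod_mult, Cmod_pow. apply Rmult_le_compat_r; auto.
  apply pow_le, Cmod_ge_0.
Qed.

Lemma ps_at_0 (c : nat -> C) : ps c 0 = c O.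
Proof.
  unfold ps. rewrite (CSeries_finite 1).
  - simpl. ring.
  - intros n Hn. destruct n; [lia |]. simpl. ring.
Qed.

Lemma ps_step (c : nat -> C) (z : C) :
  Cabs (fun n => c n * z ^ n) -> z <> 0 ->
  Cabs (fun n => c (S n) * z ^ n) /\ ps c z = c O + z * ps (fun n => c (S n)) z.
Proof.
  intros H Hz.
  assert (A : Cabs (fun n => c (S n) * z ^ n)).
  { apply Cabs_ext with (fun n => / z * (c (S n) * z ^ S n)).
    - intro n. simpl. field. auto.
    - apply Cabs_scal. now apply -> (Cabs_incr 1) in H. }
  split; [exact A |].
  unfold ps. rewrite CSeries_S by auto. rewrite <- CSeries_scal by auto.
  f_equal; [simpl; ring |]. apply CSeries_ext. intro n. simpl. ring.
Qed.

Lemma ps_lipschitz (c : nat -> C) (rho : R) :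
  (0 < rho)%R -> Cabs (fun n => c n * RtoC rho ^ n) ->
  exists K, (0 <= K)%R /\
    forall z, (Cmod z <= rho)%R -> (Cmod (ps c z - c O) <= K * Cmod z)%R.
Proof.
  intros Hr H.
  assert (Hr0 : RtoC rho <> 0) by (apply RtoC_neq_0; lra).
  destruct (ps_step c (RtoC rho) H Hr0) as [A _].
  exists (Series (fun n => Cmod (c (S n) * RtoC rho ^ n))). split.
  - apply Series_ge_0; auto using Cmod_ge_0.
  - intros z Hz. destruct (Ceq_dec z 0) as [-> | Hz0].
    + rewrite ps_at_0, Cmod_0. replace (c O - c O) with (RtoC 0) by ring. rewrite Cmod_0; lra.
    + destruct (ps_step c z (Cabs_ps _ _ _ H Hz) Hz0) as [_ ->].
      replace (c O + _ - c O) with (z * ps (fun n => c (S n)) z) by ring.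
      rewrite Cmod_mult, Rmult_comm. apply Rmult_le_compat_r; [apply Cmod_ge_0 |].
      apply Cmod_CSeries_le; [| exact A]. intro n. rewrite !Cmod_mult.
      apply Rmult_le_compat_l; [apply Cmod_ge_0 |].
      rewrite !Cmod_pow, Cmod_R, Rabs_pos_eq by lra. apply pow_incr.
      split; [apply Cmod_ge_0 | auto].
Qed.

Lemma ps_lim_0 (c : nat -> C) (rho : R) (w : nat -> C) :
  (0 < rho)%R -> Cabs (fun n => c n * RtoC rho ^ n) -> Clim w 0 ->
  Clim (fun n => ps c (w n)) (c O).
Proof.
  intros Hr H Hw. destruct (ps_lipschitz c rho Hr H) as [K [HK HL]].
  apply Clim_Cmod in Hw.
  assert (Hw' : is_lim_seq (fun n => Cmod (w n)) 0).
  { eapply is_lim_seq_ext; [| exact Hw]. intro n. simpl. f_equal; ring. }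
  assert (E := Hw'). apply is_lim_seq_spec in E.
  destruct (E (mkposreal rho Hr)) as [N HN]. simpl in HN.
  apply (Clim_incr N). 
  replace (c O) with (0 + c O) by ring.
  apply Clim_ext with (fun n => (ps c (w (n + N)%nat) - c O) + c O); [intro; ring |].
  apply Clim_plus; [| apply Clim_const].
  apply Clim_0_le with (fun n => (K * Cmod (w (n + N)%nat))%R).
  - intro n. apply HL. specialize (HN (n + N)%nat (Nat.le_add_l _ _)).
    rewrite Rminus_0_r, Rabs_pos_eq in HN by apply Cmod_ge_0. lra.
  - replace (Finite 0) with (Finite (K * 0)) by (f_equal; ring).
    apply is_lim_seq_mult'; [apply is_lim_seq_const |].
    now apply -> (is_lim_seq_incr_n (fun n => Cmod (w n)) N).
Qed.

(** A power series is determined by its values on any sequence of nonzero points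
    tending to the origin: divide by the first power not yet known to be absent
    and pass to the limit. *)
Lemma ps_zero (c : nat -> C) (rho : R) (w : nat -> C) :
  (0 < rho)%R -> Cabs (fun n => c n * RtoC rho ^ n) -> Clim w 0 ->
  (forall n, w n <> 0 /\ (Cmod (w n) <= rho)%R /\ ps c (w n) = 0) ->
  forall n, c n = 0.
Proof.
  intros Hr H Hw Hz n. revert c H Hz. 
  assert (H0 : forall c, Cabs (fun n => c n * RtoC rho ^ n) ->
     (forall n, w n <> 0 /\ (Cmod (w n) <= rho)%R /\ ps c (w n) = 0) -> c O = 0).
  { intros c H Hz. apply (Clim_unique (fun n => ps c (w n))).
    - now apply ps_lim_0 with rho.
    - apply Clim_ext with (fun _ => 0); [intro k; symmetry; apply Hz | apply Clim_const]. }
  induction n; intros c H Hz; [now apply H0 |].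
  assert (Hr0 : RtoC rho <> 0) by (apply RtoC_neq_0; lra).
  apply (IHn (fun n => c (S n))).
  - now apply (ps_step c (RtoC rho)).
  - intro k. destruct (Hz k) as [A [B E]]. repeat split; auto.
    rewrite (proj2 (ps_step c (w k) (Cabs_ps _ _ _ H B) A)), (H0 c H Hz) in E.
    destruct (Ceq_dec (ps (fun n => c (S n)) (w k)) 0) as [F | F]; auto.
    exfalso. apply (Cmult_neq_0 _ _ A F). rewrite <- E. ring.
Qed.

(** * The q-binomial theorem *)

Definition qbin (q : R) (c : C) (k : nat) : C := qpoch q c k / qpoch q q k.

Lemma qbin_0 (q : R) (c : C) : qbin q c 0 = 1.
Proof. unfold qbin; simpl. field. Qed.

Lemma qbin_S (q : R) (c : C) (k : nat) :
  (0 < q < 1)%R ->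
  qbin q c (S k) * (1 - q ^ S k) = qbin q c k * (1 - c * q ^ k).
Proof.
  intros Hq. unfold qbin. rewrite !qpoch_S. simpl Cpow.
  field. split.
  - apply qpoch_neq_0. now apply qregular_q.
  - exact (qpow_S_neq_1 q k Hq).
Qed.

Lemma qbin_bounded (q : R) (c : C) :
  (0 < q < 1)%R -> exists M, (0 <= M)%R /\ forall k, (Cmod (qbin q c k) <= M)%R.
Proof. intros Hq. apply qpoch_div_bounded; auto using qregular_q. Qed.

Lemma Cabs_qbin (q : R) (c s : C) :
  (0 < q < 1)%R -> (Cmod s < 1)%R -> Cabs (fun k => qbin q c k * s ^ k).
Proof.
  intros Hq Hs. destruct (qbin_bounded q c Hq) as [M [_ HM]].
  now apply Cabs_ps_bounded with M.
Qed.

Lemma Cmod_mult_q_lt (q : R) (s : C) (r : R) :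
  (0 < q < 1)%R -> (Cmod s < r)%R -> (Cmod (s * q) < r)%R.
Proof.
  intros Hq Hs. rewrite Cmod_mult, Cmod_R, Rabs_pos_eq by lra.
  pose proof (Cmod_ge_0 s). nra.
Qed.

Lemma Cmod_mult_qpow_le (q : R) (s : C) (n : nat) :
  (0 < q < 1)%R -> (Cmod (s * q ^ n) <= Cmod s)%R.
Proof.
  intros Hq. rewrite Cmod_mult, Cmod_qpow by auto.
  pose proof (Cmod_ge_0 s). pose proof (qpow_le_1 q n Hq). nra.
Qed.

Lemma Cmod_mult_qpow_lt (q : R) (s : C) (n : nat) (r : R) :
  (0 < q < 1)%R -> (Cmod s < r)%R -> (Cmod (s * q ^ n) < r)%R.
Proof. intros Hq Hs. eapply Rle_lt_trans; [now apply Cmod_mult_qpow_le | exact Hs]. Qed.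

(** The sum g of the series satisfies (1 - s) g(s) = (1 - c s) g(q s), and this
    recursion is solved by the infinite product because g(q^n s) tends to 1. *)
Theorem q_binomial (q : R) (c s : C) :
  (0 < q < 1)%R -> (Cmod s < 1)%R ->
  ps (qbin q c) s = qpoch_inf q (c * s) / qpoch_inf q s.
Proof.
  intros Hq Hs.
  assert (step : forall t, (Cmod t < 1)%R ->
            (1 - t) * ps (qbin q c) t = (1 - c * t) * ps (qbin q c) (t * q)).
  { intros t Ht.
    assert (A1 := Cabs_qbin q c t Hq Ht).
    assert (A2 := Cabs_qbin q c (t * q) Hq (Cmod_mult_q_lt q t 1 Hq Ht)).
    assert (E : ps (qbin q c) t + - (1) * ps (qbin q c) (t * q) =
                t * (ps (qbin q c) t + - c * ps (qbin q c) (t * q))).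
    { unfold ps. rewrite <- !CSeries_scal, <- !CSeries_plus, <- !CSeries_scal by
        auto using Cabs_plus, Cabs_scal.
      rewrite CSeries_S by auto using Cabs_plus, Cabs_scal.
      rewrite qbin_0. simpl Cpow at 1 2.
      replace (1 * 1 + - (1) * (1 * 1)) with (RtoC 0) by ring. rewrite Cplus_0_l.
      apply CSeries_ext. intro k. rewrite !Cpow_mult_l.
      transitivity (qbin q c (S k) * (1 - q ^ S k) * t ^ S k); [ring |].
      rewrite qbin_S by auto. simpl. ring. }
    transitivity (ps (qbin q c) t + - (1) * ps (qbin q c) (t * q)
                  + ps (qbin q c) (t * q) - t * ps (qbin q c) t); [ring |].
    rewrite E. ring. }
  assert (it : forall n, qpoch q s n * ps (qbin q c) s =
                         qpoch q (c * s) n * ps (qbin q c) (s * q ^ n)).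
  { induction n.
    - simpl. replace (s * 1) with s by ring. ring.
    - rewrite !qpoch_S.
      replace (qpoch q s n * (1 - s * q ^ n) * ps (qbin q c) s) with
        ((1 - s * q ^ n) * (qpoch q s n * ps (qbin q c) s)) by ring.
      rewrite IHn.
      replace ((1 - s * q ^ n) * (qpoch q (c * s) n * ps (qbin q c) (s * q ^ n)))
        with (qpoch q (c * s) n *
              ((1 - s * q ^ n) * ps (qbin q c) (s * q ^ n))) by ring.
      rewrite step.
      + replace (s * q ^ S n) with (s * q ^ n * q) by (simpl; ring). ring.
      + now apply Cmod_mult_qpow_lt. }
  assert (L : qpoch_inf q s * ps (qbin q c) s = qpoch_inf q (c * s) * 1).
  { apply (Clim_unique (fun n => qpoch q s n * ps (qbin q c) s)).
    - apply Clim_mult; [now apply qpoch_lim | apply Clim_const].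
    - apply Clim_ext with (fun n => qpoch q (c * s) n * ps (qbin q c) (s * q ^ n)).
      { intro n. now rewrite it. }
      apply Clim_mult; [now apply qpoch_lim |].
      rewrite <- (qbin_0 q c).
      apply ps_lim_0 with (/ 2)%R; [lra | |].
      + apply Cabs_qbin; auto. rewrite Cmod_R, Rabs_pos_eq; lra.
      + replace (RtoC 0) with (s * 0) by ring. apply Clim_scal. now apply qpow_lim_0. }
  assert (N := qpoch_inf_neq_0 q s Hq (qregular_small q s Hq Hs)).
  apply (f_equal (fun x => x / qpoch_inf q s)) in L.
  rewrite Cmult_1_r in L. rewrite <- L. field. exact N.
Qed.

(** * Power series and the hypergeometric q-difference equation *)

Lemma ps_scal (k : C) (c : nat -> C) (z : C) :
  Cabs (fun n => c n * z ^ n) -> ps (fun n => k * c n) z = k * ps c z.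
Proof.
  intros Hc. unfold ps. rewrite <- CSeries_scal by auto. apply CSeries_ext; intro; ring.
Qed.

Lemma ps_dilate (c : nat -> C) (k z : C) : ps c (z * k) = ps (fun n => c n * k ^ n) z.
Proof. apply CSeries_ext; intro. rewrite Cpow_mult_l. ring. Qed.

Lemma ps_ext (c d : nat -> C) (z : C) : (forall n, c n = d n) -> ps c z = ps d z.
Proof. intro H. apply CSeries_ext. intro; now rewrite H. Qed.

(** The equation (1 - T)(1 - C T / q) F = z (1 - A T)(1 - B T) F, with T the
    dilation by q, along the points z q^n. *)
Definition hyp_eq (q : R) (A B C0 z : C) (F : nat -> C) : Prop :=
  forall n,
    F n - F (S n) - C0 / q * (F (S n) - F (S (S n))) =
    z * q ^ n * (F n - (A + B) * F (S n) + A * B * F (S (S n))).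

(** On coefficients the hypergeometric operator is a two-term recursion; this is where
    the one of 2phi1 comes from. *)
Lemma ps_hyp_eq (q : R) (A B C0 : C) (c : nat -> C) (rho : R) (z : C) :
  (0 < q < 1)%R -> (0 < rho)%R -> Cabs (fun n => c n * RtoC rho ^ n) ->
  (Cmod z <= rho)%R ->
  ps c z - ps c (z * q)
    - C0 / q * (ps c (z * q) - ps c (z * q * q))
    - z * (ps c z - (A + B) * ps c (z * q) + A * B * ps c (z * q * q))
  = z * ps (fun n => c (S n) * (1 - q ^ S n) * (1 - C0 * q ^ n)
                     - c n * (1 - A * q ^ n) * (1 - B * q ^ n)) z.
Proof.
  intros Hq Hr H Hz.
  assert (Hr0 : RtoC rho <> 0) by (apply RtoC_neq_0; lra).
  assert (Hq0 := q_neq_0 q Hq).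
  assert (H1 : Cabs (fun n => c (S n) * RtoC rho ^ n)) by now apply (ps_step c (RtoC rho)).
  assert (A0 := Cabs_ps _ _ _ H Hz). assert (A1 := Cabs_ps _ _ _ H1 Hz).
  cbv beta in A1.
  assert (Aq : forall (d : nat -> C) (k : nat), Cabs (fun n => d n * z ^ n) ->
            Cabs (fun n => (q ^ k) ^ n * (d n * z ^ n))).
  { intros d k Hd. apply Cabs_bounded_mult with 1%R; auto. intro n.
    rewrite <- Cpow_mult_r, Cmod_qpow by auto. now apply qpow_le_1. }
  assert (B0 := Aq c 1%nat A0). assert (B1 := Aq (fun n => c (S n)) 1%nat A1).
  assert (D0 := Aq c 2%nat A0). assert (D1 := Aq (fun n => c (S n)) 2%nat A1).
  cbv beta in B1, D1.
  assert (St : forall k, ps c (z * q ^ k) =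
     c O + z * (q ^ k * CSeries (fun n => (q ^ k) ^ n * (c (S n) * z ^ n)))).
  { intro k. unfold ps. rewrite CSeries_S.
    - simpl Cpow at 1. f_equal; [ring |].
      rewrite <- CSeries_scal by (apply (Aq (fun n => c (S n))); exact A1).
      rewrite <- CSeries_scal by (apply Cabs_scal, (Aq (fun n => c (S n))); exact A1).
      apply CSeries_ext. intro n. rewrite Cpow_mult_l. simpl. ring.
    - apply (Cabs_ext (fun n => (q ^ k) ^ n * (c n * z ^ n))); auto.
      intro n; rewrite Cpow_mult_l; ring. }
  assert (Pq : forall k, ps c (z * q ^ k) = CSeries (fun n => (q ^ k) ^ n * (c n * z ^ n))).
  { intro k. apply CSeries_ext. intro n. rewrite Cpow_mult_l. ring. }
  assert (E2 : z * q * q = z * q ^ 2) by (simpl; ring).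
  assert (E1 : z * q = z * q ^ 1) by (simpl; ring).
  assert (E0 : z = z * q ^ 0) by (simpl; ring).
  rewrite E2, E1.
  set (U0 := CSeries (fun n => c (S n) * z ^ n)).
  set (U1 := CSeries (fun n => (q ^ 1) ^ n * (c (S n) * z ^ n))).
  set (U2 := CSeries (fun n => (q ^ 2) ^ n * (c (S n) * z ^ n))).
  set (V0 := CSeries (fun n => c n * z ^ n)).
  set (V1 := CSeries (fun n => (q ^ 1) ^ n * (c n * z ^ n))).
  set (V2 := CSeries (fun n => (q ^ 2) ^ n * (c n * z ^ n))).
  assert (RH : ps (fun n => c (S n) * (1 - q ^ S n) * (1 - C0 * q ^ n)
                     - c n * (1 - A * q ^ n) * (1 - B * q ^ n)) z =
     U0 + ((- (q + C0)) * U1 + (C0 * q * U2 +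
       ((- (RtoC 1)) * V0 + ((A + B) * V1 + (- (A * B)) * V2))))).
  { unfold U0, U1, U2, V0, V1, V2, ps.
    rewrite <- !CSeries_scal by auto.
    rewrite <- !CSeries_plus by auto 9 using Cabs_plus, Cabs_scal.
    apply CSeries_ext. intro n. rewrite Cpow_1_r, <- Cpow_mult_r, Nat.mul_comm, Cpow_mult_r.
    simpl. ring. }
  rewrite RH.
  assert (S0 : ps c z = c O + z * U0).
  { rewrite E0 at 1. rewrite St. unfold U0. f_equal. f_equal.
    simpl. rewrite Cmult_1_l. apply CSeries_ext. intro n. rewrite Cpow_1_l. ring. }
  change V0 with (ps c z). replace V1 with (ps c (z * q ^ 1)) by apply Pq.
  replace V2 with (ps c (z * q ^ 2)) by apply Pq.
  assert (S1 := St 1%nat). assert (S2 := St 2%nat). fold U1 in S1. fold U2 in S2.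
  rewrite S0, S1, S2. simpl. field. auto.
Qed.

Definition hyp_coef (q : R) (A B C0 : C) (j : nat) : C :=
  qpoch q A j * qpoch q B j / (qpoch q q j * qpoch q C0 j).

Definition phi21 (q : R) (A B C0 z : C) : C := ps (hyp_coef q A B C0) z.

Lemma hyp_coef_S (q : R) (A B C0 : C) (j : nat) :
  (0 < q < 1)%R -> qregular q C0 ->
  hyp_coef q A B C0 (S j) * (1 - q ^ S j) * (1 - C0 * q ^ j) =
  hyp_coef q A B C0 j * (1 - A * q ^ j) * (1 - B * q ^ j).
Proof.
  intros Hq HC. unfold hyp_coef. rewrite !qpoch_S.
  assert (H1 := qpow_S_neq_1 q j Hq).
  assert (H2 := qpoch_neq_0 q q j (qregular_q q Hq)).
  assert (H3 := qpoch_neq_0 q C0 j HC). assert (H4 := qregular_factor q C0 j HC).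
  simpl Cpow in *. field. auto.
Qed.

Lemma hyp_coef_0 (q : R) (A B C0 : C) : hyp_coef q A B C0 0 = 1.
Proof. unfold hyp_coef; simpl; field. Qed.

Lemma hyp_coef_bounded (q : R) (A B C0 : C) :
  (0 < q < 1)%R -> qregular q C0 ->
  exists M, (0 <= M)%R /\ forall n, (Cmod (hyp_coef q A B C0 n) <= M)%R.
Proof.
  intros Hq HC.
  destruct (qpoch_div_bounded q A C0 Hq HC) as [M1 [P1 H1]].
  destruct (qpoch_div_bounded q B q Hq (qregular_q q Hq)) as [M2 [P2 H2]].
  exists (M1 * M2)%R. split; [now apply Rmult_le_pos |]. intro n.
  replace (hyp_coef q A B C0 n) with
    (qpoch q A n / qpoch q C0 n * (qpoch q B n / qpoch q q n)).
  - rewrite Cmod_mult. apply Rmult_le_compat; auto using Cmod_ge_0.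
  - unfold hyp_coef. field. split; apply qpoch_neq_0; auto using qregular_q.
Qed.

Lemma Cabs_hyp (q : R) (A B C0 z : C) :
  (0 < q < 1)%R -> qregular q C0 -> (Cmod z < 1)%R ->
  Cabs (fun n => hyp_coef q A B C0 n * z ^ n).
Proof.
  intros Hq HC Hz. destruct (hyp_coef_bounded q A B C0 Hq HC) as [M [_ HM]].
  now apply Cabs_ps_bounded with M.
Qed.

Lemma radius_above (z : C) :
  (Cmod z < 1)%R -> exists r, (0 < r)%R /\ (Cmod z <= r)%R /\ (Cmod (RtoC r) < 1)%R.
Proof.
  intro H. pose proof (Cmod_ge_0 z). exists ((1 + Cmod z) / 2)%R.
  repeat split; [lra | lra |]. rewrite Cmod_R, Rabs_pos_eq; lra.
Qed.

Lemma phi21_hyp_eq (q : R) (A B C0 z : C) :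
  (0 < q < 1)%R -> qregular q C0 -> (Cmod z < 1)%R ->
  hyp_eq q A B C0 z (fun n => phi21 q A B C0 (z * q ^ n)).
Proof.
  intros Hq HC Hz n.
  assert (Hzn : (Cmod (z * q ^ n) < 1)%R)
    by (now apply Cmod_mult_qpow_lt).
  destruct (radius_above _ Hzn) as [r [R0 [R1 R2]]].
  assert (H := ps_hyp_eq q A B C0 (hyp_coef q A B C0) r (z * q ^ n) Hq R0
                 (Cabs_hyp q A B C0 _ Hq HC R2) R1).
  replace (z * q ^ n * q) with (z * q ^ S n) in H by (simpl; ring).
  replace (z * q ^ S n * q) with (z * q ^ S (S n)) in H by (simpl; ring).
  assert (E0 : forall t, ps (fun k =>
      hyp_coef q A B C0 (S k) * (1 - q ^ S k) * (1 - C0 * q ^ k)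
      - hyp_coef q A B C0 k * (1 - A * q ^ k) * (1 - B * q ^ k)) t = 0).
  { intro t. apply CSeries_0. intro k. rewrite hyp_coef_S by auto. ring. }
  rewrite E0, Cmult_0_r in H. unfold phi21. apply Ceq_minus. exact H.
Qed.

(** A power series solution of the hypergeometric equation is determined by its
    constant term, since C q^n never equals 1. *)
Lemma hyp_eq_ps_unique (q : R) (A B C0 : C) (c : nat -> C) (rho : R) :
  (0 < q < 1)%R -> qregular q C0 -> (0 < rho)%R ->
  Cabs (fun n => c n * RtoC rho ^ n) ->
  hyp_eq q A B C0 (RtoC rho) (fun n => ps c (RtoC rho * q ^ n)) ->
  forall n, c n = c O * hyp_coef q A B C0 n.
Proof.
  intros Hq HC Hr Hc He.
  set (d := fun n => c (S n) * (1 - q ^ S n) * (1 - C0 * q ^ n)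
                     - c n * (1 - A * q ^ n) * (1 - B * q ^ n)).
  assert (Hr0 : RtoC rho <> 0) by (apply RtoC_neq_0; lra).
  assert (Hw : forall k, (Cmod (RtoC rho * q ^ k) <= rho)%R).
  { intro k. eapply Rle_trans; [now apply Cmod_mult_qpow_le |].
    rewrite Cmod_R, Rabs_pos_eq; lra. }
  assert (Hd : forall n, d n = 0).
  { apply ps_zero with rho (fun n => RtoC rho * q ^ n); auto.
    - assert (H1 : Cabs (fun n => c (S n) * RtoC rho ^ n)) by now apply (ps_step c (RtoC rho)).
      assert (bd : forall (x : C) n, (Cmod (1 - x * q ^ n) <= 1 + Cmod x)%R).
      { intros x n. eapply Rle_trans; [apply Cmod_triangle |].
        rewrite Cmod_1, Cmod_opp. pose proof (Cmod_mult_qpow_le q x n Hq). lra. }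
      apply (Cabs_ext (fun n =>
         ((1 - q * q ^ n) * (1 - C0 * q ^ n)) * (c (S n) * RtoC rho ^ n)
         + (- (1) * (1 - A * q ^ n) * (1 - B * q ^ n)) * (c n * RtoC rho ^ n))).
      { intro n. unfold d. simpl. ring. }
      apply Cabs_plus.
      + apply Cabs_bounded_mult with ((1 + Cmod q) * (1 + Cmod C0))%R; auto.
        intro n. rewrite Cmod_mult. apply Rmult_le_compat; auto using Cmod_ge_0.
      + apply Cabs_bounded_mult with ((1 + Cmod A) * (1 + Cmod B))%R; auto.
        intro n. rewrite !Cmod_mult, Cmod_opp, Cmod_1, Rmult_1_l.
        apply Rmult_le_compat; auto using Cmod_ge_0.
    - replace (RtoC 0) with (RtoC rho * 0) by ring. apply Clim_scal. now apply qpow_lim_0.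
    - intro n. assert (Hn : RtoC rho * q ^ n <> 0)
        by (apply Cmult_neq_0; auto; apply Cpow_nz; now apply q_neq_0).
      repeat split; auto.
      assert (H := ps_hyp_eq q A B C0 c rho (RtoC rho * q ^ n) Hq Hr Hc (Hw n)).
      specialize (He n).
      replace (RtoC rho * q ^ n * q) with (RtoC rho * q ^ S n) in H
        by (simpl; ring).
      replace (RtoC rho * q ^ S n * q) with (RtoC rho * q ^ S (S n)) in H
        by (simpl; ring).
      apply -> Ceq_minus in He. fold d in H.
      destruct (Ceq_dec (ps d (RtoC rho * q ^ n)) 0) as [E | E]; auto.
      exfalso. apply (Cmult_neq_0 _ _ Hn E). rewrite <- H. exact He. }
  induction n.
  - rewrite hyp_coef_0. ring.
  - specialize (Hd n). unfold d in Hd. apply (proj2 (Ceq_minus _ _)) in Hd.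
    assert (X := hyp_coef_S q A B C0 n Hq HC).
    assert (N1 := qpow_S_neq_1 q n Hq). assert (N2 := qregular_factor q C0 n HC).
    apply Ceq_minus.
    destruct (Ceq_dec (c (S n) - c O * hyp_coef q A B C0 (S n)) 0) as [E | E]; auto.
    exfalso. apply (Cmult_neq_0 _ _ (Cmult_neq_0 _ _ E N1) N2).
    transitivity (c (S n) * (1 - q ^ S n) * (1 - C0 * q ^ n) -
      c O * (hyp_coef q A B C0 (S n) * (1 - q ^ S n) * (1 - C0 * q ^ n)));
      [ring |].
    rewrite X, Hd, IHn. ring.
Qed.

(** ** Products of power series *)

Definition conv (a b : nat -> C) : nat -> C := diag (fun i j => a i * b j).

Lemma conv_pow (a b : nat -> C) (z : C) (p : nat) :
  conv a b p * z ^ p = diag (fun i j => (a i * z ^ i) * (b j * z ^ j)) p.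
Proof.
  unfold conv, diag. rewrite Cmult_comm, <- psum_scal. apply psum_ext. intros k Hk.
  replace p with (k + (p - k))%nat at 1 by lia. rewrite Cpow_add_r. ring.
Qed.

Lemma Cabs_conv (a b : nat -> C) (z : C) :
  Cabs (fun n => a n * z ^ n) -> Cabs (fun n => b n * z ^ n) ->
  Cabs (fun n => conv a b n * z ^ n).
Proof.
  intros Ha Hb. eapply Cabs_ext; [intro n; symmetry; apply conv_pow |].
  apply Cabs_diag with (fun i => Cmod (a i * z ^ i)) (fun j => Cmod (b j * z ^ j));
    auto using Cmod_ge_0.
  intros i j. rewrite Cmod_mult. lra.
Qed.

Lemma ps_conv (a b : nat -> C) (z : C) :
  Cabs (fun n => a n * z ^ n) -> Cabs (fun n => b n * z ^ n) ->
  ps (conv a b) z = ps a z * ps b z.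
Proof.
  intros Ha Hb. unfold ps at 1.
  rewrite (CSeries_ext _ _ (conv_pow a b z)).
  erewrite hasum_CSeries.
  2: apply fubini_diag with (fun i => Cmod (a i * z ^ i)) (fun j => Cmod (b j * z ^ j));
    auto using Cmod_ge_0.
  2: intros i j; rewrite Cmod_mult; lra.
  rewrite (CSeries_ext _ (fun i => ps b z * (a i * z ^ i))).
  - rewrite CSeries_scal by auto. unfold ps. ring.
  - intro i. rewrite CSeries_scal by auto. unfold ps. ring.
Qed.

(** ** Euler's transformation *)

(** Multiplying a solution by (z q^n;q)_inf / (v q^n;q)_inf with v = A B z / C
    exchanges the parameters A, B with C/A, C/B: the outer coefficients 1 - z q^n and
    (C/q)(1 - v q^(n+1)) of the equation become 1 - v q^n and (C/q)(1 - z q^(n+1)). *)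
Lemma hyp_eq_gauge (q : R) (A B C0 z v : C) (F : nat -> C) :
  (0 < q < 1)%R -> A <> 0 -> B <> 0 -> C0 <> 0 -> v = A * B * z / C0 ->
  qregular q v -> hyp_eq q A B C0 z F ->
  hyp_eq q (C0 / A) (C0 / B) C0 v
    (fun n => F n * (qpoch_inf q (z * q ^ n) / qpoch_inf q (v * q ^ n))).
Proof.
  intros Hq HA HB HC Hv Rv HF n. specialize (HF n).
  assert (Hq0 := q_neq_0 q Hq).
  assert (sp : forall (x : C) m, qpoch_inf q (x * q ^ m) =
             (1 - x * q ^ m) * qpoch_inf q (x * q ^ S m)).
  { intros x m. rewrite qpoch_inf_S by auto. f_equal. f_equal. simpl. ring. }
  rewrite (sp z n), (sp v n), (sp z (S n)), (sp v (S n)).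
  assert (Q := qpoch_inf_neq_0 q _ Hq (qregular_shift q v (S (S n)) Rv)).
  assert (N0 := qregular_factor q v n Rv). assert (N1 := qregular_factor q v (S n) Rv).
  set (P := qpoch_inf q (z * q ^ S (S n))) in *.
  set (Q0 := qpoch_inf q (v * q ^ S (S n))) in *.
  set (x := q ^ n) in *.
  assert (Ez : z = v * C0 / (A * B)) by (rewrite Hv; field; auto).
  simpl Cpow in *. fold x in N1, N0 |- *.
  (* A B z = C v writes the last coefficient as (C/q)(1 - v q^(n+1)) *)
  assert (E : (1 - z * x) * F n =
     (1 + C0 / q - (A + B) * (z * x)) * F (S n)
     - (C0 / q) * (1 - v * (q * x)) * F (S (S n))).
  { apply Ceq_minus. apply -> Ceq_minus in HF. rewrite <- HF.
    rewrite Hv. field. auto. }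
  apply Ceq_minus.
  transitivity (P / Q0 * (1 - z * (q * x)) / (1 - v * (q * x)) *
     ((1 - z * x) * F n
      - ((1 + C0 / q - (A + B) * (z * x)) * F (S n)
         - (C0 / q) * (1 - v * (q * x)) * F (S (S n))))).
  - rewrite Ez. field. repeat split; auto.
  - rewrite E. ring.
Qed.

(** Both factors of the left-hand side are power series in v = A B z / C (the second
    one by the q-binomial theorem), and their product solves the equation of the
    right-hand side. *)
Theorem euler_transformation (q : R) (A B C0 z v : C) :
  (0 < q < 1)%R -> A <> 0 -> B <> 0 -> C0 <> 0 -> qregular q C0 -> v = A * B * z / C0 ->
  (Cmod z < 1)%R -> (Cmod v < 1)%R ->
  phi21 q A B C0 z * (qpoch_inf q z / qpoch_inf q v) = phi21 q (C0 / A) (C0 / B) C0 v.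
Proof.
  intros Hq HA HB HC RC Hv Hz Hv1.
  set (k := A * B / C0).
  assert (Hk : k <> 0).
  { unfold k. apply Cmult_neq_0; [now apply Cmult_neq_0 |].
    intro E. apply C1_nz. rewrite <- (Cinv_r C0 HC), E. ring. }
  set (c := conv (fun n => hyp_coef q A B C0 n * (/ k) ^ n) (qbin q (/ k))).
  assert (Hab : forall u, (Cmod u < 1)%R -> (Cmod (u * / k) < 1)%R ->
      Cabs (fun n => c n * u ^ n) /\
      ps c u = phi21 q A B C0 (u * / k) * (qpoch_inf q (u * / k) / qpoch_inf q u)).
  { intros u Hu Hu'.
    assert (A1 : Cabs (fun n => hyp_coef q A B C0 n * (/ k) ^ n * u ^ n)).
    { apply (Cabs_ext (fun n => hyp_coef q A B C0 n * (u * / k) ^ n)).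
      - intro n. rewrite Cpow_mult_l. ring.
      - now apply Cabs_hyp. }
    assert (A2 := Cabs_qbin q (/ k) u Hq Hu).
    split; [now apply Cabs_conv |].
    unfold c. rewrite ps_conv by auto. f_equal.
    - unfold phi21. now rewrite ps_dilate.
    - rewrite q_binomial by auto. do 2 f_equal. ring. }
  assert (Hz' : z = v * / k) by (rewrite Hv; unfold k; field; auto).
  destruct (Hab v) as [_ E]; [auto | now rewrite <- Hz' |].
  rewrite <- Hz' in E. rewrite <- E. unfold phi21. apply ps_ext.
  assert (c0 : c O = 1).
  { unfold c, conv, diag. simpl. rewrite hyp_coef_0, qbin_0. ring. }
  pose proof (proj1 (Cmod_gt_0 k) Hk) as Pk.
  set (r := Rmin (/ 2) (Cmod k / 2)).
  assert (Hr : (0 < r)%R) by (apply Rmin_glb_lt; lra).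
  assert (Cr : Cmod (RtoC r) = r) by (rewrite Cmod_R, Rabs_pos_eq; lra).
  assert (Hr1 : (Cmod (RtoC r) < 1)%R).
  { rewrite Cr. unfold r. eapply Rle_lt_trans; [apply Rmin_l | lra]. }
  assert (Hr2 : (Cmod (RtoC r * / k) < 1)%R).
  { rewrite Cmod_mult, Cmod_inv, Cr by auto.
    apply Rle_lt_trans with (Cmod k / 2 * / Cmod k)%R.
    - apply Rmult_le_compat_r; [left; now apply Rinv_0_lt_compat | apply Rmin_r].
    - unfold Rdiv. rewrite Rmult_assoc, (Rmult_comm (/ 2)), <- Rmult_assoc, Rinv_r; lra. }
  intro n. replace (hyp_coef q (C0 / A) (C0 / B) C0 n) with
    (c O * hyp_coef q (C0 / A) (C0 / B) C0 n) by (rewrite c0; ring).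
  apply hyp_eq_ps_unique with r; auto; [now apply Hab |].
  assert (G := hyp_eq_gauge q A B C0 (RtoC r * / k) (RtoC r)
    (fun n => phi21 q A B C0 (RtoC r * / k * q ^ n)) Hq HA HB HC).
  assert (Ex : forall m, ps c (RtoC r * q ^ m) =
     phi21 q A B C0 (RtoC r * / k * q ^ m) *
     (qpoch_inf q (RtoC r * / k * q ^ m) / qpoch_inf q (RtoC r * q ^ m))).
  { intro m. replace (RtoC r * / k * q ^ m) with (RtoC r * q ^ m * / k) by ring.
    apply Hab.
    - now apply Cmod_mult_qpow_lt.
    - replace (RtoC r * q ^ m * / k) with (RtoC r * / k * q ^ m) by ring.
      now apply Cmod_mult_qpow_lt. }
  intro m. rewrite !Ex. apply G.
  - unfold k. field. auto.
  - now apply qregular_small.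
  - now apply phi21_hyp_eq.
Qed.

(** ** Dilation series applied to hypergeometric series *)

Lemma Cmod_pow_lt_1 (s : C) : (Cmod s < 1)%R -> ex_series (fun n => Cmod (s ^ n)).
Proof.
  intro H. eapply (ex_series_ext (K := R_AbsRing) (V := R_NormedModule));
    [| apply (ex_series_geom (Cmod s))].
  - intro n. simpl. now rewrite Cmod_pow.
  - rewrite Rabs_pos_eq; [auto | apply Cmod_ge_0].
Qed.

(** Dilation by q acts on z^n as multiplication by q^n, so the q-binomial theorem
    sums the dilation series coefficient by coefficient. *)
Lemma dilation_series_ps (q : R) (m s : C) (c : nat -> C) (z : C) :
  (0 < q < 1)%R -> (Cmod s < 1)%R -> Cabs (fun n => c n * z ^ n) ->
  CSeries (fun k => qbin q m k * s ^ k * ps c (z * q ^ k)) =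
  ps (fun n => c n * (qpoch_inf q (m * s * q ^ n) / qpoch_inf q (s * q ^ n))) z.
Proof.
  intros Hq Hs Hc.
  set (a := fun n k => (c n * z ^ n) * (qbin q m k * (s * q ^ n) ^ k)).
  assert (Hsn : forall n, (Cmod (s * q ^ n) < 1)%R)
    by (intro n; now apply Cmod_mult_qpow_lt).
  transitivity (CSeries (fun n => CSeries (a n))).
  - rewrite <- (hasum_CSeries _ _ (fubini_swap a (fun n => Cmod (c n * z ^ n))
       (fun k => Cmod (qbin q m k * s ^ k))
       ltac:(intros i j; unfold a; rewrite Cmod_mult; apply Rmult_le_compat_l;
             [apply Cmod_ge_0 |]; rewrite !Cmod_mult, !Cmod_pow;
             apply Rmult_le_compat_l; [apply Cmod_ge_0 |];
             apply pow_incr; split; [apply Cmod_ge_0 | now apply Cmod_mult_qpow_le])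
       Hc (Cabs_qbin q m s Hq Hs) (fun n => Cmod_ge_0 _) (fun n => Cmod_ge_0 _))).
    apply CSeries_ext. intro k. unfold ps, a. rewrite <- CSeries_scal.
    + apply CSeries_ext. intro n. rewrite !Cpow_mult_l, <- !Cpow_mult_r, (Nat.mul_comm k n).
      ring.
    + apply (Cabs_ext (fun n => (q ^ k) ^ n * (c n * z ^ n))).
      * intro n. rewrite Cpow_mult_l. ring.
      * apply Cabs_bounded_mult with 1%R; auto. intro n.
        rewrite <- Cpow_mult_r, Cmod_qpow by auto. now apply qpow_le_1.
  - apply CSeries_ext. intro n. unfold a. rewrite CSeries_scal by now apply Cabs_qbin.
    change (CSeries (fun k => qbin q m k * (s * q ^ n) ^ k)) with
      (ps (qbin q m) (s * q ^ n)).
    rewrite q_binomial by auto.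
    replace (m * (s * q ^ n)) with (m * s * q ^ n) by ring. ring.
Qed.

(** The quotient (m C q^n;q)_inf/(C q^n;q)_inf replaces the factor 1/(C;q)_n of the
    n-th coefficient by 1/(m C;q)_n. *)
Lemma dilation_series_raise_lower_parameter (q : R) (A B C0 m z : C) :
  (0 < q < 1)%R -> (Cmod C0 < 1)%R -> qregular q (C0 * m) -> (Cmod z < 1)%R ->
  CSeries (fun k => qbin q m k * C0 ^ k * phi21 q A B C0 (z * q ^ k)) =
  qpoch_inf q (C0 * m) / qpoch_inf q C0 * phi21 q A B (C0 * m) z.
Proof.
  intros Hq HC RC Hz.
  assert (RC0 := qregular_small q C0 Hq HC).
  unfold phi21. rewrite dilation_series_ps by auto using Cabs_hyp.
  rewrite <- ps_scal by auto using Cabs_hyp. apply ps_ext. intro n.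
  rewrite (qpoch_inf_split q (C0 * m) n), (qpoch_inf_split q C0 n) by auto.
  replace (m * C0) with (C0 * m) by ring. unfold hyp_coef.
  assert (qpoch_inf q (C0 * q ^ n) <> 0)
    by (apply qpoch_inf_neq_0; auto; now apply qregular_shift).
  assert (H1 := qpoch_neq_0 q q n (qregular_q q Hq)).
  assert (H2 := qpoch_neq_0 q _ n RC). assert (H3 := qpoch_neq_0 q _ n RC0).
  field. auto.
Qed.

(** The quotient (A q^n;q)_inf/(A q^n/c;q)_inf replaces the factor (A;q)_n of the n-th
    coefficient by (A/c;q)_n. *)
Lemma dilation_series_lower_upper_parameter (q : R) (A B C0 c z : C) :
  (0 < q < 1)%R -> c <> 0 -> (Cmod (A / c) < 1)%R -> qregular q C0 -> (Cmod z < 1)%R ->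
  CSeries (fun k => qbin q c k * (A / c) ^ k * phi21 q A B C0 (z * q ^ k)) =
  qpoch_inf q A / qpoch_inf q (A / c) * phi21 q (A / c) B C0 z.
Proof.
  intros Hq Hc HA RC Hz.
  assert (RA := qregular_small q (A / c) Hq HA).
  unfold phi21. rewrite dilation_series_ps by auto using Cabs_hyp.
  rewrite <- ps_scal by auto using Cabs_hyp. apply ps_ext. intro n.
  replace (c * (A / c)) with A by (field; auto).
  rewrite (qpoch_inf_split q A n), (qpoch_inf_split q (A / c) n) by auto.
  unfold hyp_coef.
  assert (qpoch_inf q (A / c * q ^ n) <> 0)
    by (apply qpoch_inf_neq_0; auto; now apply qregular_shift).
  assert (H1 := qpoch_neq_0 q q n (qregular_q q Hq)).
  assert (H2 := qpoch_neq_0 q _ n RA). assert (H3 := qpoch_neq_0 q _ n RC).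
  field. auto.
Qed.

(** * The analytic continuation of the hypergeometric series *)

Lemma eventually_bounded (u : nat -> C) (M : R) (N : nat) :
  (forall n, (N <= n)%nat -> (Cmod (u n) <= M)%R) ->
  exists K, (0 <= K)%R /\ forall n, (Cmod (u n) <= K)%R.
Proof.
  revert u. induction N; intros u H.
  - exists (Rmax 0 M). split; [apply Rmax_l |].
    intro n. eapply Rle_trans; [apply H; lia | apply Rmax_r].
  - destruct (IHN (fun n => u (S n))) as [K [K0 HK]]; [intros; apply H; lia |].
    exists (Rmax (Cmod (u O)) K). split; [eapply Rle_trans; [exact K0 | apply Rmax_r] |].
    intros [| n]; [apply Rmax_l |]. eapply Rle_trans; [apply HK | apply Rmax_r].
Qed.

Lemma eventually_away (u : nat -> C) (e : R) (N : nat) :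
  (0 < e)%R -> (forall n, u n <> 0) -> (forall n, (N <= n)%nat -> (e <= Cmod (u n))%R) ->
  exists d, (0 < d)%R /\ forall n, (d <= Cmod (u n))%R.
Proof.
  intros He. revert u. induction N; intros u H0 H.
  - exists e. split; [auto | intro; apply H; lia].
  - destruct (IHN (fun n => u (S n))) as [d [d0 Hd]]; [auto | intros; apply H; lia |].
    exists (Rmin (Cmod (u O)) d). split; [apply Rmin_glb_lt; auto; now apply Cmod_gt_0 |].
    intros [| n]; [apply Rmin_l |]. eapply Rle_trans; [apply Rmin_r | apply Hd].
Qed.

(** Abel's lemma: the terms at w are bounded, those at z are smaller by a geometric
    factor. *)
Lemma hasum_Cabs_inside (c : nat -> C) (w z l : C) :
  hasum (fun n => c n * w ^ n) l -> (Cmod z < Cmod w)%R -> Cabs (fun n => c n * z ^ n).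
Proof.
  intros H Hz. pose proof (Cmod_ge_0 z) as Pz.
  assert (L : Clim (fun n => c n * w ^ n) 0).
  { replace (RtoC 0) with (l - l) by ring.
    apply Clim_ext with (fun n => psum (fun n => c n * w ^ n) (n + 1) -
                                  psum (fun n => c n * w ^ n) n).
    - intro n. rewrite Nat.add_1_r. simpl. ring.
    - apply Clim_minus; [now apply (Clim_incr 1) in H | exact H]. }
  apply Clim_Cmod, is_lim_seq_spec in L. destruct (L (mkposreal 1 Rlt_0_1)) as [N HN].
  destruct (eventually_bounded (fun n => c n * w ^ n) 1 N) as [K [K0 HK]].
  { intros n Hn. specialize (HN n Hn). simpl in HN.
    rewrite Rminus_0_r, Rabs_pos_eq in HN by apply Cmod_ge_0.
    replace (c n * w ^ n - 0) with (c n * w ^ n) in HN by ring. lra. }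
  apply Cabs_geom with K (Cmod z / Cmod w)%R.
  - split; [apply Rmult_le_pos; [auto | left; apply Rinv_0_lt_compat; lra] |].
    apply Rmult_lt_reg_r with (Cmod w); [lra |].
    unfold Rdiv. rewrite Rmult_assoc, Rinv_l; lra.
  - intro n. specialize (HK n). rewrite Cmod_mult, Cmod_pow in HK |- *.
    unfold Rdiv. rewrite Rpow_mult_distr, pow_inv.
    assert (Pw : (0 < Cmod w ^ n)%R) by (apply pow_lt; lra).
    replace (Cmod (c n) * Cmod z ^ n)%R with
      ((Cmod (c n) * Cmod w ^ n) * (Cmod z ^ n * / Cmod w ^ n))%R by (field; lra).
    apply Rmult_le_compat_r; [| exact HK].
    apply Rmult_le_pos; [now apply pow_le | left; now apply Rinv_0_lt_compat].
Qed.

(** ** Closure properties of analyticity *)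

Lemma analytic_const (k z0 : C) : analytic_at (fun _ => k) z0.
Proof.
  exists (fun n => match n with O => k | S _ => RtoC 0 end), 1%R. split; [lra |]. intros z _.
  apply hasum_Cis_series.
  set (u := fun n => match n with O => k | S _ => RtoC 0 end * (z - z0) ^ n).
  assert (E : psum u 1 = k) by (unfold u; simpl; ring). rewrite <- E.
  apply hasum_finite. intros [| n] Hn; [lia | unfold u; ring].
Qed.

Lemma analytic_plus (F G : C -> C) (z0 : C) :
  analytic_at F z0 -> analytic_at G z0 -> analytic_at (fun z => F z + G z) z0.
Proof.
  intros [c [r [Hr Hc]]] [d [s [Hs Hd]]].
  exists (fun n => c n + d n), (Rmin r s). split; [now apply Rmin_glb_lt |].
  intros z Hz. apply hasum_Cis_series.
  apply hasum_ext with (fun n => c n * (z - z0) ^ n + d n * (z - z0) ^ n); [intro; ring |].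
  apply hasum_plus; apply hasum_Cis_series; [apply Hc | apply Hd];
    (eapply Rlt_le_trans; [exact Hz |]); [apply Rmin_l | apply Rmin_r].
Qed.

Lemma analytic_scal (k : C) (F : C -> C) (z0 : C) :
  analytic_at F z0 -> analytic_at (fun z => k * F z) z0.
Proof.
  intros [c [r [Hr Hc]]]. exists (fun n => k * c n), r. split; auto.
  intros z Hz. apply hasum_Cis_series.
  apply hasum_ext with (fun n => k * (c n * (z - z0) ^ n)); [intro; ring |].
  apply hasum_scal, hasum_Cis_series; auto.
Qed.

Lemma analytic_mult_var (F : C -> C) (z0 : C) :
  analytic_at F z0 -> analytic_at (fun z => z * F z) z0.
Proof.
  intros HF.
  assert (H : analytic_at (fun z => (z - z0) * F z) z0).
  { destruct HF as [c [r [Hr Hc]]].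
    exists (fun n => match n with O => RtoC 0 | S m => c m end), r. split; auto.
    intros z Hz. apply hasum_Cis_series.
    replace ((z - z0) * F z) with
      (psum (fun n => (match n with O => RtoC 0 | S m => c m end) * (z - z0) ^ n) 1
       + (z - z0) * F z) by (simpl; ring).
    apply -> (hasum_incr 1 (fun n => (match n with O => RtoC 0 | S m => c m end) * (z - z0) ^ n)).
    apply hasum_ext with (fun n => (z - z0) * (c n * (z - z0) ^ n)); [intro; simpl; ring |].
    apply hasum_scal, hasum_Cis_series; auto. }
  assert (G := analytic_plus _ _ z0 H (analytic_scal z0 F z0 HF)).
  destruct G as [c [r [Hr Hc]]]. exists c, r. split; auto.
  intros z Hz. replace (z * F z) with ((z - z0) * F z + z0 * F z) by ring. auto.
Qed.

Lemma analytic_dilate (k : C) (F : C -> C) (z0 : C) :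
  (Cmod k <= 1)%R -> analytic_at F (k * z0) -> analytic_at (fun z => F (k * z)) z0.
Proof.
  intros Hk [c [r [Hr Hc]]]. exists (fun n => c n * k ^ n), r. split; auto.
  intros z Hz. apply hasum_Cis_series.
  apply hasum_ext with (fun n => c n * (k * z - k * z0) ^ n).
  - intro n. replace (k * z - k * z0) with (k * (z - z0)) by ring.
    rewrite Cpow_mult_l. ring.
  - apply hasum_Cis_series, Hc.
    replace (k * z - k * z0) with (k * (z - z0)) by ring. rewrite Cmod_mult.
    pose proof (Cmod_ge_0 (z - z0)). nra.
Qed.

(** ** The identity theorem on the cut plane *)

Lemma cut_plane_scale (t : R) (z : C) :
  (0 <= t <= 1)%R -> cut_plane z -> cut_plane (RtoC t * z).
Proof.
  intros Ht Hz [H1 H2]. apply Hz. unfold Im, Re in *. simpl in *.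
  assert (0 < t)%R.
  { destruct (Req_dec t 0) as [-> |]; [| lra]. rewrite !Rmult_0_l in H2. lra. }
  split; nra.
Qed.

(** The cut plane is star-shaped about 0, so it is enough to follow a segment [0, z]:
    at the last point up to which F vanishes, the local power series vanishes on a
    sequence of points, hence identically, and F vanishes a little further. *)
Theorem identity_on_cut_plane (F : C -> C) :
  (forall z, cut_plane z -> analytic_at F z) ->
  (forall z, (Cmod z < 1)%R -> F z = 0) ->
  forall z, cut_plane z -> F z = 0.
Proof.
  intros HF H0 z Hz.
  destruct (Ceq_dec z 0) as [-> | Hz0]; [apply H0; rewrite Cmod_0; lra |].
  assert (Pz := proj1 (Cmod_gt_0 z) Hz0).
  set (P := fun t : R => (0 <= t <= 1)%R /\ forall s, (0 <= s <= t)%R -> F (RtoC s * z) = 0).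
  destruct (completeness P) as [T [HT1 HT2]].
  { exists 1%R. intros t [Ht _]; lra. }
  { exists 0%R. split; [lra |]. intros s Hs. replace s with 0%R by lra.
    apply H0. rewrite Cmult_0_l, Cmod_0; lra. }
  assert (below : forall s, (0 <= s < T)%R -> F (RtoC s * z) = 0).
  { intros s Hs. destruct (classic (exists t, P t /\ (s < t)%R)) as [[t [[_ Ht] Hst]] | N].
    - apply Ht; lra.
    - exfalso. apply (Rlt_not_le _ _ (proj2 Hs)). apply HT2. intros t Pt.
      destruct (Rle_lt_dec t s); auto. exfalso. apply N. exists t; auto. }
  assert (T1 : (T <= 1)%R) by (apply HT2; intros t [Ht _]; lra).
  assert (T0 : (0 < T)%R).
  { set (t := Rmin 1 (/ (2 * Cmod z))).
    assert (Pt : (0 < / (2 * Cmod z))%R) by (apply Rinv_0_lt_compat; lra).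
    assert (0 < t)%R by (apply Rmin_glb_lt; lra).
    apply Rlt_le_trans with t; auto. apply HT1. split; [split; [lra | apply Rmin_l] |].
    intros s Hs. apply H0. rewrite Cmod_mult, Cmod_R, Rabs_pos_eq by lra.
    apply Rle_lt_trans with (/ (2 * Cmod z) * Cmod z)%R.
    - apply Rmult_le_compat_r; [lra |]. eapply Rle_trans; [apply Hs | apply Rmin_r].
    - rewrite Rinv_mult, Rmult_assoc, Rinv_l; lra. }
  destruct (HF (RtoC T * z)) as [c [r [Hr Hc]]]; [apply cut_plane_scale; [lra | auto] |].
  assert (Hw : forall w, (Cmod w < r)%R ->
            hasum (fun n => c n * w ^ n) (F (RtoC T * z + w))).
  { intros w Hwr. assert (E : RtoC T * z + w - RtoC T * z = w) by ring.
    specialize (Hc (RtoC T * z + w)). rewrite E in Hc. now apply hasum_Cis_series, Hc. }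
  set (rho := (r / 2)%R).
  assert (Arho : Cabs (fun n => c n * RtoC rho ^ n)).
  { apply hasum_Cabs_inside with (RtoC (3 / 4 * r)) (F (RtoC T * z + RtoC (3 / 4 * r))).
    - apply Hw. rewrite Cmod_R, Rabs_pos_eq; lra.
    - rewrite !Cmod_R, !Rabs_pos_eq; unfold rho; lra. }
  set (dl := Rmin T (rho / Cmod z)).
  assert (Hdl : (0 < dl)%R).
  { apply Rmin_glb_lt; auto. apply Rmult_lt_0_compat; [unfold rho; lra |].
    now apply Rinv_0_lt_compat. }
  set (h := (/ 2)%R). assert (Hh : (0 < h < 1)%R) by (unfold h; lra).
  assert (Z : forall n, c n = 0).
  { apply ps_zero with rho (fun n => (- RtoC dl * z) * RtoC h ^ n).
    - unfold rho; lra.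
    - exact Arho.
    - replace (RtoC 0) with (- RtoC dl * z * 0) by ring. apply Clim_scal.
      now apply qpow_lim_0.
    - intro n. pose proof (qpow_le_1 h n Hh) as Hp.
      assert (Cm : (Cmod (- RtoC dl * z * RtoC h ^ n) <= rho)%R).
      { eapply Rle_trans; [now apply Cmod_mult_qpow_le |].
        rewrite Cmod_mult, Cmod_opp, Cmod_R, Rabs_pos_eq by lra.
        apply Rle_trans with (rho / Cmod z * Cmod z)%R.
        - apply Rmult_le_compat_r; [lra | apply Rmin_r].
        - unfold Rdiv. rewrite Rmult_assoc, Rinv_l; lra. }
      repeat split; auto.
      + apply Cmult_neq_0; [apply Cmult_neq_0; auto |].
        * intro E. apply (RtoC_neq_0 dl); [lra |].
          replace (RtoC dl) with (- (- RtoC dl)) by ring. rewrite E. ring.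
        * apply Cpow_nz. apply RtoC_neq_0. lra.
      + apply hasum_CSeries.
        assert (E : RtoC (T - dl * h ^ n) * z = RtoC T * z + - RtoC dl * z * RtoC h ^ n).
        { rewrite RtoC_minus, RtoC_mult, RtoC_pow. ring. }
        assert (dl <= T)%R by apply Rmin_l.
        rewrite <- (below (T - dl * h ^ n)%R) by (split; nra). rewrite E.
        apply Hw. unfold rho in Cm; lra. }
  assert (near : forall s, (Rabs (s - T) * Cmod z < r)%R -> F (RtoC s * z) = 0).
  { intros s Hs.
    assert (Hs' : (Cmod (RtoC s * z - RtoC T * z) < r)%R).
    { replace (RtoC s * z - RtoC T * z) with (RtoC (s - T) * z)
        by (rewrite RtoC_minus; ring).
      now rewrite Cmod_mult, Cmod_R. }
    specialize (Hc _ Hs'). apply hasum_Cis_series, hasum_CSeries in Hc.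
    rewrite <- Hc. apply CSeries_0. intro n. rewrite Z. ring. }
  set (T' := Rmin 1 (T + dl)).
  assert (PT : P T').
  { split.
    - split; [apply Rmin_glb; lra | apply Rmin_l].
    - intros s Hs. destruct (Rlt_le_dec s T) as [Hl | Hl]; [apply below; lra |].
      apply near. rewrite Rabs_pos_eq by lra.
      assert (s - T <= dl)%R by (assert (T' <= T + dl)%R by apply Rmin_r; lra).
      apply Rle_lt_trans with (rho / Cmod z * Cmod z)%R.
      + apply Rmult_le_compat_r; [lra |]. eapply Rle_trans; [eassumption | apply Rmin_r].
      + unfold Rdiv. rewrite Rmult_assoc, Rinv_l; unfold rho; lra. }
  assert (E1 : T' = 1%R).
  { assert (T' <= T)%R by now apply HT1.
    unfold T' in *. destruct (Rle_lt_dec 1 (T + dl)); [now apply Rmin_left |].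
    rewrite Rmin_right in * by lra. lra. }
  rewrite E1 in PT. destruct PT as [_ PT].
  replace z with (RtoC 1 * z) by ring. apply PT. lra.
Qed.

(** ** Partial fractions *)

Lemma cut_plane_qpow (q : R) (z : C) (n : nat) :
  (0 < q < 1)%R -> cut_plane z -> cut_plane (z * q ^ n).
Proof.
  intros Hq Hz. rewrite Cmult_comm, <- RtoC_pow. apply cut_plane_scale; auto.
  pose proof (qpow_le_1 q n Hq). lra.
Qed.

Lemma cut_plane_qregular (q : R) (z : C) : (0 < q < 1)%R -> cut_plane z -> qregular q z.
Proof.
  intros Hq Hz n E. apply (cut_plane_qpow q z n Hq Hz). rewrite E. simpl. lra.
Qed.

Definition has_continuation (c : nat -> C) (F : C -> C) : Prop :=
  (forall z, cut_plane z -> analytic_at F z) /\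
  (forall z, (Cmod z < 1)%R -> hasum (fun n => c n * z ^ n) (F z)).

Lemma geom_hasum (z : C) : (Cmod z < 1)%R -> hasum (fun n => z ^ n) (/ (1 - z)).
Proof.
  intros Hz.
  assert (H1 : 1 - z <> 0).
  { apply Cminus_eq_contra. intro E. rewrite <- E, Cmod_1 in Hz. lra. }
  assert (A : Cabs (fun n => z ^ n)) by now apply Cmod_pow_lt_1.
  assert (E : CSeries (fun n => z ^ n) = / (1 - z)); [| rewrite <- E; now apply Cabs_hasum].
  assert (Sg := CSeries_S _ A). cbv beta in Sg.
  rewrite (CSeries_ext (fun n => z ^ S n) (fun n => z * z ^ n)) in Sg by (intro; reflexivity).
  rewrite CSeries_scal in Sg by auto.
  assert (S' : (1 - z) * CSeries (fun n => z ^ n) = 1).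
  { set (X := CSeries (fun n => z ^ n)) in *.
    transitivity (X - z * X); [ring |]. rewrite Sg at 1. simpl. ring. }
  replace (/ (1 - z)) with (/ (1 - z) * ((1 - z) * CSeries (fun n => z ^ n)))
    by (rewrite S'; ring).
  field. auto.
Qed.

Lemma CSeries_geom (k z : C) :
  (Cmod z < 1)%R -> CSeries (fun n => k * z ^ n) = k * / (1 - z).
Proof. intro Hz. apply hasum_CSeries, hasum_scal, geom_hasum, Hz. Qed.

(** If the coefficients of a power series are the values at q^j of an absolutely
    convergent power series with coefficients d n, then its sum is the sum of the
    simple fractions d n / (1 - q^n z), and this is analytic off the poles. *)
Lemma partial_fractions_continuation (q : R) (d : nat -> C) :
  (0 < q < 1)%R -> Cabs d ->
  has_continuation (fun j => ps d (q ^ j))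
    (fun z => CSeries (fun n => d n * / (1 - z * q ^ n))).
Proof.
  intros Hq Hd. split.
  - intros z0 Hz0. assert (Rz := cut_plane_qregular q z0 Hq Hz0).
    destruct (eventually_away (fun n => 1 - z0 * q ^ n) (/ 2)
                (proj1_sig (constructive_indefinite_description _
                   (qpow_mult_small q z0 (/ 2) Hq ltac:(lra))))) as [dl [Pdl Hdl]].
    + lra.
    + intro n. now apply qregular_factor.
    + destruct (constructive_indefinite_description _ _) as [N HN]. simpl. intros n Hn.
      specialize (HN n Hn).
      pose proof (Cmod_triangle (1 - z0 * q ^ n) (z0 * q ^ n)) as T.
      replace (1 - z0 * q ^ n + z0 * q ^ n) with (RtoC 1) in T by ring.
      rewrite Cmod_1 in T. lra.
    + cbv beta in Hdl. set (D := fun n => 1 - z0 * q ^ n) in *.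
      assert (Hdl' : forall n, (dl <= Cmod (D n))%R) by exact Hdl.
      assert (D0 : forall n, D n <> 0) by (intro n; now apply qregular_factor).
      exists (fun m => CSeries (fun n => d n * / D n * (q ^ n * / D n) ^ m)), dl.
      split; auto. intros z Hz. apply hasum_Cis_series.
      set (w := z - z0) in *.
      assert (bq : forall n, (Cmod (q ^ n * / D n) <= / dl)%R).
      { intro n. rewrite Cmod_mult, Cmod_inv, Cmod_qpow by auto.
        pose proof (qpow_le_1 q n Hq).
        rewrite <- (Rmult_1_l (/ dl)). apply Rmult_le_compat; [lra | | lra |].
        - left. apply Rinv_0_lt_compat. now apply Cmod_gt_0.
        - apply Rinv_le_contravar; auto. }
      assert (bi : forall n, (Cmod (/ D n) <= / dl)%R).
      { intro n. rewrite Cmod_inv by auto. apply Rinv_le_contravar; auto. }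
      assert (wd : (0 <= Cmod w * / dl < 1)%R).
      { split; [apply Rmult_le_pos; [apply Cmod_ge_0 | left; now apply Rinv_0_lt_compat] |].
        apply Rmult_lt_reg_r with dl; auto. rewrite Rmult_assoc, Rinv_l; lra. }
      assert (tw : forall n, (Cmod (q ^ n * / D n * w) <= Cmod w * / dl)%R).
      { intro n. rewrite Cmod_mult, Rmult_comm. apply Rmult_le_compat_l; auto.
        apply Cmod_ge_0. }
      set (a := fun n m => d n * / D n * (q ^ n * / D n * w) ^ m).
      assert (fub := fubini_swap a (fun n => / dl * Cmod (d n))%R
                (fun m => (Cmod w * / dl) ^ m)%R).
      assert (E : forall n, CSeries (a n) = d n * / (1 - z * q ^ n)).
      { intro n. unfold a.
        assert (t1 : (Cmod (q ^ n * / D n * w) < 1)%R)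
          by (eapply Rle_lt_trans; [apply tw | apply wd]).
        rewrite CSeries_geom by auto.
        assert (N1 : 1 - q ^ n * / D n * w <> 0).
        { apply Cminus_eq_contra. intro E. rewrite <- E, Cmod_1 in t1. lra. }
        assert (E1 : 1 - z * q ^ n = D n * (1 - q ^ n * / D n * w)).
        { specialize (D0 n). transitivity (D n - q ^ n * w); [unfold D, w; ring |].
          field. auto. }
        rewrite E1. specialize (D0 n). field. split; auto.
        intro E2. apply N1. rewrite <- (Cmult_0_r (/ D n)), <- E2. field. auto. }
      rewrite <- (CSeries_ext _ _ E).
      apply (hasum_ext (fun m => CSeries (fun n => a n m))).
      * intro m. rewrite Cmult_comm, <- CSeries_scal.
        -- apply CSeries_ext. intro n. unfold a. rewrite (Cpow_mult_l _ w). ring.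
        -- apply (Cabs_ext (fun n => (/ D n * (q ^ n * / D n) ^ m) * d n));
             [intro; ring |].
           apply Cabs_bounded_mult with (/ dl * (/ dl) ^ m)%R; auto.
           intro n. rewrite Cmod_mult, Cmod_pow. apply Rmult_le_compat; auto.
           ++ apply Cmod_ge_0.
           ++ apply pow_le, Cmod_ge_0.
           ++ apply pow_incr. split; [apply Cmod_ge_0 | auto].
      * apply fub.
        -- intros i j. unfold a. rewrite !Cmod_mult, Cmod_pow.
           apply Rmult_le_compat.
           ++ apply Rmult_le_pos; apply Cmod_ge_0.
           ++ apply pow_le, Cmod_ge_0.
           ++ rewrite Rmult_comm. apply Rmult_le_compat_r; [apply Cmod_ge_0 | auto].
           ++ apply pow_incr. split; [apply Cmod_ge_0 |]. apply tw.
        -- now apply ex_series_scal_R.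
        -- apply ex_series_geom. rewrite Rabs_pos_eq; lra.
        -- intro i. apply Rmult_le_pos; [left; now apply Rinv_0_lt_compat | apply Cmod_ge_0].
        -- intro j. apply pow_le. lra.
  - intros z Hz.
    set (a := fun n j => d n * (z * q ^ n) ^ j).
    assert (tz : forall n, (Cmod (z * q ^ n) < 1)%R)
      by (intro n; now apply Cmod_mult_qpow_lt).
    apply (hasum_ext (fun j => CSeries (fun n => a n j))).
    + intro j. unfold ps. rewrite Cmult_comm, <- CSeries_scal.
      * apply CSeries_ext. intro n. unfold a.
        rewrite Cpow_mult_l, <- !Cpow_mult_r, (Nat.mul_comm n j). ring.
      * apply (Cabs_ext (fun n => (q ^ j) ^ n * d n)); [intro; ring |].
        apply Cabs_bounded_mult with 1%R; auto.
        intro n. rewrite <- Cpow_mult_r, Cmod_qpow by auto. now apply qpow_le_1.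
    + rewrite (CSeries_ext _ (fun n => CSeries (a n))).
      * apply fubini_swap with (fun n => Cmod (d n)) (fun j => (Cmod z) ^ j)%R.
        -- intros i j. unfold a. rewrite Cmod_mult, Cmod_pow.
           apply Rmult_le_compat_l; [apply Cmod_ge_0 |].
           apply pow_incr. split; [apply Cmod_ge_0 | now apply Cmod_mult_qpow_le].
        -- exact Hd.
        -- apply ex_series_geom. rewrite Rabs_pos_eq; [auto | apply Cmod_ge_0].
        -- intro; apply Cmod_ge_0.
        -- intro; apply pow_le, Cmod_ge_0.
      * intro n. unfold a. now rewrite CSeries_geom.
Qed.

(** Dropping finitely many coefficients multiplies the parameters by a power of q,
    and so brings them into the unit disc. *)
Lemma continuation_of_tail (N : nat) (c : nat -> C) :
  (exists G, has_continuation (fun n => c (N + n)%nat) G) -> exists F, has_continuation c F.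
Proof.
  revert c. induction N; intros c H; [exact H |].
  destruct (IHN (fun n => c (S n)) H) as [G [G1 G2]].
  exists (fun z => c O + z * G z). split.
  - intros z Hz. apply analytic_plus; [apply analytic_const | now apply analytic_mult_var; auto].
  - intros z Hz.
    replace (c O + z * G z) with (psum (fun n => c n * z ^ n) 1 + z * G z) by (simpl; ring).
    apply hasum_incr. apply (hasum_ext (fun n => z * (c (S n) * z ^ n))).
    + intro n. simpl. ring.
    + apply hasum_scal. auto.
Qed.

(** The q-binomial theorem at A q^j. *)
Lemma qpoch_ratio_as_ps (q : R) (A D : C) (j : nat) :
  (0 < q < 1)%R -> A <> 0 -> (Cmod A < 1)%R -> qregular q D ->
  qpoch q A j / qpoch q D j =
  ps (fun n => qpoch_inf q A / qpoch_inf q D * (qbin q (D / A) n * A ^ n)) (q ^ j).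
Proof.
  intros Hq HA HA1 RD.
  assert (RA := qregular_small q A Hq HA1).
  assert (HAj : (Cmod (A * q ^ j) < 1)%R)
    by (now apply Cmod_mult_qpow_lt).
  assert (Ab := Cabs_qbin q (D / A) _ Hq HAj).
  rewrite ps_scal.
  - rewrite <- ps_dilate, (Cmult_comm _ A), q_binomial by auto.
    replace (D / A * (A * q ^ j)) with (D * q ^ j) by (field; auto).
    rewrite (qpoch_inf_split q A j), (qpoch_inf_split q D j) by auto.
    assert (qpoch_inf q (A * q ^ j) <> 0)
      by (apply qpoch_inf_neq_0; auto; now apply qregular_shift).
    assert (qpoch_inf q (D * q ^ j) <> 0)
      by (apply qpoch_inf_neq_0; auto; now apply qregular_shift).
    assert (H1 := qpoch_neq_0 q _ j RD). field. auto.
  - eapply Cabs_ext; [| exact Ab]. intro n. cbv beta. rewrite Cpow_mult_l. ring.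
Qed.

(** Beyond the first N indices, each of the quotients (A;q)_j/(q;q)_j and
    (B;q)_j/(C;q)_j is a power series in q^j; the numerators d n of the partial
    fractions are the coefficients of the product of the two series. *)
Lemma hyp_continuation_exists (q : R) (A B C0 : C) :
  (0 < q < 1)%R -> A <> 0 -> B <> 0 -> qregular q C0 ->
  exists F, has_continuation (hyp_coef q A B C0) F.
Proof.
  intros Hq HA HB RC.
  destruct (qpow_mult_small q A 1 Hq) as [N1 H1]; [lra |].
  destruct (qpow_mult_small q B 1 Hq) as [N2 H2]; [lra |].
  set (N := (N1 + N2)%nat). set (x := q ^ N).
  assert (Hx : x <> 0) by (apply Cpow_nz; now apply q_neq_0).
  assert (HAx : (Cmod (A * x) < 1)%R) by (apply H1; unfold N; lia).
  assert (HBx : (Cmod (B * x) < 1)%R) by (apply H2; unfold N; lia).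
  assert (RD := qregular_shift q _ N (qregular_q q Hq)). fold x in RD.
  assert (RC' := qregular_shift q _ N RC). fold x in RC'.
  set (al := fun n => qpoch_inf q (A * x) / qpoch_inf q (q * x) *
                (qbin q (q * x / (A * x)) n * (A * x) ^ n)).
  set (be := fun n => qpoch_inf q (B * x) / qpoch_inf q (C0 * x) *
                (qbin q (C0 * x / (B * x)) n * (B * x) ^ n)).
  assert (Aal : Cabs al) by now apply Cabs_scal, Cabs_qbin.
  assert (Abe : Cabs be) by now apply Cabs_scal, Cabs_qbin.
  set (d := fun n => hyp_coef q A B C0 N * conv al be n).
  assert (one : forall u : nat -> C, Cabs u -> forall t, (Cmod t <= 1)%R ->
            Cabs (fun n => u n * t ^ n)).
  { intros u Hu t Ht. apply (Cabs_ext (fun n => t ^ n * u n)); [intro; ring |].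
    apply Cabs_bounded_mult with 1%R; auto. intro n. rewrite Cmod_pow.
    rewrite <- (pow1 n). apply pow_incr. split; [apply Cmod_ge_0 | auto]. }
  assert (Ad : Cabs (conv al be)).
  { apply (Cabs_ext (fun n => conv al be n * 1 ^ n));
      [intro; rewrite Cpow_1_l; ring |].
    apply Cabs_conv; apply one; auto; rewrite Cmod_1; lra. }
  apply continuation_of_tail with N.
  eexists.
  replace (fun n => hyp_coef q A B C0 (N + n)%nat) with (fun j => ps d (q ^ j)).
  { apply partial_fractions_continuation; auto. now apply Cabs_scal. }
  apply functional_extensionality. intro j.
  assert (Hj : (Cmod (q ^ j) <= 1)%R).
  { rewrite Cmod_qpow by auto. now apply qpow_le_1. }
  unfold d. rewrite ps_scal by auto. rewrite ps_conv by auto.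
  unfold al, be. rewrite <- !qpoch_ratio_as_ps by (auto; now apply Cmult_neq_0).
  unfold hyp_coef. rewrite !(qpoch_add q _ N j). fold x.
  assert (h1 := qpoch_neq_0 q _ N (qregular_q q Hq)).
  assert (h2 := qpoch_neq_0 q _ N RC). assert (h3 := qpoch_neq_0 q _ j RD).
  assert (h4 := qpoch_neq_0 q _ j RC').
  field. auto.
Qed.

(** ** Values of the continuation *)

Lemma qhyp_term_21 (q : R) (A B C0 z : C) (j : nat) :
  qhyp_term q [A; B] [C0] z j = hyp_coef q A B C0 j * z ^ j.
Proof.
  unfold qhyp_term, qpochs, hyp_coef. simpl. rewrite !Cmult_1_r. reflexivity.
Qed.

Lemma qhyp_continuation (q : R) (A B C0 : C) :
  (0 < q < 1)%R -> A <> 0 -> B <> 0 -> qregular q C0 ->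
  has_continuation (hyp_coef q A B C0) (qhyp q [A; B] [C0]).
Proof.
  intros Hq HA HB RC.
  destruct (hyp_continuation_exists q A B C0 Hq HA HB RC) as [F [F1 F2]].
  assert (H : is_qhyp_continuation q [A; B] [C0] (qhyp q [A; B] [C0])).
  { unfold qhyp. apply (epsilon_spec _ (is_qhyp_continuation q [A; B] [C0])). exists F. split; auto. intros z Hz.
    apply hasum_Cis_series. apply (hasum_ext (fun n => hyp_coef q A B C0 n * z ^ n)); auto.
    intro; now rewrite qhyp_term_21. }
  destruct H as [H1 H2]. split; auto. intros z Hz.
  apply (hasum_ext (qhyp_term q [A; B] [C0] z)); [intro; apply qhyp_term_21 |].
  apply hasum_Cis_series; auto.
Qed.

Lemma qhyp_small (q : R) (A B C0 z : C) :
  (0 < q < 1)%R -> A <> 0 -> B <> 0 -> qregular q C0 -> (Cmod z < 1)%R ->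
  qhyp q [A; B] [C0] z = phi21 q A B C0 z.
Proof.
  intros Hq HA HB RC Hz. symmetry. apply hasum_CSeries.
  now apply qhyp_continuation.
Qed.

(** The hypergeometric equation persists on the cut plane because its defect is
    analytic there and vanishes on the unit disc. *)
Lemma qhyp_hyp_eq (q : R) (A B C0 z : C) :
  (0 < q < 1)%R -> A <> 0 -> B <> 0 -> qregular q C0 -> cut_plane z ->
  hyp_eq q A B C0 z (fun n => qhyp q [A; B] [C0] (z * q ^ n)).
Proof.
  intros Hq HA HB RC Hz.
  destruct (qhyp_continuation q A B C0 Hq HA HB RC) as [F1 _].
  assert (Fs := fun w => qhyp_small q A B C0 w Hq HA HB RC).
  set (F := qhyp q [A; B] [C0]) in *. clearbody F.
  set (D := fun w => F w + (- (1 + C0 / q) * F (q * w) +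
     (C0 / q * F (q * (q * w)) +
     (-(1)) * (w * (F w + (- (A + B) * F (q * w) +
               A * B * F (q * (q * w)))))))).
  assert (HD : forall w, cut_plane w -> D w = 0).
  { assert (q1 : (Cmod q <= 1)%R) by (rewrite Cmod_R, Rabs_pos_eq; lra).
    assert (cq : forall w, cut_plane w -> cut_plane (q * w))
      by (intros; apply cut_plane_scale; auto; lra).
    apply identity_on_cut_plane.
    - intros w Hw. assert (a0 := F1 w Hw).
      assert (a1 := analytic_dilate q F w q1 (F1 _ (cq _ Hw))).
      assert (a2 : analytic_at (fun w => F (q * (q * w))) w).
      { apply (analytic_dilate q (fun u => F (q * u)) w q1).
        apply analytic_dilate; auto. }
      unfold D.
      apply analytic_plus; [exact a0 |].
      apply analytic_plus; [apply analytic_scal; exact a1 |].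
      apply analytic_plus; [apply analytic_scal; exact a2 |].
      apply analytic_scal, analytic_mult_var.
      apply analytic_plus; [exact a0 |].
      apply analytic_plus; apply analytic_scal; [exact a1 | exact a2].
    - intros w Hw.
      assert (E := phi21_hyp_eq q A B C0 w Hq RC Hw O).
      assert (s : forall k, (Cmod (w * q ^ k) < 1)%R)
        by (intro k; now apply Cmod_mult_qpow_lt).
      cbv beta in E. rewrite <- !Fs in E by auto.
      replace (w * q ^ 0) with w in E by (simpl; ring).
      replace (w * q ^ 1) with (q * w) in E by (simpl; ring).
      replace (w * q ^ 2) with (q * (q * w)) in E by (simpl; ring).
      apply -> Ceq_minus in E. rewrite <- E. unfold D. simpl. ring. }
  intro n. specialize (HD _ (cut_plane_qpow q z n Hq Hz)). unfold D in HD.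
  apply Ceq_minus.
  replace (z * q ^ S n) with (q * (z * q ^ n)) by (simpl; ring).
  replace (z * q ^ S (S n)) with (q * (q * (z * q ^ n))) by (simpl; ring).
  rewrite <- HD. ring.
Qed.

(** * Complex powers *)

Lemma Cexp_plus (z w : C) : Cexp (z + w) = Cexp z * Cexp w.
Proof.
  unfold Cexp. destruct z as [a b], w as [c d]. apply C_eq; simpl;
    rewrite exp_plus; [rewrite cos_plus | rewrite sin_plus]; ring.
Qed.

Lemma Cexp_RtoC (r : R) : Cexp (RtoC r) = RtoC (exp r).
Proof. unfold Cexp. apply C_eq; simpl; rewrite ?cos_0, ?sin_0; ring. Qed.

Lemma Cmod_Cexp (z : C) : Cmod (Cexp z) = exp (Re z).
Proof.
  unfold Cmod, Cexp. simpl.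
  replace (_ + _)%R with (Rsqr (exp (Re z)) * (Rsqr (sin (Im z)) + Rsqr (cos (Im z))))%R
    by (unfold Rsqr; ring).
  rewrite sin2_cos2, Rmult_1_r. apply sqrt_Rsqr. left; apply exp_pos.
Qed.

Lemma cpow_plus (z s t : C) : cpow z (s + t) = cpow z s * cpow z t.
Proof. unfold cpow. rewrite <- Cexp_plus. f_equal. ring. Qed.

Lemma cpow_neq_0 (z s : C) : cpow z s <> 0.
Proof.
  apply Cmod_gt_0. unfold cpow. rewrite Cmod_Cexp. apply exp_pos.
Qed.

Lemma cpow_0 (z : C) : cpow z 0 = 1.
Proof. unfold cpow. rewrite Cmult_0_l, Cexp_RtoC, exp_0. reflexivity. Qed.

Lemma cpow_opp (z s : C) : cpow z (- s) = / cpow z s.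
Proof.
  assert (H := cpow_neq_0 z s).
  assert (E : cpow z (- s) * cpow z s = 1)
    by (rewrite <- cpow_plus; replace (- s + s) with (RtoC 0) by ring; apply cpow_0).
  rewrite <- (Cmult_1_l (/ cpow z s)), <- E. field. auto.
Qed.

Lemma cpow_minus (z s t : C) : cpow z (s - t) = cpow z s / cpow z t.
Proof. unfold Cminus. rewrite cpow_plus, cpow_opp. reflexivity. Qed.

Lemma cpow_mult_INR (z s : C) (n : nat) : cpow z (RtoC (INR n) * s) = cpow z s ^ n.
Proof.
  induction n.
  - simpl. rewrite Cmult_0_l. apply cpow_0.
  - rewrite S_INR, RtoC_plus. replace ((RtoC (INR n) + 1) * s) with (s + RtoC (INR n) * s) by ring.
    rewrite cpow_plus, IHn. reflexivity.
Qed.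

Lemma Carg_pos (r : R) : (0 < r)%R -> Carg (RtoC r) = 0%R.
Proof.
  intro Hr. unfold Carg. rewrite Cmod_R, Rabs_pos_eq by lra. simpl.
  destruct (Rle_dec 0 0); [| lra]. unfold Rdiv. rewrite Rinv_r by lra. apply acos_1.
Qed.

Lemma CLog_pos (r : R) : (0 < r)%R -> CLog (RtoC r) = RtoC (ln r).
Proof.
  intro Hr. unfold CLog. rewrite Carg_pos, Cmod_R, Rabs_pos_eq by lra. reflexivity.
Qed.

Lemma cpow_1 (r : R) : (0 < r)%R -> cpow (RtoC r) 1 = RtoC r.
Proof.
  intro Hr. unfold cpow. rewrite CLog_pos, Cmult_1_l, Cexp_RtoC, exp_ln; auto.
Qed.

Lemma cpow_INR (r : R) (n : nat) : (0 < r)%R -> cpow (RtoC r) (RtoC (INR n)) = RtoC r ^ n.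
Proof.
  intro Hr. rewrite <- (Cmult_1_r (RtoC (INR n))), cpow_mult_INR, cpow_1; auto.
Qed.

Lemma cpow_RtoC (r s : R) : (0 < r)%R -> cpow (RtoC r) (RtoC s) = RtoC (Rpower r s).
Proof.
  intro Hr. unfold cpow, Rpower. rewrite CLog_pos by auto. now rewrite <- RtoC_mult, Cexp_RtoC.
Qed.

Lemma Cmod_cpow (r : R) (s : C) : (0 < r)%R -> Cmod (cpow (RtoC r) s) = Rpower r (Re s).
Proof.
  intro Hr. unfold cpow, Rpower. rewrite CLog_pos, Cmod_Cexp by auto. f_equal.
  destruct s; simpl. ring.
Qed.

Lemma Rpower_lt_1 (q s : R) : (0 < q < 1)%R -> (0 < s)%R -> (0 < Rpower q s < 1)%R.
Proof.
  intros Hq Hs. split; [apply exp_pos |]. unfold Rpower. rewrite <- exp_0.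
  apply exp_increasing.
  assert (ln q < 0)%R by (rewrite <- ln_1; apply ln_increasing; lra). nra.
Qed.

Lemma CLog_scale (t : R) (z : C) :
  (0 < t)%R -> z <> 0 -> CLog (RtoC t * z) = RtoC (ln t) + CLog z.
Proof.
  intros Ht Hz. assert (Pz := proj1 (Cmod_gt_0 z) Hz).
  assert (Cm : Cmod (RtoC t * z) = (t * Cmod z)%R)
    by (rewrite Cmod_mult, Cmod_R, Rabs_pos_eq; lra).
  unfold CLog. apply C_eq; simpl.
  - rewrite Cm, ln_mult; auto.
  - rewrite Rplus_0_l. unfold Carg. rewrite Cm.
    replace (Re (RtoC t * z)) with (t * Re z)%R by (destruct z; simpl; ring).
    replace (Im (RtoC t * z)) with (t * Im z)%R by (destruct z; simpl; ring).
    replace (t * Re z / (t * Cmod z))%R with (Re z / Cmod z)%R by (field; lra).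
    destruct (Rle_dec 0 (Im z)), (Rle_dec 0 (t * Im z)); auto; exfalso; nra.
Qed.

Lemma cpow_scale (t : R) (z s : C) :
  (0 < t)%R -> z <> 0 -> cpow (RtoC t * z) s = cpow (RtoC t) s * cpow z s.
Proof.
  intros Ht Hz. unfold cpow. rewrite CLog_scale, CLog_pos by auto.
  rewrite <- Cexp_plus. f_equal. ring.
Qed.

Lemma cpow_scale_inv (t : R) (z s : C) :
  (0 < t)%R -> z <> 0 -> cpow (z / RtoC t) s = cpow z s / cpow (RtoC t) s.
Proof.
  intros Ht Hz. assert (Ht0 : RtoC t <> 0) by (apply RtoC_neq_0; lra).
  assert (H := cpow_neq_0 (RtoC t) s).
  replace z with (RtoC t * (z / RtoC t)) at 2 by (field; auto).
  rewrite cpow_scale; auto.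
  - field. auto.
  - now apply Cdiv_neq_0.
Qed.

(** * The kernels as convolutions *)

(** Both (q^-p;q)_j and (q^(1-p)/c;q)_j are, up to powers of q and c, products of the
    last j factors of (q;q)_p and (c;q)_p. *)
Lemma qpoch_reversal (q : R) (c : C) (p j : nat) :
  (0 < q < 1)%R -> c <> 0 -> (j <= p)%nat ->
  qpoch q (/ q ^ p) j * qbin q c p =
  qpoch q (q / (q ^ p * c)) j * (qbin q c (p - j) * (c / q) ^ j).
Proof.
  intros Hq Hc. assert (Hq0 := q_neq_0 q Hq). induction j; intros Hj.
  - rewrite Nat.sub_0_r. simpl. ring.
  - rewrite !qpoch_S. specialize (IHj ltac:(lia)).
    replace (p - j)%nat with (S (p - S j)) in IHj by lia.
    set (N := (p - S j)%nat) in *.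
    assert (Ep : p = (S N + j)%nat) by (unfold N; lia).
    assert (Hqj := Cpow_nz q j Hq0). assert (HqN := Cpow_nz q N Hq0).
    assert (E1 : / q ^ p * q ^ j = / (q * q ^ N)).
    { rewrite Ep, Cpow_add_r. simpl. field. auto. }
    assert (E2 : q / (q ^ p * c) * q ^ j = / (q ^ N * c)).
    { rewrite Ep, Cpow_add_r. simpl. field. auto. }
    rewrite E1, E2.
    replace (qpoch q (/ q ^ p) j * (1 - / (q * q ^ N)) * qbin q c p) with
      ((1 - / (q * q ^ N)) * (qpoch q (/ q ^ p) j * qbin q c p)) by ring.
    rewrite IHj. assert (B := qbin_S q c N Hq). simpl Cpow in B.
    transitivity (qpoch q (q / (q ^ p * c)) j * (c / q) ^ j *
       (- / (q * q ^ N)) * (qbin q c (S N) * (1 - q * q ^ N))).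
    + field. auto.
    + rewrite B. simpl. field. auto.
Qed.

Lemma qpoch_reversed_neq_0 (q : R) (c : C) (p j : nat) :
  (0 < q < 1)%R -> c <> 0 -> qregular q c -> (j <= p)%nat ->
  qpoch q (q / (q ^ p * c)) j <> 0.
Proof.
  intros Hq Hc Rc Hj. assert (Hq0 := q_neq_0 q Hq).
  induction j; [apply C1_nz |]. rewrite qpoch_S. apply Cmult_neq_0; [apply IHj; lia |].
  apply Cminus_eq_contra. intro E. apply (Rc (p - S j)%nat).
  assert (Ep : p = (p - S j + S j)%nat) by lia.
  set (N := (p - S j)%nat) in *. rewrite Ep, Cpow_add_r in E. simpl in E.
  assert (Hqj := Cpow_nz q j Hq0). assert (HqN := Cpow_nz q N Hq0).
  transitivity (c * q ^ N *
    (q / (q ^ N * (q * q ^ j) * c) * q ^ j)).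
  - rewrite <- E. ring.
  - field. auto.
Qed.

(** The common shape of the kernels of W and A; the index j belongs to the mu-part and i
    to the nu-part. *)
Definition kernel_conv (q : R) (c m Z V t : C) (p : nat) : C :=
  diag (fun j i => qbin q m j * (qpoch q Z j / qpoch q V j) * t ^ j * qbin q c i) p.

(** The series terminates at j = p because (q^-p;q)_j vanishes beyond; the reversal
    identity then produces the weights (c;q)_(p-j)/(q;q)_(p-j). *)
Lemma kernel_conv_eq (q : R) (c m Z V w t : C) (p : nat) :
  (0 < q < 1)%R -> c <> 0 -> qregular q c -> qregular q V -> t = c * w / q ->
  qbin q c p *
  qhyp_sum q [/ q ^ p; m; Z] [q / (q ^ p * c); V] w =
  kernel_conv q c m Z V t p.
Proof.
  intros Hq Hc Rc RV Ht. assert (Hq0 := q_neq_0 q Hq).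
  assert (Hz : forall n, (p < n)%nat -> qpoch q (/ q ^ p) n = 0).
  { intros n Hn. replace n with (S p + (n - S p))%nat by lia.
    rewrite qpoch_add, qpoch_S. rewrite Cinv_l by now apply Cpow_nz. ring. }
  unfold qhyp_sum. rewrite (CSeries_finite (S p)).
  - unfold kernel_conv, diag. rewrite <- psum_scal. apply psum_ext. intros j Hj.
    assert (E := qpoch_reversal q c p j Hq Hc ltac:(lia)).
    assert (N := qpoch_reversed_neq_0 q c p j Hq Hc Rc ltac:(lia)).
    assert (N1 := qpoch_neq_0 q _ j (qregular_q q Hq)). assert (N2 := qpoch_neq_0 q _ j RV).
    unfold qhyp_term, qpochs. simpl map. simpl fold_right.
    set (P := qpoch q (/ q ^ p) j) in *.
    set (D := qpoch q (q / (q ^ p * c)) j) in *.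
    transitivity (P * qbin q c p * (qpoch q m j * qpoch q Z j /
        (qpoch q q j * D * qpoch q V j)) * w ^ j); [field; auto |].
    rewrite E. unfold qbin at 2. rewrite Ht.
    replace ((c * w / q) ^ j) with ((c / q) ^ j * w ^ j)
      by (rewrite <- Cpow_mult_l; f_equal; field; auto).
    field. auto.
  - intros n Hn. unfold qhyp_term, qpochs. simpl map. simpl fold_right.
    rewrite Hz by lia. unfold Cdiv. ring.
Qed.

Lemma Clim_qpoch (q : R) (z : nat -> C) (l : C) (k : nat) :
  Clim z l -> Clim (fun n => qpoch q (z n) k) (qpoch q l k).
Proof.
  intro H. induction k; simpl; [apply Clim_const |].
  apply Clim_mult; [exact IHk |]. apply Clim_minus; [apply Clim_const |].
  apply Clim_mult; [exact H | apply Clim_const].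
Qed.

Lemma Clim_Cpow (z : nat -> C) (l : C) (k : nat) :
  Clim z l -> Clim (fun n => z n ^ k) (l ^ k).
Proof.
  intro H. induction k; simpl; [apply Clim_const | now apply Clim_mult].
Qed.

Lemma Clim_psum (v : nat -> nat -> C) (w : nat -> C) (k : nat) :
  (forall j, Clim (fun n => v n j) (w j)) -> Clim (fun n => psum (v n) k) (psum w k).
Proof. intro H. induction k; simpl; [apply Clim_const | now apply Clim_plus]. Qed.

Lemma kernel_conv_continuous (q : R) (c Z t : nat -> C) (c0 m Z0 V t0 : C) (p : nat) :
  Clim c c0 -> Clim Z Z0 -> Clim t t0 ->
  Clim (fun n => kernel_conv q (c n) m (Z n) V (t n) p) (kernel_conv q c0 m Z0 V t0 p).
Proof.
  intros Hc HZ Ht. unfold kernel_conv, diag.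
  apply Clim_psum with (v := fun n i => qbin q m i * (qpoch q (Z n) i / qpoch q V i)
                                        * t n ^ i * qbin q (c n) (p - i)).
  intro j. unfold qbin, Cdiv.
  apply Clim_mult; [apply Clim_mult; [apply Clim_mult; [apply Clim_const |] |] |].
  - apply Clim_mult; [now apply Clim_qpoch | apply Clim_const].
  - now apply Clim_Cpow.
  - apply Clim_mult; [now apply Clim_qpoch | apply Clim_const].
Qed.

Lemma cpow_inv_INR_lim (q : R) :
  (0 < q < 1)%R -> Clim (fun n => cpow q (/ RtoC (INR (S n)))) 1.
Proof.
  intros Hq.
  assert (L : is_lim_seq (fun n => exp (/ INR (S n) * ln q)) (exp (0 * ln q))).
  { apply (is_lim_seq_continuous (fun x => exp (x * ln q)) (fun n => (/ INR (S n))%R) 0).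
    - apply derivable_continuous_pt. reg.
    - apply (is_lim_seq_incr_1 (fun n => (/ INR n)%R)).
      replace (Finite 0) with (Rbar_inv p_infty) by reflexivity.
      apply is_lim_seq_inv; [apply is_lim_seq_INR | easy]. }
  rewrite Rmult_0_l, exp_0 in L.
  apply Clim_ext with (fun n => RtoC (exp (/ INR (S n) * ln q))).
  - intro n. rewrite <- RtoC_inv by apply not_0_INR, Nat.neq_succ_0.
    rewrite cpow_RtoC by lra. reflexivity.
  - split; simpl; [exact L | apply is_lim_seq_const].
Qed.

(** The modulus of q^nu is an integral power of q, and adding 1/(n+1) with n >= 1 to
    the real part of nu makes the exponent non-integral.  For n = 0 this fails, but
    only the limit in n matters. *)
Lemma cpow_perturbed_regular (q : R) (nu : C) (n : nat) :
  (0 < q < 1)%R -> ~ qregular q (cpow q nu) -> (1 <= n)%nat ->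
  qregular q (cpow q (nu + / RtoC (INR (S n)))).
Proof.
  intros Hq Hn Hn1 k E. apply Hn. clear Hn. intros j Ej.
  assert (Sn : (INR (S n) >= 2)%R) by (change 2%R with (INR 2); apply Rle_ge, le_INR; lia).
  rewrite <- RtoC_inv in E by lra.
  assert (C1 : Cmod (cpow q nu * q ^ j) = 1%R) by (rewrite Ej; apply Cmod_1).
  assert (C2 : Cmod (cpow q (nu + RtoC (/ INR (S n))) * q ^ k) = 1%R)
    by (rewrite E; apply Cmod_1).
  rewrite Cmod_mult, Cmod_cpow, Cmod_qpow, <- Rpower_pow, <- Rpower_plus in C1, C2 by lra.
  assert (inj : forall s, Rpower q s = 1%R -> s = 0%R).
  { intros s Hs. unfold Rpower in Hs. rewrite <- exp_0 in Hs. apply exp_inv in Hs.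
    assert (ln q < 0)%R by (rewrite <- ln_1; apply ln_increasing; lra). nra. }
  apply inj in C1. apply inj in C2.
  change (Re (nu + RtoC (/ INR (S n)))) with (Re nu + / INR (S n))%R in C2.
  assert (F : (/ INR (S n) = INR j - INR k)%R) by lra.
  assert (P : (0 < / INR (S n) <= / 2)%R)
    by (split; [apply Rinv_0_lt_compat | apply Rinv_le_contravar]; lra).
  rewrite F in P. rewrite !INR_IZR_INZ, <- minus_IZR in P.
  destruct P as [P1 P2]. apply lt_IZR in P1.
  assert (IZR (Z.of_nat j - Z.of_nat k) < 1)%R as P3 by lra. apply lt_IZR in P3. lia.
Qed.

(** The right-hand side is continuous in c, so it is also the value in the cases where
    the kernel is defined as a limit. *)
Lemma W_kernel_conv (q : R) (nu mu a b x : C) (p : nat) :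
  (0 < q < 1)%R -> a <> 0 -> b <> 0 -> x <> 0 ->
  let c := cpow q nu in let m := cpow q mu in
  qregular q (- (q * m / x)) ->
  W_kernel q nu mu a b x p =
  kernel_conv q c m (- (q * m * a / (c * b * x))) (- (q * m / x))
    (c * b / (m * a)) p.
Proof.
  intros Hq Ha Hb Hx c m RV. assert (Hq0 := q_neq_0 q Hq).
  assert (gen : forall nu', qregular q (cpow q nu') ->
    W_kernel_generic q nu' mu a b x p =
    kernel_conv q (cpow q nu') m
      (- (q * m * a / (cpow q nu' * b * x))) (- (q * m / x))
      (cpow q nu' * b / (m * a)) p).
  { intros nu' Rc. set (c' := cpow q nu') in *.
    assert (Hc : c' <> 0) by apply cpow_neq_0.
    assert (Hm : m <> 0) by apply cpow_neq_0.
    rewrite <- (kernel_conv_eq q c' m _ _ (q * b / (m * a))) by (auto; field; auto).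
    unfold W_kernel_generic. fold c' m. unfold qbin. f_equal.
    assert (Hqp := Cpow_nz q p Hq0).
    f_equal.
    - f_equal; [| f_equal; f_equal].
      + rewrite cpow_opp, cpow_INR by lra. reflexivity.
      + rewrite cpow_minus, cpow_plus, cpow_1 by lra. fold c' m. field. auto.
    - f_equal; [| f_equal].
      + rewrite !cpow_minus, cpow_1, cpow_INR by lra. fold c'. field. auto.
      + rewrite cpow_plus, cpow_1 by lra. fold m. field. auto.
    - rewrite cpow_minus, cpow_1 by lra. fold m. field. auto. }
  unfold W_kernel. destruct (excluded_middle_informative _) as [Rc | Rc].
  - now apply gen.
  - apply Clim_CLim_seq.
    assert (Hc : c <> 0) by apply cpow_neq_0.
    set (e := fun n => cpow q (/ RtoC (INR (S n)))).
    assert (Le : Clim e 1) by now apply cpow_inv_INR_lim.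
    assert (Lc : Clim (fun n => c * e n) c)
      by (assert (H := Clim_scal c e 1 Le); now rewrite Cmult_1_r in H).
    assert (Li : Clim (fun n => / e n) 1).
    { assert (Ln : is_lim_seq (fun n => Cmod (e n)) 1)
        by (rewrite <- Cmod_1; now apply Clim_Cmod_lim).
      assert (He : forall n, e n <> 0) by (intro; apply cpow_neq_0).
      apply Clim_Cmod. apply Clim_Cmod in Le.
      apply is_lim_seq_ext with (fun n => (Cmod (e n - 1) * / Cmod (e n))%R).
      - intro n. rewrite <- Cmod_inv, <- Cmod_mult by auto.
        rewrite <- Cmod_opp. f_equal. field. auto.
      - replace (Finite 0) with (Finite (0 * / 1)) by (f_equal; field).
        apply is_lim_seq_mult'; auto. apply is_lim_seq_inv with (l := Finite 1); auto.
        intro E. injection E. lra. }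
    apply Clim_ext_ev with (fun n => kernel_conv q (c * e n) m
       (- (q * m * a / (c * b * x)) * / e n) (- (q * m / x))
       (b / (m * a) * (c * e n)) p).
    + exists 1%nat. intros n Hn. rewrite gen by now apply cpow_perturbed_regular.
      rewrite cpow_plus. fold c. fold (e n).
      assert (He : e n <> 0) by apply cpow_neq_0.
      assert (Hm : m <> 0) by apply cpow_neq_0.
      f_equal; field; auto.
    + apply kernel_conv_continuous; auto.
      * assert (H := Clim_scal (- (q * m * a / (c * b * x))) _ 1 Li).
        now rewrite Cmult_1_r in H.
      * assert (Hm : m <> 0) by apply cpow_neq_0.
        replace (c * b / (m * a)) with (b / (m * a) * c) by (field; auto).
        now apply Clim_scal.
Qed.

Lemma W_term_conv (q : R) (nu mu a b : C) (f : C -> C) (x : C) (p : nat) :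
  (0 < q < 1)%R -> a <> 0 -> b <> 0 -> x <> 0 ->
  let c := cpow q nu in let m := cpow q mu in
  qregular q (- (q * m / x)) ->
  W_term q nu mu a b f x p =
  f (x / (m * q ^ p)) * (/ c) ^ p *
  kernel_conv q c m (- (q * m * a / (c * b * x))) (- (q * m / x))
    (c * b / (m * a)) p.
Proof.
  intros Hq Ha Hb Hx c m RV. unfold W_term.
  rewrite W_kernel_conv by auto. fold c m. f_equal.
  assert (Hc : c <> 0) by apply cpow_neq_0. assert (Hm : m <> 0) by apply cpow_neq_0.
  assert (Hqp := Cpow_nz q p (q_neq_0 q Hq)).
  rewrite cpow_minus, !cpow_opp, cpow_INR, cpow_mult_INR by lra. fold c m.
  rewrite Cpow_inv by auto. f_equal. f_equal. field. auto.
Qed.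

Lemma A_term_conv (q : R) (nu : R) (mu : C) (a b : C) (f : C -> C) (x : C) (k : nat) :
  (0 < q < 1)%R -> a <> 0 -> (0 < nu)%R ->
  let c := cpow q (RtoC nu) in let m := cpow q mu in
  qregular q (- (x * m)) -> qregular q (- (b * x * m / a)) ->
  A_term q (RtoC nu) mu a b f x k =
  f (x * m * q ^ k) * (a * b) ^ k *
  (qpoch q (- (x * m)) k / qpoch q (- (b * x * m / a)) k) *
  kernel_conv q c m (- (b * x * m / (a * c))) (- (x * m)) c k.
Proof.
  intros Hq Ha Hnu c m RV RZ. assert (Hq0 := q_neq_0 q Hq).
  assert (Hc : c <> 0) by apply cpow_neq_0.
  assert (Hqp := Cpow_nz q k Hq0).
  assert (Hc1 : (Cmod c < 1)%R).
  { unfold c. rewrite Cmod_cpow by lra. now apply Rpower_lt_1. }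
  rewrite <- (kernel_conv_eq q c m _ _ q); auto.
  2: now apply qregular_small.
  2: field; auto.
  unfold A_term. fold m.
  replace (x * cpow q (mu + RtoC (INR k))) with (x * m * q ^ k)
    by (rewrite cpow_plus, cpow_INR by lra; fold m; ring).
  replace (cpow q (- RtoC (INR k))) with (/ q ^ k)
    by (rewrite cpow_opp, cpow_INR by lra; reflexivity).
  replace (cpow q (1 - RtoC nu - RtoC (INR k))) with (q / (q ^ k * c))
    by (rewrite !cpow_minus, cpow_1, cpow_INR by lra; fold c; field; auto).
  replace (- (b * x * cpow q (mu - RtoC nu) / a)) with (- (b * x * m / (a * c)))
    by (rewrite cpow_minus; fold c m; field; auto).
  unfold qpochs. simpl map. simpl fold_right. fold c. unfold qbin.
  assert (N1 := qpoch_neq_0 q _ k (qregular_q q Hq)). assert (N2 := qpoch_neq_0 q _ k RZ).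
  field. auto.
Qed.

(** * Intertwining relations *)

(** After regrouping by values of g, the sum of the three series has vanishing
    coefficients. *)
Lemma three_term_sum_zero (g X Y Z : nat -> C) :
  X O = 0 -> X 1%nat + Y O = 0 -> (forall p, X (S (S p)) + Y (S p) + Z p = 0) ->
  Cabs (fun p => X p * g p) -> Cabs (fun p => Y p * g (S p)) ->
  Cabs (fun p => Z p * g (S (S p))) ->
  CSeries (fun p => X p * g p + Y p * g (S p) + Z p * g (S (S p))) = 0.
Proof.
  intros H0 H1 H HX HY HZ.
  rewrite CSeries_plus, CSeries_plus by auto using Cabs_plus.
  rewrite (CSeries_incr 2 (fun p => X p * g p)), (CSeries_S (fun p => Y p * g (S p))) by auto.
  simpl.
  assert (HX' : Cabs (fun n => X (S (S n)) * g (S (S n)))) by now apply -> (Cabs_incr 2) in HX.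
  assert (HY' : Cabs (fun n => Y (S n) * g (S (S n)))) by now apply -> (Cabs_incr 1) in HY.
  transitivity (X O * g O + (X 1%nat + Y O) * g 1%nat +
    (CSeries (fun n => X (S (S n)) * g (S (S n))) + CSeries (fun n => Y (S n) * g (S (S n)))
     + CSeries (fun p => Z p * g (S (S p))))); [ring |].
  rewrite <- !CSeries_plus by auto using Cabs_plus.
  rewrite H0, H1, CSeries_0; [ring |].
  intro n. transitivity ((X (S (S n)) + Y (S n) + Z n) * g (S (S n))); [ring |].
  rewrite H. ring.
Qed.

(** ** Geometric decay along a q-lattice *)

Definition decays (q : R) (f : C -> C) (y : C) (r : R) : Prop :=
  exists K, (0 <= K)%R /\ forall p : nat, (Cmod (f (y / q ^ p)%C) <= K * r ^ p)%R.

Lemma decays_shift (q : R) (f : C -> C) (y : C) (r : R) (n : nat) :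
  (0 < q < 1)%R -> (0 < r)%R -> decays q f y r ->
  exists K, (0 <= K)%R /\
    forall m p : nat, (Cmod (f (y / q ^ m / q ^ p)%C) <= K * r ^ m * r ^ p)%R.
Proof.
  intros Hq Hr [K [K0 HK]]. exists K. split; auto. intros m p.
  assert (Hq0 := q_neq_0 q Hq).
  replace (y / q ^ m / q ^ p) with (y / q ^ (m + p)).
  - rewrite Rmult_assoc, <- pow_add. apply HK.
  - rewrite Cpow_add_r. assert (H1 := Cpow_nz q m Hq0).
    assert (H2 := Cpow_nz q p Hq0). field. auto.
Qed.

Lemma decays_down (q : R) (f : C -> C) (y : C) (r : R) :
  (0 < q < 1)%R -> (0 < r)%R -> decays q f y r -> decays q f (y / q) r.
Proof.
  intros Hq Hr H. destruct (decays_shift q f y r 0 Hq Hr H) as [K [K0 HK]].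
  exists (K * r)%R. split; [apply Rmult_le_pos; lra |]. intro p.
  specialize (HK 1%nat p). now rewrite Cpow_1_r, pow_1 in HK.
Qed.

Lemma decays_up (q : R) (f : C -> C) (y : C) (r : R) :
  (0 < q < 1)%R -> (0 < r)%R -> decays q f y r -> decays q f (q * y) r.
Proof.
  intros Hq Hr [K [K0 HK]]. assert (Hq0 := q_neq_0 q Hq).
  exists (Rmax (Cmod (f (q * y)%C)) (K / r)). split.
  - eapply Rle_trans; [apply Cmod_ge_0 | apply Rmax_l].
  - intros [| p].
    + simpl. rewrite Rmult_1_r. replace (q * y / 1) with (q * y) by field.
      apply Rmax_l.
    + assert (H2 := Cpow_nz q p Hq0).
      replace (q * y / q ^ S p) with (y / q ^ p) by (simpl; field; auto).
      eapply Rle_trans; [apply HK |].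
      replace (K * r ^ p)%R with (K / r * r ^ S p)%R by (simpl; field; lra).
      apply Rmult_le_compat_r; [apply pow_le; lra | apply Rmax_r].
Qed.

Lemma decays_Cabs (q : R) (f : C -> C) (y s : C) (u : nat -> C) (M r : R) :
  (0 < q < 1)%R -> (0 < r)%R -> (Cmod s * r < 1)%R ->
  (forall n, (Cmod (u n) <= M)%R) -> decays q f y r ->
  Cabs (fun p => u p * s ^ p * f (y / q ^ p)).
Proof.
  intros Hq Hr Hs Hu [K [K0 HK]].
  apply Cabs_geom with (M * K)%R (Cmod s * r)%R.
  - split; auto. apply Rmult_le_pos; [apply Cmod_ge_0 | lra].
  - intro n. rewrite !Cmod_mult, Cmod_pow, Rpow_mult_distr.
    replace (M * K * (Cmod s ^ n * r ^ n))%R with ((M * Cmod s ^ n) * (K * r ^ n))%R by ring.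
    apply Rmult_le_compat; auto using Cmod_ge_0.
    + apply Rmult_le_pos; [apply Cmod_ge_0 | apply pow_le, Cmod_ge_0].
    + apply Rmult_le_compat_r; auto. apply pow_le, Cmod_ge_0.
Qed.

Lemma decays_mult (q : R) (f h : C -> C) (y : C) (r M : R) :
  (0 < r)%R -> (0 <= M)%R -> (forall p : nat, (Cmod (h (y / q ^ p)%C) <= M)%R) ->
  decays q f y r -> decays q (fun x => h x * f x) y r.
Proof.
  intros Hr HM Hh [K [K0 HK]]. exists (M * K)%R. split; [now apply Rmult_le_pos |].
  intro p. rewrite Cmod_mult, Rmult_assoc. apply Rmult_le_compat; auto using Cmod_ge_0.
Qed.

Lemma decays_plus (q : R) (f h : C -> C) (y : C) (r : R) :
  decays q f y r -> decays q h y r -> decays q (fun x => f x + h x) y r.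
Proof.
  intros [K [K0 HK]] [K' [K0' HK']]. exists (K + K')%R. split; [lra |].
  intro p. eapply Rle_trans; [apply Cmod_triangle |].
  specialize (HK p). specialize (HK' p). lra.
Qed.

(** At infinity the coefficients of L are bounded. *)
Lemma decays_Lop (q : R) (a b : C) (f : C -> C) (y : C) (r : R) :
  (0 < q < 1)%R -> a <> 0 -> b <> 0 -> y <> 0 -> (0 < r)%R ->
  decays q f y r -> decays q (Lop q a b f) y r.
Proof.
  intros Hq Ha Hb Hy Hr Hf. assert (Hq0 := q_neq_0 q Hq).
  assert (aff : forall k l : C, exists M, (0 <= M)%R /\
     forall p : nat, (Cmod (k + l / (y / q ^ p)) <= M)%R).
  { intros k l. exists (Cmod k + Cmod (l / y))%R. split.
    - pose proof (Cmod_ge_0 k). pose proof (Cmod_ge_0 (l / y)). lra.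
    - intro p. assert (Hp := Cpow_nz q p Hq0).
      replace (l / (y / q ^ p)) with (l / y * q ^ p) by (field; auto).
      eapply Rle_trans; [apply Cmod_triangle |].
      pose proof (Cmod_mult_qpow_le q (l / y) p Hq). lra. }
  assert (up : decays q (fun x => f (q * x)) y r).
  { destruct (decays_up q f y r Hq Hr Hf) as [K [K0 HK]]. exists K. split; auto.
    intro p. replace (q * (y / q ^ p)) with (q * y / q ^ p)
      by (assert (Hp := Cpow_nz q p Hq0); field; auto). auto. }
  assert (dn : decays q (fun x => f (x / q)) y r).
  { destruct (decays_down q f y r Hq Hr Hf) as [K [K0 HK]]. exists K. split; auto.
    intro p. replace (y / q ^ p / q) with (y / q / q ^ p)
      by (assert (Hp := Cpow_nz q p Hq0); field; auto). auto. }
  destruct (aff (a / 2) (a / 2)) as [M1 [P1 H1]].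
  destruct (aff 0 (- (a / 2 + q / (2 * b)))) as [M2 [P2 H2]].
  destruct (aff (1 / (2 * a)) (q / (2 * b))) as [M3 [P3 H3]].
  destruct (decays_plus q _ _ y r (decays_plus q _ _ y r
     (decays_mult q _ (fun x => a / 2 + a / 2 / x) y r M1 Hr P1 H1 up)
     (decays_mult q _ (fun x => 0 + - (a / 2 + q / (2 * b)) / x) y r M2 Hr P2 H2 Hf))
     (decays_mult q _ (fun x => 1 / (2 * a) + q / (2 * b) / x) y r M3 Hr P3 H3 dn))
    as [K [K0 HK]].
  exists K. split; auto. intro p. eapply Rle_trans; [| apply HK]. right. f_equal.
  assert (Hp := Cpow_nz q p Hq0).
  assert (Hx := Cdiv_neq_0 y _ Hy Hp).
  unfold Lop. set (x := y / q ^ p) in *. field. auto.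
Qed.

(** ** The two factors of W *)

(** The nu-part of W without the factor x^nu, and the mu-part without x^mu.  Leaving out
    the powers avoids choosing branches; their effect is to conjugate L. *)
Definition Vop (q : R) (c : C) (f : C -> C) (x : C) : C :=
  CSeries (fun p => qbin q c p * (/ c) ^ p * f (x / q ^ p)).

Definition Uop (q : R) (m a b c : C) (g : C -> C) (x : C) : C :=
  qpoch_inf q (- x) / qpoch_inf q (- (x / m)) *
  CSeries (fun j => qbin q m j *
    (qpoch q (- (q * m * a / (c * b * x))) j / qpoch q (- (q * m / x)) j) *
    (b / (m * a)) ^ j * g (x / m / q ^ j)).

(** The operator L of parameters (a/c, b), conjugated by x^nu with q^nu = c. *)
Definition Lop_half (q : R) (a b c : C) (g : C -> C) (x : C) : C :=
  a / 2 * (1 + 1 / x) * g (q * x)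
  - (a / (2 * c * x) + q / (2 * b * x)) * g x
  + 1 / (2 * a) * (1 + a * q / (c * b * x)) * g (x / q).

Lemma Vop_decays (q : R) (c : C) (f : C -> C) (y : C) (r : R) :
  (0 < q < 1)%R -> c <> 0 -> (0 < r < Cmod c)%R -> decays q f y r ->
  decays q (Vop q c f) y r.
Proof.
  intros Hq Hc Hr Hf. destruct (decays_shift q f y r 0 Hq (proj1 Hr) Hf) as [K [K0 HK]].
  destruct (qbin_bounded q c Hq) as [M [M0 HM]].
  assert (Pc := proj1 (Cmod_gt_0 c) Hc).
  assert (Hs : (0 <= / Cmod c * r < 1)%R).
  { split; [apply Rmult_le_pos; [left; now apply Rinv_0_lt_compat | lra] |].
    apply Rmult_lt_reg_l with (Cmod c); [lra |]. rewrite <- Rmult_assoc, Rinv_r; lra. }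
  exists (Series (fun p => M * K * (/ Cmod c * r) ^ p))%R. split.
  - apply Series_ge_0; [| now apply ex_series_geom_scal].
    intro k. apply Rmult_le_pos; [now apply Rmult_le_pos | apply pow_le; lra].
  - intro m. unfold Vop. rewrite <- Series_scal_r.
    apply Cmod_CSeries_le.
    + intro p. rewrite !Cmod_mult, Cmod_pow, Cmod_inv, Rpow_mult_distr by auto.
      replace (M * K * ((/ Cmod c) ^ p * r ^ p) * r ^ m)%R with
        ((M * (/ Cmod c) ^ p) * (K * r ^ m * r ^ p))%R by ring.
      assert (0 <= (/ Cmod c) ^ p)%R by (apply pow_le; left; now apply Rinv_0_lt_compat).
      apply Rmult_le_compat; auto using Cmod_ge_0.
      * apply Rmult_le_pos; auto using Cmod_ge_0.
      * apply Rmult_le_compat_r; auto.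
    + apply (ex_series_ext (K := R_AbsRing) (V := R_NormedModule)
        (fun p => (M * K * r ^ m) * (/ Cmod c * r) ^ p)%R);
        [intro; simpl; ring | now apply ex_series_geom_scal].
Qed.

Lemma inv_ratio_lt_1 (c : C) (r : R) :
  c <> 0 -> (0 < r < Cmod c)%R -> (Cmod (/ c) * r < 1)%R.
Proof.
  intros Hc Hr. rewrite Cmod_inv by auto.
  apply Rmult_lt_reg_l with (Cmod c); [lra |]. rewrite <- Rmult_assoc, Rinv_r; lra.
Qed.

(** Coefficientwise the relation reduces to the recursion of the q-binomial
    coefficients (c;q)_p/(q;q)_p. *)
Lemma Vop_intertwines (q : R) (a b c : C) (f : C -> C) (x : C) (r : R) :
  (0 < q < 1)%R -> a <> 0 -> b <> 0 -> c <> 0 -> x <> 0 -> (0 < r < Cmod c)%R ->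
  decays q f x r ->
  Vop q c (Lop q a b f) x = Lop_half q a b c (Vop q c f) x.
Proof.
  intros Hq Ha Hb Hc Hx Hr Hf. assert (Hq0 := q_neq_0 q Hq).
  destruct (qbin_bounded q c Hq) as [M [M0 HM]].
  assert (Hs := inv_ratio_lt_1 c r Hc Hr).
  assert (Du := decays_up q f x r Hq (proj1 Hr) Hf).
  assert (Dd := decays_down q f x r Hq (proj1 Hr) Hf).
  set (g := fun p => f (q * x / q ^ p)).
  assert (G1 : forall p, f (x / q ^ p) = g (S p)).
  { intro p. unfold g. f_equal. simpl. assert (Hp := Cpow_nz q p Hq0). field; auto. }
  assert (G2 : forall p, f (x / q / q ^ p) = g (S (S p))).
  { intro p. unfold g. f_equal. simpl. assert (Hp := Cpow_nz q p Hq0). field; auto. }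
  set (u := fun p => qbin q c p * (/ c) ^ p).
  assert (A0 : Cabs (fun p => u p * g p)).
  { unfold u, g. now apply decays_Cabs with M r. }
  assert (A1 : Cabs (fun p => u p * g (S p))).
  { apply (Cabs_ext (fun p => u p * f (x / q ^ p))); [intro; now rewrite G1 |].
    now apply decays_Cabs with M r. }
  assert (A2 : Cabs (fun p => u p * g (S (S p)))).
  { apply (Cabs_ext (fun p => u p * f (x / q / q ^ p))); [intro; now rewrite G2 |].
    now apply decays_Cabs with M r. }
  assert (Qb : forall (v : nat -> C), Cabs v -> Cabs (fun p => q ^ p * v p)).
  { intros v Hv. apply Cabs_bounded_mult with 1%R; auto. intro n.
    rewrite Cmod_qpow by auto. now apply qpow_le_1. }
  set (X := fun p => a / (2 * x) * (q ^ p - 1) * u p).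
  set (Y := fun p => ((a / (2 * c * x) + q / (2 * b * x))
                      - (a / (2 * x) + q / (2 * b * x)) * q ^ p) * u p).
  set (Z := fun p => (q / (2 * b * x) * q ^ p - q / (2 * c * b * x)) * u p).
  assert (aff : forall k l (v : nat -> C), Cabs v -> Cabs (fun p => (k + l * q ^ p) * v p)).
  { intros k l v Hv. apply (Cabs_ext (fun p => k * v p + l * (q ^ p * v p)));
      [intro; ring |]. apply Cabs_plus; apply Cabs_scal; auto. }
  assert (Sum : CSeries (fun p => X p * g p + Y p * g (S p) + Z p * g (S (S p))) = 0).
  { apply three_term_sum_zero.
    - unfold X. simpl. ring.
    - unfold X, Y, u. rewrite qbin_0.
      assert (B := qbin_S q c 0 Hq). rewrite qbin_0 in B. simpl in *.
      transitivity (a / (2 * x) / c * ((1 - c * 1) * 1) - a / (2 * x) / c *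
        (qbin q c 1 * (1 - q * 1))); [| rewrite B; ring]. field. auto.
    - intro p. unfold X, Y, Z, u. assert (B := qbin_S q c p Hq).
      assert (B' := qbin_S q c (S p) Hq). simpl Cpow in *.
      set (v := q ^ p) in *. set (w := (/ c) ^ p).
      transitivity (w * (a / (2 * x) / (c * c)) *
           (qbin q c (S p) * (1 - c * (q * v)) -
            qbin q c (S (S p)) * (1 - q * (q * v)))
         + w * (q / (2 * b * x) / c) *
           (qbin q c (S p) * (1 - q * v) - qbin q c p * (1 - c * v))).
      + field. auto.
      + rewrite B', B. ring.
    - apply (Cabs_ext (fun p => (- (a / (2 * x)) + a / (2 * x) * q ^ p) * (u p * g p)));
        [intro; unfold X; ring | auto].
    - apply (Cabs_ext (fun p => ((a / (2 * c * x) + q / (2 * b * x)) +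
         (- (a / (2 * x) + q / (2 * b * x))) * q ^ p) * (u p * g (S p))));
        [intro; unfold Y; ring | auto].
    - apply (Cabs_ext (fun p => (- (q / (2 * c * b * x)) +
         q / (2 * b * x) * q ^ p) * (u p * g (S (S p)))));
        [intro; unfold Z; ring | auto]. }
  apply Ceq_minus. rewrite <- Sum. unfold Lop_half, Vop.
  replace (CSeries (fun p => qbin q c p * (/ c) ^ p * f (q * x / q ^ p)))
    with (CSeries (fun p => u p * g p)) by reflexivity.
  rewrite (CSeries_ext (fun p => qbin q c p * (/ c) ^ p * f (x / q ^ p))
             (fun p => u p * g (S p))) by (intro; now rewrite G1).
  rewrite (CSeries_ext (fun p => qbin q c p * (/ c) ^ p * f (x / q / q ^ p))
             (fun p => u p * g (S (S p)))) by (intro; now rewrite G2).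
  set (k1 := a / 2 * (1 + 1 / x)).
  set (k2 := a / (2 * c * x) + q / (2 * b * x)).
  set (k3 := 1 / (2 * a) * (1 + a * q / (c * b * x))).
  transitivity (CSeries (fun p => qbin q c p * (/ c) ^ p * Lop q a b f (x / q ^ p))
    + ((- k1) * CSeries (fun p => u p * g p)
       + (k2 * CSeries (fun p => u p * g (S p))
          + (- k3) * CSeries (fun p => u p * g (S (S p)))))); [ring |].
  assert (AL : Cabs (fun p => qbin q c p * (/ c) ^ p * Lop q a b f (x / q ^ p))).
  { apply decays_Cabs with M r; auto; try lra. apply decays_Lop; auto; apply Hr. }
  rewrite <- !CSeries_scal by auto.
  rewrite <- !CSeries_plus by auto 6 using Cabs_plus, Cabs_scal.
  apply CSeries_ext. intro p.
  assert (Hp := Cpow_nz q p Hq0).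
  unfold Lop. rewrite G1.
  replace (f (q * (x / q ^ p))) with (g p)
    by (unfold g; f_equal; field; auto).
  replace (f (x / q ^ p / q)) with (g (S (S p)))
    by (rewrite <- G2; f_equal; field; auto).
  unfold X, Y, Z, k1, k2, k3. fold (u p). field. auto.
Qed.

(** The operator L of parameters (a/c, b/m), conjugated by x^(mu+nu) with q^nu = c
    and q^mu = m. *)
Definition Lop_conj (q : R) (a b c m : C) (g : C -> C) (x : C) : C :=
  m * a / 2 * (1 + 1 / x) * g (q * x)
  - (a / (2 * c * x) + q * m / (2 * b * x)) * g x
  + 1 / (2 * a * m) * (1 + a * m * q / (c * b * x)) * g (x / q).

(** The coefficient of a value of g in the difference of the two sides of the
    intertwining relation, with w j standing for (Z;q)_j/(V;q)_j. *)
Lemma Uop_coefficients_cancel (q : R) (a b c m x : C) (w : nat -> C) (p : nat) :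
  (0 < q < 1)%R -> a <> 0 -> b <> 0 -> c <> 0 -> m <> 0 -> x <> 0 ->
  let Z := - (q * m * a / (c * b * x)) in let V := - (q * m / x) in
  let t := b / (m * a) in
  w p * (1 - Z * q ^ p) = w (S p) * (1 - V * q ^ p) ->
  a / 2 * t ^ S (S p) * qbin q m (S (S p)) * w (S p) *
     (Z / q - Z * q ^ S p)
  + ((a / (2 * c * x) + q * m / (2 * b * x))
     - (a / (2 * c) + q / (2 * b)) * m * q ^ S p / x) *
      (t ^ S p * qbin q m (S p) * w (S p))
  + 1 / (2 * a) * t ^ p * qbin q m p *
      ((1 - Z * q ^ p) * w p - (1 - V / m) * w (S p)) = 0.
Proof.
  intros Hq Ha Hb Hc Hm Hx Z V t Hw. assert (Hq0 := q_neq_0 q Hq).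
  assert (B := qbin_S q m p Hq). assert (B' := qbin_S q m (S p) Hq).
  rewrite (Cmult_comm _ (w p)), Hw. simpl Cpow in *.
  set (v := q ^ p) in *. set (s := t ^ p).
  transitivity (a / 2 * (t * (t * s)) * w (S p) * (Z / q) *
        (qbin q m (S (S p)) * (1 - q * (q * v)) -
         qbin q m (S p) * (1 - m * (q * v)))
     + 1 / (2 * a) * s * w (S p) * (V / m) *
        (qbin q m p * (1 - m * v) - qbin q m (S p) * (1 - q * v))).
  - unfold t, Z, V. field. auto 10.
  - rewrite B, B'. ring.
Qed.

(** Up to the common prefactor at x, the weights at q x, x and x/q are quotients
    (Z q^e;q)_j/(V q^e;q)_j with e = -1, 0, 1, and differ by simple factors only; this
    leaves the cancellation of the previous lemma. *)
Lemma Uop_intertwines (q : R) (a b c m : C) (g : C -> C) (x : C) (r : R) :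
  (0 < q < 1)%R -> a <> 0 -> b <> 0 -> c <> 0 -> m <> 0 -> x <> 0 ->
  (0 < r)%R -> (Cmod (b / (m * a)) * r < 1)%R ->
  qregular q (- (m / x)) -> qregular q (- (x / m / q)) ->
  decays q g (x / m) r ->
  Uop q m a b c (Lop_half q a b c g) x = Lop_conj q a b c m (Uop q m a b c g) x.
Proof.
  intros Hq Ha Hb Hc Hm Hx Hr Ht RV1 RX Hg. assert (Hq0 := q_neq_0 q Hq).
  set (Z := - (q * m * a / (c * b * x))). set (V := - (q * m / x)).
  set (t := b / (m * a)) in *.
  assert (EV : - (m / x) = V / q) by (unfold V; field; auto). rewrite EV in RV1.
  assert (RV : qregular q V).
  { assert (H := qregular_shift q _ 1 RV1).
    replace (V / q * q ^ 1) with V in H by (simpl; field; auto). exact H. }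
  assert (RV2 : qregular q (V * q)).
  { assert (H := qregular_shift q _ 1 RV). now rewrite Cpow_1_r in H. }
  assert (N1 : 1 - V / RtoC q <> 0).
  { assert (H := qregular_factor q _ 0 RV1). simpl in H.
    now replace (V / q * 1) with (V / q) in H by ring. }
  assert (N2 : 1 - V <> 0).
  { assert (H := qregular_factor q _ 0 RV). simpl in H. now replace (V * 1) with V in H by ring. }
  set (w := fun j => qpoch q Z j / qpoch q V j).
  set (wp := fun j => qpoch q (Z / q) j / qpoch q (V / q) j).
  set (wm := fun j => qpoch q (Z * q) j / qpoch q (V * q) j).
  assert (w0 : w O = 1) by (unfold w; simpl; field).
  assert (wp0 : wp O = 1) by (unfold wp; simpl; field).
  assert (wS : forall j, w j * (1 - Z * q ^ j) = w (S j) * (1 - V * q ^ j)).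
  { intro j. unfold w. rewrite !qpoch_S. field. split.
    - now apply qregular_factor.
    - now apply qpoch_neq_0. }
  assert (wpS : forall j, (1 - V / q) * wp (S j) = (1 - Z / q) * w j).
  { intro j. unfold w, wp. rewrite !qpoch_S_l.
    replace (Z / q * q) with Z by (field; auto).
    replace (V / q * q) with V by (field; auto).
    assert (N1' : q - V <> 0).
    { replace (q - V) with (q * (1 - V / q)) by (field; auto).
      now apply Cmult_neq_0. }
    assert (NV := qpoch_neq_0 q V j RV). field. auto 10. }
  assert (wmE : forall j, (1 - Z) / (1 - V) * wm j = w (S j)).
  { intro j. unfold w, wm. rewrite !qpoch_S_l. field. split; auto. now apply qpoch_neq_0. }
  destruct (qbin_bounded q m Hq) as [M [M0 HM]].
  destruct (qpoch_div_bounded q Z V Hq RV) as [Mw [Mw0 HMw]]. fold w in HMw.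
  destruct (qpoch_div_bounded q (Z / q) (V / q) Hq RV1) as [Mp [Mp0 HMp]].
  destruct (qpoch_div_bounded q (Z * q) (V * q) Hq RV2) as [Mm [Mm0 HMm]].
  assert (Bd : forall (y : nat -> C) K, (forall n, (Cmod (y n) <= K)%R) ->
             forall n, (Cmod (qbin q m n * y n) <= M * K)%R).
  { intros y K Hy n. rewrite Cmod_mult. apply Rmult_le_compat; auto using Cmod_ge_0. }
  assert (Du := decays_up q g _ r Hq Hr Hg). assert (Dd := decays_down q g _ r Hq Hr Hg).
  set (G := fun p => g (q * (x / m) / q ^ p)).
  assert (G1 : forall p, g (x / m / q ^ p) = G (S p)).
  { intro p. unfold G. f_equal. simpl. assert (Hp := Cpow_nz q p Hq0). field; auto. }
  assert (G0 : forall p, g (q * x / m / q ^ p) = G p).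
  { intro p. unfold G. f_equal. assert (Hp := Cpow_nz q p Hq0). field; auto. }
  assert (G2 : forall p, g (x / q / m / q ^ p) = G (S (S p))).
  { intro p. unfold G. f_equal. simpl. assert (Hp := Cpow_nz q p Hq0). field; auto. }
  assert (AG0 : forall (y : nat -> C) K, (forall n, (Cmod (y n) <= K)%R) ->
             Cabs (fun p => qbin q m p * y p * t ^ p * G p)).
  { intros y K Hy. unfold G.
    apply (decays_Cabs q g _ t (fun p => qbin q m p * y p)) with (M * K)%R r; auto. }
  assert (AG1 : forall (y : nat -> C) K, (forall n, (Cmod (y n) <= K)%R) ->
             Cabs (fun p => qbin q m p * y p * t ^ p * G (S p))).
  { intros y K Hy.
    apply (Cabs_ext (fun p => qbin q m p * y p * t ^ p * g (x / m / q ^ p)));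
      [intro; now rewrite G1 |].
    apply (decays_Cabs q g _ t (fun p => qbin q m p * y p)) with (M * K)%R r; auto. }
  assert (AG2 : forall (y : nat -> C) K, (forall n, (Cmod (y n) <= K)%R) ->
             Cabs (fun p => qbin q m p * y p * t ^ p * G (S (S p)))).
  { intros y K Hy.
    apply (Cabs_ext (fun p => qbin q m p * y p * t ^ p * g (x / m / q / q ^ p))).
    - intro p. rewrite <- G2. f_equal. f_equal.
      assert (Hp := Cpow_nz q p Hq0). field; auto.
    - apply (decays_Cabs q g _ t (fun p => qbin q m p * y p)) with (M * K)%R r; auto. }
  assert (Qb : forall (y : nat -> C) K k l, (0 <= K)%R -> (forall n, (Cmod (y n) <= K)%R) ->
            forall n, (Cmod ((k + l * q ^ n) * y n) <= (Cmod k + Cmod l) * K)%R).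
  { intros y K k l HK Hy n. rewrite Cmod_mult. apply Rmult_le_compat; auto using Cmod_ge_0.
    eapply Rle_trans; [apply Cmod_triangle |].
    pose proof (Cmod_mult_qpow_le q l n Hq). lra. }
  set (X := fun p => qbin q m p * ((a / 2 + - (a / 2 * V / q) * q ^ p) * w p) * t ^ p
       + (- (a / 2 * (1 - V / q))) * (qbin q m p * wp p * t ^ p)).
  set (Y := fun p => qbin q m p *
      (((a / (2 * c * x) + q * m / (2 * b * x))
        + - ((a / (2 * c) + q / (2 * b)) * m / x) * q ^ p) * w p) * t ^ p).
  set (W := fun p => qbin q m p *
      ((1 / (2 * a) + - (1 / (2 * a) * Z) * q ^ p) * w p) * t ^ p
       + (- (1 / (2 * a) * (1 - V / m) * ((1 - Z) / (1 - V)))) * (qbin q m p * wm p * t ^ p)).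
  assert (XS : forall p, X (S p) =
      a / 2 * t ^ S p * qbin q m (S p) * w p * (Z / q - Z * q ^ p)).
  { intro p. unfold X.
    transitivity (qbin q m (S p) * t ^ S p * (a / 2) *
       (w (S p) * (1 - V * q ^ p) - (1 - V / q) * wp (S p))).
    - simpl. field. auto 10.
    - rewrite <- wS, wpS. ring. }
  assert (AX : Cabs (fun p => X p * G p)).
  { apply (Cabs_ext (fun p =>
        qbin q m p * ((a / 2 + - (a / 2 * V / q) * q ^ p) * w p) * t ^ p * G p
        + (- (a / 2 * (1 - V / q))) * (qbin q m p * wp p * t ^ p * G p)));
        [intro; unfold X; ring |].
      apply Cabs_plus.
      + eapply (AG0 (fun p => (a / 2 + - (a / 2 * V / q) * q ^ p) * w p)).
        now apply Qb with (K := Mw).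
      + apply Cabs_scal. now apply AG0 with Mp. }
  assert (AY : Cabs (fun p => Y p * G (S p))).
  { eapply (AG1 (fun p => ((a / (2 * c * x) + q * m / (2 * b * x))
        + - ((a / (2 * c) + q / (2 * b)) * m / x) * q ^ p) * w p)).
      now apply Qb with (K := Mw). }
  assert (AW : Cabs (fun p => W p * G (S (S p)))).
  { apply (Cabs_ext (fun p =>
        qbin q m p * ((1 / (2 * a) + - (1 / (2 * a) * Z) * q ^ p) * w p) * t ^ p * G (S (S p))
        + (- (1 / (2 * a) * (1 - V / m) * ((1 - Z) / (1 - V)))) *
          (qbin q m p * wm p * t ^ p * G (S (S p)))));
        [intro; unfold W; ring |].
      apply Cabs_plus.
      + eapply (AG2 (fun p => (1 / (2 * a) + - (1 / (2 * a) * Z) * q ^ p) * w p)).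
        now apply Qb with (K := Mw).
      + apply Cabs_scal. now apply AG2 with Mm. }
  assert (Sum : CSeries (fun p => X p * G p + Y p * G (S p) + W p * G (S (S p))) = 0).
  { apply three_term_sum_zero.
    - unfold X. rewrite w0, wp0. simpl. field. auto 10.
    - rewrite XS. unfold Y. rewrite w0, qbin_0.
      assert (B := qbin_S q m 0 Hq). rewrite qbin_0 in B. simpl in *.
      transitivity (a / 2 * t * (Z / q) * (qbin q m 1 * (1 - q * 1) - 1 * (1 - m * 1))).
      + unfold t, Z. field. auto 10.
      + rewrite B. ring.
    - intro p. rewrite XS. unfold Y, W.
      rewrite <- (Uop_coefficients_cancel q a b c m x w p Hq Ha Hb Hc Hm Hx (wS p)).
      fold Z V t. rewrite <- (wmE p) at 5. ring_simplify. field. auto 10.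
    - exact AX.
    - exact AY.
    - exact AW. }
  (* no factor vanishes at x and q x because none does at x / q *)
  assert (RX0 : qregular q (- (x / m))).
  { assert (H := qregular_shift q _ 1 RX).
    now replace (- (x / m / q) * q ^ 1) with (- (x / m)) in H by (simpl; field; auto). }
  assert (RX1 : qregular q (- (q * x / m))).
  { assert (H := qregular_shift q _ 1 RX0).
    now replace (- (x / m) * q ^ 1) with (- (q * x / m)) in H by (simpl; field; auto). }
  set (P := qpoch_inf q (- x) / qpoch_inf q (- (x / m))).
  assert (n0 := qpoch_inf_neq_0 q _ Hq RX0). assert (n1 := qpoch_inf_neq_0 q _ Hq RX1).
  assert (f0 := qregular_factor q _ 0 RX0). assert (f1 := qregular_factor q _ 0 RX).
  simpl Cpow in f0, f1.
  assert (d0 : m + x <> 0).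
  { replace (m + x) with (m * (1 - - (x / m) * 1)) by (field; auto). now apply Cmult_neq_0. }
  assert (d1 : m * q + x <> 0).
  { replace (m * q + x) with (m * q * (1 - - (x / m / q) * 1)) by (field; auto).
    apply Cmult_neq_0; auto. now apply Cmult_neq_0. }
  assert (d2 : m - - x <> 0) by (now replace (m - - x) with (m + x) by ring).
  assert (P1 : (1 + 1 / x) * (qpoch_inf q (- (q * x)) / qpoch_inf q (- (q * x / m)))
               = P * (1 - V / q) / m).
  { unfold P. rewrite (qpoch_inf_S q (- x)), (qpoch_inf_S q (- (x / m))) by auto.
    replace (- x * q) with (- (q * x)) by ring.
    replace (- (x / m) * q) with (- (q * x / m)) by (field; auto).
    unfold V. field. auto 10. }
  assert (P2 : qpoch_inf q (- (x / q)) / qpoch_inf q (- (x / q / m))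
               = P * m * (1 - V / m) / (1 - V)).
  { rewrite (qpoch_inf_S q (- (x / q))), (qpoch_inf_S q (- (x / q / m))) by auto.
    replace (- (x / q) * q) with (- x) by (field; auto).
    replace (- (x / q / m) * q) with (- (x / m)) by (field; auto).
    unfold P, V in *. field. repeat split; auto.
    replace (x - - (q * m)) with (m * q + x) by ring. auto. }
  unfold Lop_conj, Uop. fold Z V t P.
  replace (- (q * m * a / (c * b * (q * x)))) with (Z / q)
    by (unfold Z; field; auto 10).
  replace (- (q * m / (q * x))) with (V / q) by (unfold V; field; auto).
  replace (- (q * m * a / (c * b * (x / q)))) with (Z * q)
    by (unfold Z; field; auto 10).
  replace (- (q * m / (x / q))) with (V * q) by (unfold V; field; auto).
  rewrite P2.
  set (S0 := CSeries (fun p => qbin q m p * wp p * t ^ p * G p)).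
  set (S1 := CSeries (fun p => qbin q m p * w p * t ^ p * G (S p))).
  set (S2 := CSeries (fun p => qbin q m p * wm p * t ^ p * G (S (S p)))).
  replace (CSeries (fun p => qbin q m p * (qpoch q (Z / q) p / qpoch q (V / q) p) * t ^ p *
                g (q * x / m / q ^ p)))
    with S0 by (apply CSeries_ext; intro; now rewrite G0).
  replace (CSeries (fun p => qbin q m p * (qpoch q Z p / qpoch q V p) * t ^ p *
                g (x / m / q ^ p)))
    with S1 by (apply CSeries_ext; intro; now rewrite G1).
  replace (CSeries (fun p => qbin q m p * (qpoch q (Z * q) p / qpoch q (V * q) p) * t ^ p *
                g (x / q / m / q ^ p)))
    with S2 by (apply CSeries_ext; intro; now rewrite G2).
  set (SL := CSeries (fun j => qbin q m j * (qpoch q Z j / qpoch q V j) * t ^ j *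
                      Lop_half q a b c g (x / m / q ^ j))).
  replace (m * a / 2 * (1 + 1 / x) *
     (qpoch_inf q (- (q * x)) / qpoch_inf q (- (q * x / m)) * S0))
    with (m * a / 2 * S0 * (P * (1 - V / q) / m)) by (rewrite <- P1; ring).
  replace (1 + a * m * q / (c * b * x)) with (1 - Z) by (unfold Z; field; auto 10).
  set (k1 := a / 2 * (1 - V / q)).
  set (k2 := a / (2 * c * x) + q * m / (2 * b * x)).
  set (k3 := 1 / (2 * a) * (1 - V / m) * ((1 - Z) / (1 - V))).
  assert (E : SL = k1 * S0 + ((- k2) * S1 + k3 * S2)).
  { assert (A0 := AG0 wp Mp HMp). assert (A1 := AG1 w Mw HMw). assert (A2 := AG2 wm Mm HMm).
    transitivity (CSeries (fun p => X p * G p + Y p * G (S p) + W p * G (S (S p)))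
                  + (k1 * S0 + ((- k2) * S1 + k3 * S2))); [| rewrite Sum; ring].
    unfold S0, S1, S2. rewrite <- !CSeries_scal by auto.
    rewrite <- !CSeries_plus by auto 6 using Cabs_plus, Cabs_scal.
    apply CSeries_ext. intro p. assert (Hp := Cpow_nz q p Hq0).
    unfold Lop_half. rewrite G1.
    replace (g (q * (x / m / q ^ p))) with (G p)
      by (unfold G; f_equal; field; auto).
    replace (g (x / m / q ^ p / q)) with (G (S (S p)))
      by (rewrite <- G2; f_equal; field; auto).
    change (qpoch q Z p / qpoch q V p) with (w p).
    unfold X, Y, W, k1, k2, k3, Z, V. field. repeat split; auto.
    replace (x - - (q * m)) with (m * q + x) by ring. auto. }
  rewrite E. unfold k1, k2, k3. field. auto 10.
Qed.

(** * Integral powers *)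

Lemma CpowZ_of_nat (z : C) (n : nat) : CpowZ z (Z.of_nat n) = z ^ n.
Proof. destruct n; [reflexivity |]. simpl CpowZ. now rewrite SuccNat2Pos.id_succ. Qed.

Lemma CpowZ_opp_of_nat (z : C) (n : nat) : CpowZ z (- Z.of_nat n) = / z ^ n.
Proof.
  destruct n; [simpl; field |]. simpl CpowZ. now rewrite SuccNat2Pos.id_succ.
Qed.

Lemma CpowZ_succ (z : C) (n : Z) : z <> 0 -> CpowZ z (n + 1) = z * CpowZ z n.
Proof.
  intros Hz. destruct (Z_lt_le_dec n 0) as [H | H].
  - replace n with (- Z.of_nat (S (Z.to_nat (- n - 1))))%Z by lia.
    set (k := Z.to_nat (- n - 1)).
    replace (- Z.of_nat (S k) + 1)%Z with (- Z.of_nat k)%Z by lia.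
    rewrite !CpowZ_opp_of_nat. assert (Hk := Cpow_nz z k Hz). simpl. field. auto.
  - replace n with (Z.of_nat (Z.to_nat n)) by lia. set (k := Z.to_nat n).
    replace (Z.of_nat k + 1)%Z with (Z.of_nat (S k)) by lia.
    now rewrite !CpowZ_of_nat.
Qed.

Lemma CpowZ_neq_0 (z : C) (n : Z) : z <> 0 -> CpowZ z n <> 0.
Proof.
  intros Hz. destruct (Z_lt_le_dec n 0) as [H | H].
  - replace n with (- Z.of_nat (Z.to_nat (- n)))%Z by lia. rewrite CpowZ_opp_of_nat.
    intro E. apply C1_nz. rewrite <- (Cinv_r (z ^ Z.to_nat (- n))) by now apply Cpow_nz.
    rewrite E. ring.
  - replace n with (Z.of_nat (Z.to_nat n)) by lia. rewrite CpowZ_of_nat. now apply Cpow_nz.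
Qed.

Lemma CpowZ_pred (z : C) (n : Z) : z <> 0 -> CpowZ z (n - 1) = CpowZ z n / z.
Proof.
  intros Hz. assert (E := CpowZ_succ z (n - 1) Hz).
  replace (n - 1 + 1)%Z with n in E by lia. rewrite E. field. auto.
Qed.

Lemma CpowZ_add_nat (z : C) (n : Z) (p : nat) :
  z <> 0 -> CpowZ z (n + Z.of_nat p) = CpowZ z n * z ^ p.
Proof.
  intros Hz. induction p; [rewrite Z.add_0_r; simpl; ring |].
  replace (n + Z.of_nat (S p))%Z with (n + Z.of_nat p + 1)%Z by lia.
  rewrite CpowZ_succ, IHp by auto. simpl. ring.
Qed.

Lemma CpowZ_sub_nat (z : C) (n : Z) (p : nat) :
  z <> 0 -> CpowZ z (n - Z.of_nat p) = CpowZ z n / z ^ p.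
Proof.
  intros Hz. assert (E := CpowZ_add_nat z (n - Z.of_nat p) p Hz).
  replace (n - Z.of_nat p + Z.of_nat p)%Z with n in E by lia. rewrite E.
  assert (H := Cpow_nz z p Hz). field. auto.
Qed.

(** Used to propagate identities along a q-lattice in both directions. *)
Lemma Zstep_constant (G : Z -> C) :
  (forall k, G (k + 1)%Z = G k) -> forall k, G k = G 0%Z.
Proof.
  intros H k.
  assert (P : forall n : nat, G (Z.of_nat n) = G 0%Z).
  { induction n; [reflexivity |].
    replace (Z.of_nat (S n)) with (Z.of_nat n + 1)%Z by lia. now rewrite H. }
  assert (N : forall n : nat, G (- Z.of_nat n)%Z = G 0%Z).
  { induction n; [reflexivity |].
    rewrite <- IHn. rewrite <- (H (- Z.of_nat (S n))%Z). f_equal. lia. }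
  destruct (Z_lt_le_dec k 0).
  - replace k with (- Z.of_nat (Z.to_nat (- k)))%Z by lia. auto.
  - replace k with (Z.of_nat (Z.to_nat k)) by lia. auto.
Qed.

Lemma CpowZ_opp (z : C) (k : Z) : z <> 0 -> CpowZ z (- k) = / CpowZ z k.
Proof.
  intro Hz. assert (H : CpowZ z (- k) * CpowZ z k = 1).
  { rewrite (Zstep_constant (fun k => CpowZ z (- k) * CpowZ z k)).
    - simpl. ring.
    - intro j. rewrite CpowZ_succ by auto. replace (- (j + 1))%Z with (- j - 1)%Z by lia.
      rewrite CpowZ_pred by auto. field. auto. }
  assert (N := CpowZ_neq_0 z k Hz). rewrite <- (Cmult_1_l (/ CpowZ z k)), <- H. field. auto.
Qed.

Lemma CpowZ_mult (z w : C) (k : Z) :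
  z <> 0 -> w <> 0 -> CpowZ (z * w) k = CpowZ z k * CpowZ w k.
Proof.
  intros Hz Hw. assert (Hzw := Cmult_neq_0 z w Hz Hw).
  assert (N := fun k => CpowZ_neq_0 (z * w) k Hzw).
  assert (H : CpowZ z k * CpowZ w k / CpowZ (z * w) k = 1).
  { rewrite (Zstep_constant (fun k => CpowZ z k * CpowZ w k / CpowZ (z * w) k)).
    - simpl. field.
    - intro j. rewrite !CpowZ_succ by auto. specialize (N j). field. auto. }
  specialize (N k). rewrite <- (Cmult_1_l (CpowZ (z * w) k)), <- H. field. auto.
Qed.

Lemma CpowZ_pos (q : R) (k : Z) : (0 < q)%R -> exists t, (0 < t)%R /\ CpowZ q k = RtoC t.
Proof.
  intro Hq. assert (Hq0 : RtoC q <> 0) by (apply RtoC_neq_0; lra).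
  destruct (Z_lt_le_dec k 0).
  - replace k with (- Z.of_nat (Z.to_nat (- k)))%Z by lia. rewrite CpowZ_opp_of_nat.
    exists (/ q ^ Z.to_nat (- k))%R. split; [apply Rinv_0_lt_compat, pow_lt; auto |].
    rewrite RtoC_inv, RtoC_pow; auto. apply pow_nonzero; lra.
  - replace k with (Z.of_nat (Z.to_nat k)) by lia. rewrite CpowZ_of_nat.
    exists (q ^ Z.to_nat k)%R. split; [apply pow_lt; auto | now rewrite RtoC_pow].
Qed.

(** * The operator W *)

Lemma W_regular_neighbours (q : R) (mu x : C) :
  (0 < q < 1)%R -> W_regular q mu x ->
  W_regular q mu (q * x) /\ W_regular q mu (x / q).
Proof.
  intros Hq [Hx H]. assert (Hq0 := q_neq_0 q Hq). split; split.
  - now apply Cmult_neq_0.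
  - intros n E. apply (H (n - 1)%Z). rewrite CpowZ_pred, <- E by auto. field. auto.
  - now apply Cdiv_neq_0.
  - intros n E. apply (H (n + 1)%Z). rewrite CpowZ_succ, <- E by auto. field. auto.
Qed.

Lemma W_regular_qregular (q : R) (mu x : C) :
  (0 < q < 1)%R -> W_regular q mu x ->
  let m := cpow q mu in
  qregular q (- (q * m / x)) /\ qregular q (- (m / x)) /\
  qregular q (- (x / m / q)).
Proof.
  intros Hq [Hx H] m. assert (Hq0 := q_neq_0 q Hq).
  assert (Hm : m <> 0) by apply cpow_neq_0.
  assert (H' : forall n, - (x / m) <> CpowZ q n).
  { intros n E. apply (H n). rewrite <- E, cpow_opp. reflexivity. }
  assert (aux : forall n : nat, - (m / x) * q ^ n <> 1).
  { intros n E. apply (H' (Z.of_nat n)). rewrite CpowZ_of_nat.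
    transitivity (- (x / m) * (- (m / x) * q ^ n)); [rewrite E; ring | field; auto]. }
  repeat split.
  - intros n E. apply (aux (S n)). rewrite <- E. simpl. field. auto.
  - exact aux.
  - intros n E. apply (H' (1 - Z.of_nat n)%Z). rewrite CpowZ_sub_nat by auto.
    assert (Hn := Cpow_nz q n Hq0). simpl CpowZ. rewrite <- (Cmult_1_r (q ^ n)), <- E at 1.
    simpl. field. auto.
Qed.

(** W is the composition of its two factors: the double series is summed along
    diagonals on one side and by rows on the other. *)
Lemma Wop_factorization (q : R) (nu mu a b : C) (f : C -> C) (x : C) (r : R) :
  (0 < q < 1)%R -> a <> 0 -> b <> 0 ->
  (Cmod (cpow q (nu - mu) * b / a) < 1)%R -> W_regular q mu x ->
  let c := cpow q nu in let m := cpow q mu in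
  (0 < r < Cmod c)%R -> decays q f (x / m) r ->
  Cabs (W_term q nu mu a b f x) /\
  Wop q nu mu a b f x =
    cpow q (- (mu * mu)) * cpow (b / a) mu * cpow x (mu + nu) *
    Uop q m a b c (Vop q c f) x.
Proof.
  intros Hq Ha Hb Ht HW c m Hr Hf. assert (Hq0 := q_neq_0 q Hq).
  assert (Hc : c <> 0) by apply cpow_neq_0. assert (Hm : m <> 0) by apply cpow_neq_0.
  destruct (W_regular_qregular q mu x Hq HW) as [RV _]. fold m in RV.
  destruct HW as [Hx _].
  rewrite cpow_minus in Ht. fold c m in Ht.
  set (Z := - (q * m * a / (c * b * x))). set (V := - (q * m / x)) in *.
  set (t := c * b / (m * a)).
  assert (Ht' : (Cmod t < 1)%R).
  { replace t with (c / m * b / a) by (unfold t; field; auto). exact Ht. }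
  set (w := fun j => qpoch q Z j / qpoch q V j).
  set (A := fun j i => qbin q m j * w j * t ^ j * qbin q c i *
                       ((/ c) ^ (j + i) * f (x / m / q ^ (j + i)))).
  assert (E : forall p, W_term q nu mu a b f x p = diag A p).
  { intro p. rewrite W_term_conv by auto. fold c m Z V t. unfold kernel_conv, diag.
    rewrite <- psum_scal. apply psum_ext. intros j Hj. unfold A, w.
    replace (j + (p - j))%nat with p by lia.
    assert (Hp := Cpow_nz q p Hq0).
    replace (x / m / q ^ p) with (x / (m * q ^ p)) by (field; auto). ring. }
  destruct (qbin_bounded q m Hq) as [M1 [P1 H1]].
  destruct (qbin_bounded q c Hq) as [M2 [P2 H2]].
  destruct (qpoch_div_bounded q Z V Hq RV) as [M3 [P3 H3]].
  assert (Hfr := Hf). destruct Hfr as [K [K0 HK]].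
  set (s := (Cmod (/ c) * r)%R).
  assert (Hs : (0 <= s < 1)%R).
  { split; [apply Rmult_le_pos; [apply Cmod_ge_0 | lra] | now apply inv_ratio_lt_1]. }
  assert (Pt := Cmod_ge_0 t).
  assert (HA : forall j i, (Cmod (A j i) <= (M1 * M3 * M2 * K * (Cmod t * s) ^ j) * s ^ i)%R).
  { intros j i. unfold A. rewrite !Cmod_mult, !Cmod_pow.
    replace (M1 * M3 * M2 * K * (Cmod t * s) ^ j * s ^ i)%R with
      (M1 * M3 * Cmod t ^ j * M2 * ((Cmod (/ c)) ^ (j + i) * (K * r ^ (j + i))))%R
      by (unfold s; rewrite !Rpow_mult_distr, !pow_add; ring).
    assert (0 <= Cmod t ^ j)%R by now apply pow_le.
    assert (0 <= Cmod (/ c) ^ (j + i))%R by (apply pow_le, Cmod_ge_0).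
    specialize (HK (j + i)%nat).
    assert (B1 : (0 <= Cmod (qbin q m j) * Cmod (w j) <= M1 * M3)%R).
    { split; [apply Rmult_le_pos; apply Cmod_ge_0 |].
      apply Rmult_le_compat; [apply Cmod_ge_0 | apply Cmod_ge_0 | apply H1 | apply H3]. }
    assert (B2 : (0 <= Cmod (qbin q m j) * Cmod (w j) * Cmod t ^ j <= M1 * M3 * Cmod t ^ j)%R).
    { split; [apply Rmult_le_pos; lra |]. apply Rmult_le_compat_r; lra. }
    apply Rmult_le_compat.
    - apply Rmult_le_pos; [lra | apply Cmod_ge_0].
    - apply Rmult_le_pos; [lra | apply Cmod_ge_0].
    - apply Rmult_le_compat; [lra | apply Cmod_ge_0 | lra | auto].
    - apply Rmult_le_compat_l; auto. }
  assert (S1 : ex_series (fun j => (M1 * M3 * M2 * K * (Cmod t * s) ^ j)%R)).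
  { apply ex_series_geom_scal. nra. }
  assert (S2 : ex_series (fun i => (s ^ i)%R)).
  { apply ex_series_geom. rewrite Rabs_pos_eq; lra. }
  assert (Q1 : forall j, (0 <= M1 * M3 * M2 * K * (Cmod t * s) ^ j)%R).
  { intro j. assert (0 <= (Cmod t * s) ^ j)%R by (apply pow_le; nra).
    repeat apply Rmult_le_pos; auto. }
  assert (Q2 : forall i, (0 <= s ^ i)%R) by (intro; apply pow_le; lra).
  assert (AD : Cabs (diag A)) by exact (Cabs_diag A _ _ HA S1 S2 Q1 Q2).
  split; [exact (Cabs_ext _ _ (fun p => eq_sym (E p)) AD) |].
  unfold Wop. rewrite (CSeries_ext _ _ E).
  rewrite (hasum_CSeries _ _ (fubini_diag A _ _ HA S1 S2 Q1 Q2)).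
  unfold Uop. fold Z V. rewrite cpow_opp. fold m.
  replace (- (x * / m)) with (- (x / m)) by reflexivity.
  rewrite (CSeries_ext (fun i => CSeries (A i)) (fun j => qbin q m j *
     (qpoch q Z j / qpoch q V j) * (b / (m * a)) ^ j * Vop q c f (x / m / q ^ j))); [ring |].
  intro j. unfold Vop. rewrite <- CSeries_scal.
  - apply CSeries_ext. intro i. unfold A, w, t.
    replace (c * b / (m * a)) with (c * (b / (m * a))) by (field; auto).
    rewrite Cpow_mult_l, !Cpow_add_r, !Cpow_inv by auto.
    assert (Hcj := Cpow_nz c j Hc). assert (Hci := Cpow_nz c i Hc).
    assert (Hqj := Cpow_nz q j Hq0). assert (Hqi := Cpow_nz q i Hq0).
    assert (HVj := qpoch_neq_0 q V j RV).
    replace (x / m / (q ^ j * q ^ i)) with (x / m / q ^ j / q ^ i)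
      by (field; auto).
    set (u := f (x / m / q ^ j / q ^ i)). set (T := (b / (m * a)) ^ j).
    field. auto.
  - destruct (decays_shift q f (x / m) r 0 Hq (proj1 Hr) Hf) as [K' [K0' HK']].
    apply (decays_Cabs q f (x / m / q ^ j) (/ c) (qbin q c) M2 r); auto; try lra.
    + now apply inv_ratio_lt_1.
    + exists (K' * r ^ j)%R. split; [apply Rmult_le_pos; auto; apply pow_le; lra |]. auto.
Qed.

(** The power x^(mu+nu) contributes the factors m c at q x and 1/(m c) at x/q,
    which is the conjugation built into the intermediate forms of L. *)
Theorem Wop_intertwines (q : R) (nu mu a b : C) (f : C -> C) (x : C) (r : R) :
  (0 < q < 1)%R -> a <> 0 -> b <> 0 ->
  (Cmod (cpow q (nu - mu) * b / a) < 1)%R -> W_regular q mu x ->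
  (0 < r < Cmod (cpow q nu))%R -> decays q f (x / cpow q mu) r ->
  Wop q nu mu a b (Lop q a b f) x =
  Lop q (a * cpow q (- nu)) (b * cpow q (- mu)) (Wop q nu mu a b f) x.
Proof.
  intros Hq Ha Hb Ht HW Hr Hf. assert (Hq0 := q_neq_0 q Hq).
  destruct (W_regular_neighbours q mu x Hq HW) as [HWu HWd].
  destruct (W_regular_qregular q mu x Hq HW) as [_ [RV RX]].
  assert (Hx := proj1 HW).
  set (c := cpow q nu) in *. set (m := cpow q mu) in *.
  assert (Hc : c <> 0) by apply cpow_neq_0. assert (Hm : m <> 0) by apply cpow_neq_0.
  assert (Hxm := Cdiv_neq_0 x m Hx Hm).
  assert (Hu : decays q f (q * x / m) r).
  { replace (q * x / m) with (q * (x / m)) by (field; auto).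
    apply decays_up; auto; lra. }
  assert (Hd : decays q f (x / q / m) r).
  { replace (x / q / m) with (x / m / q) by (field; auto).
    apply decays_down; auto; lra. }
  assert (HL : decays q (Lop q a b f) (x / m) r) by (apply decays_Lop; auto; lra).
  destruct (Wop_factorization q nu mu a b _ x r Hq Ha Hb Ht HW Hr HL) as [_ E0].
  destruct (Wop_factorization q nu mu a b f x r Hq Ha Hb Ht HW Hr Hf) as [_ E1].
  destruct (Wop_factorization q nu mu a b f _ r Hq Ha Hb Ht HWu Hr Hu) as [_ E2].
  destruct (Wop_factorization q nu mu a b f _ r Hq Ha Hb Ht HWd Hr Hd) as [_ E3].
  fold c m in E0, E1, E2, E3.
  unfold Lop at 2. rewrite E0, E1, E2, E3.
  rewrite cpow_scale, cpow_scale_inv, cpow_plus by (auto; lra).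
  rewrite !cpow_opp. rewrite (cpow_plus q). fold c m.
  assert (EU : Uop q m a b c (Vop q c (Lop q a b f)) x
               = Lop_conj q a b c m (Uop q m a b c (Vop q c f)) x).
  { rewrite <- Uop_intertwines with (r := r); auto; try lra.
    - unfold Uop. f_equal. apply CSeries_ext. intro j. f_equal.
      assert (Hqj := Cpow_nz q j Hq0).
      apply Vop_intertwines with r; auto.
      + now apply Cdiv_neq_0.
      + destruct (decays_shift q f (x / m) r 0 Hq (proj1 Hr) Hf) as [K [K0 HK]].
        exists (K * r ^ j)%R. split; [apply Rmult_le_pos; auto; apply pow_le; lra |]. auto.
    - rewrite cpow_minus in Ht. fold c m in Ht.
      replace (c / m * b / a) with (c * (b / (m * a))) in Ht by (field; auto).
      rewrite Cmod_mult in Ht. pose proof (Cmod_ge_0 (b / (m * a))). nra.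
    - apply Vop_decays; auto. }
  rewrite EU. unfold Lop_conj.
  set (U0 := Uop q m a b c (Vop q c f) x).
  set (U1 := Uop q m a b c (Vop q c f) (q * x)).
  set (U2 := Uop q m a b c (Vop q c f) (x / q)).
  set (k := / cpow q (mu * mu) * cpow (b / a) mu). set (xp := cpow x mu * cpow x nu).
  field. auto 10.
Qed.

(** ** The asymptotically free solution *)

Lemma free_solution_qregular (q : R) (sigma : C) :
  (0 < q < 1)%R -> (forall n : Z, sigma * sigma <> CpowZ q n) ->
  qregular q (q * (sigma * sigma)).
Proof.
  intros Hq H n E. assert (Hq0 := q_neq_0 q Hq). apply (H (- Z.of_nat (S n))%Z).
  rewrite CpowZ_opp_of_nat. assert (Hn := Cpow_nz q n Hq0).
  transitivity (q * (sigma * sigma) * q ^ n / (q * q ^ n));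
    [field; auto | rewrite E; simpl; field; auto].
Qed.

(** The hypergeometric equation at z = -q^(-k)/y, rewritten in the variable x = y q^k. *)
Lemma Phi_three_term (q : R) (a b sigma y : C) (k : Z) :
  (0 < q < 1)%R -> a <> 0 -> b <> 0 -> sigma <> 0 -> y <> 0 ->
  qregular q (q * (sigma * sigma)) ->
  (forall n : Z, cut_plane (- (CpowZ q n / y))) ->
  let x := y * CpowZ q k in
  a / 2 * (1 + 1 / x) * Phi q a b sigma y (k + 1)
  - (a / (2 * x) + q / (2 * b * x)) * Phi q a b sigma y k
  + 1 / (2 * a) * (1 + a * q / (b * x)) * Phi q a b sigma y (k - 1)
  = (sigma + / sigma) / 2 * Phi q a b sigma y k.
Proof.
  intros Hq Ha Hb Hs Hy RC Hcut x. assert (Hq0 := q_neq_0 q Hq).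
  assert (HA : a * sigma <> 0) by now apply Cmult_neq_0.
  assert (HB : q * sigma / b <> 0) by (apply Cdiv_neq_0; auto; now apply Cmult_neq_0).
  assert (Hk := CpowZ_neq_0 q k Hq0).
  assert (HAk := CpowZ_neq_0 (a * sigma) k HA).
  assert (E := qhyp_hyp_eq q _ _ _ _ Hq HA HB RC (Hcut (- k)%Z) O). cbv beta in E.
  set (F := qhyp q [a * sigma; q * sigma / b] [q * (sigma * sigma)]) in *.
  unfold Phi. fold F.
  replace (1 - (k + 1))%Z with (- k)%Z by lia.
  replace (1 - (k - 1))%Z with (- k + 1 + 1)%Z by lia.
  replace (1 - k)%Z with (- k + 1)%Z by lia.
  rewrite !CpowZ_succ by auto.
  replace (- (k + 1))%Z with (- k - 1)%Z by lia.
  replace (- (k - 1))%Z with (- k + 1)%Z by lia.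
  rewrite CpowZ_succ, CpowZ_pred by auto.
  rewrite (CpowZ_opp q) in E |- * by auto. rewrite (CpowZ_opp (a * sigma)) by auto.
  simpl Cpow in E.
  replace (- (/ CpowZ q k / y) * 1) with (- (/ CpowZ q k / y)) in E by ring.
  replace (- (/ CpowZ q k / y) * (q * 1))
    with (- (q * / CpowZ q k / y)) in E by (field; auto).
  replace (- (/ CpowZ q k / y) * (q * (q * 1)))
    with (- (q * (q * / CpowZ q k) / y)) in E by (field; auto).
  set (F0 := F (- (/ CpowZ q k / y))) in *.
  set (F1 := F (- (q * / CpowZ q k / y))) in *.
  set (F2 := F (- (q * (q * / CpowZ q k) / y))) in *.
  apply -> Ceq_minus in E. apply Ceq_minus.
  transitivity (/ CpowZ (a * sigma) k / (2 * sigma) *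
     (F0 - F1 - q * (sigma * sigma) / q * (F1 - F2) -
      - (/ CpowZ q k / y) *
        (F0 - (a * sigma + q * sigma / b) * F1 + a * sigma * (q * sigma / b) * F2))).
  - unfold x. field. repeat split; auto.
  - rewrite <- (Cmult_0_r (/ CpowZ (a * sigma) k / (2 * sigma))), <- E. ring.
Qed.

Lemma phi21_sym (q : R) (A B C0 z : C) : phi21 q A B C0 z = phi21 q B A C0 z.
Proof. apply ps_ext. intro n. unfold hyp_coef. f_equal. ring. Qed.

(** A power series is Lipschitz at the origin, and its value there is 1. *)
Lemma phi21_lattice_bounded (q : R) (A B C0 z : C) :
  (0 < q < 1)%R -> qregular q C0 -> (Cmod z < 1)%R ->
  exists M, (0 <= M)%R /\
    forall i : nat, (Cmod (phi21 q A B C0 (z * q ^ i) - 1) <= M * q ^ i)%R.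
Proof.
  intros Hq RC Hz. destruct (radius_above z Hz) as [r [R0 [R1 R2]]].
  destruct (ps_lipschitz (hyp_coef q A B C0) r R0 (Cabs_hyp q A B C0 _ Hq RC R2))
    as [K [K0 HK]].
  exists (K * r)%R. split; [apply Rmult_le_pos; lra |]. intro i.
  pose proof (Cmod_mult_qpow_le q z i Hq) as Hle.
  specialize (HK (z * q ^ i) ltac:(lra)). rewrite hyp_coef_0 in HK.
  eapply Rle_trans; [exact HK |]. rewrite Rmult_assoc. apply Rmult_le_compat_l; auto.
  rewrite Cmod_mult, Cmod_qpow by auto. apply Rmult_le_compat_r; auto. apply pow_le; lra.
Qed.

Lemma Cabs_dilation_series (q : R) (A B C0 m s z : C) :
  (0 < q < 1)%R -> qregular q C0 -> (Cmod z < 1)%R -> (Cmod s < 1)%R ->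
  Cabs (fun i => qbin q m i * s ^ i * phi21 q A B C0 (z * q ^ i)).
Proof.
  intros Hq RC Hz Hs. destruct (qbin_bounded q m Hq) as [M1 [P1 H1]].
  destruct (phi21_lattice_bounded q A B C0 z Hq RC Hz) as [M2 [P2 H2]].
  apply (Cabs_ext (fun i => (qbin q m i * phi21 q A B C0 (z * q ^ i)) * s ^ i));
    [intro; ring |].
  apply Cabs_bounded_mult with (M1 * (M2 + 1))%R; [| now apply Cmod_pow_lt_1].
  intro i. rewrite Cmod_mult. apply Rmult_le_compat; auto using Cmod_ge_0.
  replace (phi21 q A B C0 (z * q ^ i)) with (phi21 q A B C0 (z * q ^ i) - 1 + 1)
    by ring.
  eapply Rle_trans; [apply Cmod_triangle |]. rewrite Cmod_1. specialize (H2 i).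
  pose proof (qpow_le_1 q i Hq). nra.
Qed.

(** Close to infinity, where all the hypergeometric series converge, the two
    factors of W are summed by the q-binomial theorem; Euler's transformation
    turns the weights of the second factor into those of the first one, with the
    roles of a and b exchanged. *)
Lemma Uop_Vop_free_solution (q : R) (a b c m sigma kap x : C) (f : C -> C) :
  (0 < q < 1)%R -> a <> 0 -> b <> 0 -> c <> 0 -> m <> 0 -> x <> 0 -> sigma <> 0 ->
  let C0 := q * (sigma * sigma) in
  let V := - (q * m / x) in let Z := - (q * m * a / (c * b * x)) in
  qregular q C0 -> (Cmod (a * sigma / c) < 1)%R -> (Cmod (b * sigma / m) < 1)%R ->
  (Cmod V < 1)%R -> (Cmod Z < 1)%R -> (Cmod (- (q / x)) < 1)%R ->
  qregular q (- (x / m)) ->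
  (forall p : nat, f (x / m / q ^ p) =
     kap * (a * sigma) ^ p * phi21 q (a * sigma) (q * sigma / b) C0 (V * q ^ p)) ->
  Uop q m a b c (Vop q c f) x =
  kap * (qpoch_inf q (- x) * qpoch_inf q (- (q / x)) /
         (qpoch_inf q (- (x / m)) * qpoch_inf q V)) *
  (qpoch_inf q (a * sigma) * qpoch_inf q (b * sigma) /
   (qpoch_inf q (a * sigma / c) * qpoch_inf q (b * sigma / m))) *
  phi21 q (a * sigma / c) (q * sigma * m / b) C0 (- (q / x)).
Proof.
  intros Hq Ha Hb Hc Hm Hx Hs C0 V Z RC HAc HBm HV HZ HX RX Hf. assert (Hq0 := q_neq_0 q Hq).
  set (A := a * sigma) in *. set (B := q * sigma / b) in *.
  assert (HA : A <> 0) by now apply Cmult_neq_0.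
  assert (HbS : b * sigma <> 0) by now apply Cmult_neq_0.
  assert (HqS : q * sigma <> 0) by now apply Cmult_neq_0.
  assert (HB : B <> 0) by now apply Cdiv_neq_0.
  assert (HC0 : C0 <> 0) by (apply Cmult_neq_0; auto; now apply Cmult_neq_0).
  assert (HA' : A / c <> 0) by now apply Cdiv_neq_0.
  assert (small : forall (u : C) n, (Cmod u < 1)%R -> (Cmod (u * q ^ n) < 1)%R)
    by (intros; now apply Cmod_mult_qpow_lt).
  set (k1 := qpoch_inf q A / qpoch_inf q (A / c)).
  assert (EV : forall j, Vop q c f (x / m / q ^ j) =
             kap * A ^ j * k1 * phi21 q (A / c) B C0 (V * q ^ j)).
  { intro j. unfold k1.
    rewrite <- Cmult_assoc, <- (dilation_series_lower_upper_parameter q A B C0 c) by auto.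
    rewrite <- CSeries_scal.
    - apply CSeries_ext. intro i.
      assert (Hqj := Cpow_nz q j Hq0). assert (Hqi := Cpow_nz q i Hq0).
      replace (x / m / q ^ j / q ^ i) with (x / m / q ^ (j + i))
        by (rewrite Cpow_add_r; field; auto).
      rewrite Hf, !Cpow_add_r.
      replace ((A / c) ^ i) with (A ^ i * (/ c) ^ i) by (symmetry; apply Cpow_mult_l).
      replace (V * (q ^ j * q ^ i)) with (V * q ^ j * q ^ i) by ring.
      ring.
    - apply Cabs_dilation_series; auto. }
  (* Euler's transformation at V q^j, then the q-binomial theorem, then back *)
  assert (EZ : Z = A / c * B * V / C0) by (unfold Z, A, B, V, C0; field; auto 10).
  assert (E1 : C0 / B = b * sigma) by (unfold C0, B; field; auto).
  assert (RZ := qregular_small q Z Hq HZ). assert (RVs := qregular_small q V Hq HV).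
  assert (NZ := qpoch_inf_neq_0 q Z Hq RZ). assert (NV := qpoch_inf_neq_0 q V Hq RVs).
  assert (Eul : forall j, phi21 q (A / c) B C0 (V * q ^ j) =
     qpoch_inf q Z / qpoch_inf q V * (qpoch q V j / qpoch q Z j) *
     phi21 q (b * sigma) (C0 / (A / c)) C0 (Z * q ^ j)).
  { intro j.
    assert (N1 := qpoch_inf_neq_0 q _ Hq (qregular_shift q Z j RZ)).
    assert (N2 := qpoch_inf_neq_0 q _ Hq (qregular_shift q V j RVs)).
    assert (N3 := qpoch_neq_0 q Z j RZ). assert (N4 := qpoch_neq_0 q V j RVs).
    assert (E := euler_transformation q (A / c) B C0 (V * q ^ j) (Z * q ^ j)
                   Hq HA' HB HC0 RC ltac:(rewrite EZ; field; auto)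
                   (small V j HV) (small Z j HZ)).
    rewrite E1, (phi21_sym q _ (b * sigma)) in E. rewrite <- E.
    rewrite (qpoch_inf_split q Z j), (qpoch_inf_split q V j) by auto. field. auto. }
  assert (Back : phi21 q (b * sigma / m) (C0 / (A / c)) C0 Z *
      (qpoch_inf q Z / qpoch_inf q (- (q / x))) =
      phi21 q (A / c) (q * sigma * m / b) C0 (- (q / x))).
  { rewrite (euler_transformation q _ _ C0 Z (- (q / x))); auto using Cdiv_neq_0.
    - rewrite phi21_sym. f_equal; unfold C0, A; field; auto 10.
    - unfold C0, A, Z. field. auto 10. }
  assert (NX := qpoch_inf_neq_0 q _ Hq (qregular_small q _ Hq HX)).
  assert (E3 := dilation_series_lower_upper_parameter q (b * sigma) (C0 / (A / c)) C0 m Z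
                  Hq Hm HBm RC HZ).
  unfold Uop. fold Z V.
  rewrite (CSeries_ext _ (fun j => (kap * k1 * (qpoch_inf q Z / qpoch_inf q V)) *
     (qbin q m j * (b * sigma / m) ^ j *
      phi21 q (b * sigma) (C0 / (A / c)) C0 (Z * q ^ j)))).
  - assert (Ab : Cabs (fun j => qbin q m j * (b * sigma / m) ^ j *
      phi21 q (b * sigma) (C0 / (A / c)) C0 (Z * q ^ j))).
    { now apply Cabs_dilation_series. }
    rewrite CSeries_scal, E3, <- Back by auto.
    assert (N5 := qpoch_inf_neq_0 q _ Hq (qregular_small q _ Hq HAc)).
    assert (N6 := qpoch_inf_neq_0 q _ Hq (qregular_small q _ Hq HBm)).
    assert (N7 := qpoch_inf_neq_0 q _ Hq RX).
    unfold k1. field. auto 10.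
  - intro j. rewrite EV, Eul.
    assert (N3 := qpoch_neq_0 q Z j RZ). assert (N4 := qpoch_neq_0 q V j RVs).
    replace ((b * sigma / m) ^ j) with ((b / (m * a)) ^ j * A ^ j)
      by (rewrite <- Cpow_mult_l; f_equal; unfold A; field; auto).
    field. auto.
Qed.

Lemma three_term_unique (al be ga : Z -> C) (G H : Z -> C) (N : Z) :
  (forall k, al k <> 0) ->
  (forall k, al k * G (k + 1)%Z = be k * G k + ga k * G (k - 1)%Z) ->
  (forall k, al k * H (k + 1)%Z = be k * H k + ga k * H (k - 1)%Z) ->
  (forall k, (k <= N)%Z -> G k = H k) -> forall k, G k = H k.
Proof.
  intros Hal HG HH H0 k.
  assert (P : forall n : nat, G (N + Z.of_nat n)%Z = H (N + Z.of_nat n)%Z /\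
                        G (N + Z.of_nat n - 1)%Z = H (N + Z.of_nat n - 1)%Z).
  { induction n; [split; apply H0; lia |]. destruct IHn as [I1 I2].
    replace (N + Z.of_nat (S n))%Z with (N + Z.of_nat n + 1)%Z by lia.
    replace (N + Z.of_nat n + 1 - 1)%Z with (N + Z.of_nat n)%Z by lia.
    split; auto. set (j := (N + Z.of_nat n)%Z) in *.
    assert (E : al j * G (j + 1)%Z = al j * H (j + 1)%Z) by (rewrite HG, HH, I1, I2; auto).
    transitivity (al j * G (j + 1)%Z / al j); [field; auto |].
    rewrite E. field. auto. }
  destruct (Z_le_gt_dec k N) as [L | L]; auto.
  replace k with (N + Z.of_nat (Z.to_nat (k - N)))%Z by lia. apply P.
Qed.

Lemma theta_quasi_periodic (q : R) (x : C) :
  (0 < q < 1)%R -> x <> 0 ->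
  qpoch_inf q (- (x * q)) * qpoch_inf q (- (q / (x * q))) =
  / x * (qpoch_inf q (- x) * qpoch_inf q (- (q / x))).
Proof.
  intros Hq Hx. assert (Hq0 := q_neq_0 q Hq).
  rewrite (qpoch_inf_S q (- x)), (qpoch_inf_S q (- (q / (x * q)))) by auto.
  replace (- x * q) with (- (x * q)) by ring.
  replace (- (q / (x * q)) * q) with (- (q / x)) by (field; auto).
  field. auto.
Qed.

(** The theta function (-x,-q/x;q)_inf gets the factor 1/x under x -> q x, so the
    quotient of its values at x and x/m gets the factor 1/m.  This explains the
    normalization of W. *)
Lemma theta_quotient_lattice (q : R) (m y : C) (k : Z) :
  (0 < q < 1)%R -> m <> 0 -> y <> 0 ->
  (forall n : Z, - (y / m) <> CpowZ q n) ->
  let x := y * CpowZ q k in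
  qpoch_inf q (- x) * qpoch_inf q (- (q / x)) /
  (qpoch_inf q (- (x / m)) * qpoch_inf q (- (q * m / x))) =
  CpowZ m (- k) *
  (qpoch_inf q (- y) * qpoch_inf q (- (q / y)) /
   (qpoch_inf q (- (y / m)) * qpoch_inf q (- (q * m / y)))).
Proof.
  intros Hq Hm Hy Hreg x. assert (Hq0 := q_neq_0 q Hq).
  set (th := fun u => qpoch_inf q (- u) * qpoch_inf q (- (q / u))).
  assert (Hth : forall u : C, u <> 0 -> th (u * q) = / u * th u)
    by (intros; now apply theta_quasi_periodic).
  assert (Hxk : forall j, y * CpowZ q j <> 0)
    by (intro; apply Cmult_neq_0; auto; now apply CpowZ_neq_0).
  assert (dv := fun u Hu => Cdiv_neq_0 u m Hu Hm).
  assert (Hnz : forall j, th (y * CpowZ q j / m) <> 0).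
  { intro j. assert (Hj := CpowZ_neq_0 q j Hq0).
    apply Cmult_neq_0; apply qpoch_inf_neq_0; auto; intros n E.
    - apply (Hreg (- (j + Z.of_nat n))%Z). rewrite CpowZ_opp, CpowZ_add_nat by auto.
      assert (Hn := Cpow_nz q n Hq0).
      transitivity (- (y * CpowZ q j / m) * q ^ n /
         (CpowZ q j * q ^ n)); [field; auto | rewrite E; field; auto].
    - assert (Hn := Cpow_nz q n Hq0).
      apply (Hreg (- j + Z.of_nat (S n))%Z). rewrite CpowZ_add_nat, CpowZ_opp by auto.
      transitivity (- (y / m) * (- (q / (y * CpowZ q j / m)) * q ^ n));
        [rewrite E; ring | simpl; field; auto 10]. }
  assert (HG := Zstep_constant (fun j => CpowZ m j *
     (th (y * CpowZ q j) / th (y * CpowZ q j / m)))).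
  cbv beta in HG. specialize (HG ltac:(
    intro j; rewrite !CpowZ_succ by auto;
    replace (y * (q * CpowZ q j)) with (y * CpowZ q j * q) by ring;
    replace (y * CpowZ q j * q / m) with (y * CpowZ q j / m * q)
      by (field; auto);
    rewrite !Hth by auto;
    assert (H1 := Hnz j); assert (H2 := CpowZ_neq_0 q j Hq0);
    set (t1 := th (y * CpowZ q j / m)) in *; field; auto 10) k).
  simpl CpowZ in HG. replace (y * 1) with y in HG by ring.
  replace (q * m / x) with (q / (x / m))
    by (unfold x; assert (Hk := CpowZ_neq_0 q k Hq0); field; auto).
  replace (q * m / y) with (q / (y / m)) by (field; auto).
  fold (th x) (th (x / m)) (th y) (th (y / m)).
  rewrite CpowZ_opp by auto. fold x in HG. assert (Hmk := CpowZ_neq_0 m k Hm).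
  assert (H0 := Hnz 0%Z). simpl CpowZ in H0. replace (y * 1) with y in H0 by ring.
  assert (Hk := Hnz k). fold x in Hk.
  transitivity (/ CpowZ m k * (CpowZ m k * (th x / th (x / m)))); [field; auto |].
  rewrite HG. field. auto.
Qed.

Lemma qhyp_lattice_bounded (q : R) (A B C0 z : C) :
  (0 < q < 1)%R -> A <> 0 -> B <> 0 -> qregular q C0 -> cut_plane z ->
  exists M, (0 <= M)%R /\
    forall p : nat, (Cmod (qhyp q [A; B] [C0] (z * q ^ p)%C) <= M)%R.
Proof.
  intros Hq HA HB RC Hz. destruct (qpow_mult_small q z 1 Hq Rlt_0_1) as [N HN].
  destruct (phi21_lattice_bounded q A B C0 (z * q ^ N) Hq RC (HN N (le_n N)))
    as [M [M0 HM]].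
  apply (eventually_bounded (fun p => qhyp q [A; B] [C0] (z * q ^ p)) (M + 1) N).
  intros p Hp. rewrite qhyp_small by auto. specialize (HM (p - N)%nat).
  replace (z * q ^ N * q ^ (p - N)) with (z * q ^ p) in HM
    by (rewrite <- Cmult_assoc, <- Cpow_add_r; do 2 f_equal; lia).
  replace (phi21 q A B C0 (z * q ^ p)) with (phi21 q A B C0 (z * q ^ p) - 1 + 1)
    by ring.
  eapply Rle_trans; [apply Cmod_triangle |]. rewrite Cmod_1.
  pose proof (qpow_le_1 q (p - N) Hq). nra.
Qed.

Lemma cpow_lattice (q y : R) (s : C) (k : Z) :
  (0 < q)%R -> (0 < y)%R ->
  cpow (RtoC y * CpowZ q k) s = cpow (RtoC y) s * CpowZ (cpow q s) k.
Proof.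
  intros Hq Hy. assert (Hq0 : RtoC q <> 0) by (apply RtoC_neq_0; lra).
  assert (Hy0 : RtoC y <> 0) by (apply RtoC_neq_0; lra).
  assert (Hs := cpow_neq_0 q s). assert (N := fun k => CpowZ_neq_0 _ k Hs).
  assert (G := Zstep_constant (fun j => cpow (RtoC y * CpowZ q j) s /
                                        CpowZ (cpow q s) j)).
  cbv beta in G. specialize (G ltac:(
    intro j; rewrite !CpowZ_succ by auto;
    replace (RtoC y * (q * CpowZ q j)) with (q * (RtoC y * CpowZ q j))
      by ring;
    rewrite cpow_scale by (auto; apply Cmult_neq_0; auto; now apply CpowZ_neq_0);
    specialize (N j); field; auto) k).
  simpl CpowZ in G. replace (RtoC y * 1) with (RtoC y) in G by ring. specialize (N k).
  transitivity (cpow (RtoC y * CpowZ q k) s / CpowZ (cpow q s) k *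
                CpowZ (cpow q s) k); [field; auto |].
  rewrite G. field.
Qed.

(** The image of the free solution is an eigenfunction by the intertwining relation.
    It is computed for k close to -oo and extended to all k by the recursion; the
    coefficient of the value at q x is nonzero since x is positive. *)
Theorem Wop_free_solution (q : R) (nu mu a b sigma : C) (y : R) (k : Z) (f : C -> C) :
  (0 < q < 1)%R -> a <> 0 -> b <> 0 ->
  (Cmod (cpow q (nu - mu) * b / a) < 1)%R -> sigma <> 0 ->
  (forall n : Z, sigma * sigma <> CpowZ q n) ->
  (Cmod (a * sigma) < Cmod (cpow q nu))%R -> (0 < y)%R ->
  ~ (Im (RtoC y * cpow q (- mu)) = 0%R /\
     (Re (RtoC y * cpow q (- mu)) < 0)%R) ->
  (forall n : Z, f (RtoC y * cpow q (- mu) * CpowZ q n) =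
                 Phi q a b sigma (RtoC y * cpow q (- mu)) n) ->
  Cabs (W_term q nu mu a b f (RtoC y * CpowZ q k)) /\
  Wop q nu mu a b f (RtoC y * CpowZ q k) =
    W_norm q mu a b (RtoC y) * cpow (RtoC y) (mu + nu) *
    (qpochs_inf q [a * sigma; b * sigma] /
     qpochs_inf q [a * cpow q (- nu) * sigma; b * cpow q (- mu) * sigma]) *
    Phi q (a * cpow q (- nu)) (b * cpow q (- mu)) sigma (RtoC y) k.
Proof.
  intros Hq Ha Hb Ht Hs Hss Has Hy Hneg Hf. assert (Hq0 := q_neq_0 q Hq).
  rewrite !cpow_opp in *.
  set (c := cpow q nu) in *. set (m := cpow q mu) in *.
  assert (Hc : c <> 0) by apply cpow_neq_0. assert (Hm : m <> 0) by apply cpow_neq_0.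
  assert (Hy0 : RtoC y <> 0) by (apply RtoC_neq_0; lra).
  assert (RC := free_solution_qregular q sigma Hq Hss).
  set (y0 := RtoC y * / m) in *.
  assert (Hy00 : y0 <> 0).
  { intro E. apply Hy0. transitivity (y0 * m); [unfold y0; field; auto | rewrite E; ring]. }
  (* a point -t/u with t > 0 can lie on the cut only if u is a negative real number *)
  assert (cut : forall (u : C) n, u <> 0 -> ~ (Im u = 0%R /\ (Re u < 0)%R) ->
            cut_plane (- (CpowZ q n / u))).
  { intros u n Hu Hnu [H1 H2]. apply Hnu.
    destruct (CpowZ_pos q n (proj1 Hq)) as [t [Ht0 Et]]. rewrite Et in *.
    set (s := Re (- (RtoC t / u))) in *.
    assert (Es : - (RtoC t / u) = RtoC s) by (apply C_eq; [reflexivity | simpl; exact H1]).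
    assert (Hs0 : RtoC s <> 0) by (apply RtoC_neq_0; lra).
    assert (Eu : u = RtoC (- (t / s))).
    { rewrite RtoC_opp, RtoC_div by lra. rewrite <- Es. field. split; auto.
      apply RtoC_neq_0; lra. }
    rewrite Eu. simpl. split; auto.
    assert (0 < t / s)%R by (apply Rdiv_lt_0_compat; lra). lra. }
  assert (cut0 : forall n, cut_plane (- (CpowZ q n / y0))) by (intro; now apply cut).
  assert (cut1 : forall n, cut_plane (- (CpowZ q n / RtoC y))).
  { intro n. apply cut; auto. simpl. lra. }
  assert (regy : forall n, - (RtoC y / m) <> CpowZ q n).
  { intros n E. apply Hneg. destruct (CpowZ_pos q n (proj1 Hq)) as [t [Ht0 Et]].
    assert (E' : y0 = RtoC (- t)) by (rewrite RtoC_opp, <- Et, <- E; unfold y0; field; auto).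
    rewrite E'. simpl. split; auto. lra. }
  assert (WR : forall j, W_regular q mu (RtoC y * CpowZ q j)).
  { intro j. assert (Hj := CpowZ_neq_0 q j Hq0). split; [now apply Cmult_neq_0 |].
    rewrite cpow_opp. fold m. intros n E. apply Hneg.
    destruct (CpowZ_pos q n (proj1 Hq)) as [t [Ht0 Et]].
    destruct (CpowZ_pos q j (proj1 Hq)) as [u [Hu0 Eu]].
    assert (Hu1 : RtoC u <> 0) by (apply RtoC_neq_0; lra).
    assert (E' : y0 = RtoC (- (t / u))).
    { rewrite RtoC_opp, RtoC_div, <- Et, <- E, Eu by lra. unfold y0. field. auto. }
    rewrite E'. simpl. split; auto. assert (0 < t / u)%R by (apply Rdiv_lt_0_compat; lra). lra. }
  set (A := a * sigma) in *. assert (HA : A <> 0) by now apply Cmult_neq_0.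
  set (B := q * sigma / b) in *.
  assert (HqS : q * sigma <> 0) by now apply Cmult_neq_0.
  assert (HB : B <> 0) by now apply Cdiv_neq_0.
  set (C0 := q * (sigma * sigma)) in *.
  set (F := qhyp q [A; B] [C0]).
  assert (Ff : forall j p, f (RtoC y * CpowZ q j / m / q ^ p) =
      CpowZ A (- j) * A ^ p * F (- (q * m / (RtoC y * CpowZ q j)) * q ^ p)).
  { intros j p. assert (Hj := CpowZ_neq_0 q j Hq0).
    assert (Hp := Cpow_nz q p Hq0).
    replace (RtoC y * CpowZ q j / m / q ^ p)
      with (y0 * CpowZ q (j - Z.of_nat p))
      by (rewrite CpowZ_sub_nat by auto; unfold y0; field; auto).
    rewrite Hf. unfold Phi. fold A B C0 F.
    replace (- (j - Z.of_nat p))%Z with (- j + Z.of_nat p)%Z by lia.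
    replace (1 - (j - Z.of_nat p))%Z with (- j + Z.of_nat p + 1)%Z by lia.
    rewrite CpowZ_succ, !CpowZ_add_nat, (CpowZ_opp q) by auto.
    f_equal. f_equal. unfold y0. field. auto. }
  assert (Ht2 : (Cmod (b / (m * a)) * Cmod c < 1)%R).
  { rewrite cpow_minus in Ht. fold c m in Ht. rewrite <- Cmod_mult.
    replace (b / (m * a) * c) with (c / m * b / a) by (field; auto). exact Ht. }
  set (r := Cmod A).
  assert (Hr : (0 < r < Cmod c)%R) by (split; [now apply Cmod_gt_0 | exact Has]).
  assert (Dec : forall j, decays q f (RtoC y * CpowZ q j / m) r).
  { intro j. assert (Hj := CpowZ_neq_0 q j Hq0).
    set (V := - (q * m / (RtoC y * CpowZ q j))).
    assert (HV : cut_plane V).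
    { replace V with (- (CpowZ q (- j + 1) / y0)); [apply cut0 |].
      rewrite CpowZ_succ, CpowZ_opp by auto. unfold V, y0. field. auto. }
    destruct (qhyp_lattice_bounded q A B C0 V Hq HA HB RC HV) as [M [M0 HM]].
    exists (Cmod (CpowZ A (- j)) * M)%R. split; [apply Rmult_le_pos; auto using Cmod_ge_0 |].
    intro p. rewrite Ff. fold V. rewrite !Cmod_mult, Cmod_pow. fold r.
    rewrite !Rmult_assoc. apply Rmult_le_compat_l; [apply Cmod_ge_0 |].
    rewrite (Rmult_comm M). apply Rmult_le_compat_l; [apply pow_le; lra | apply HM]. }
  assert (Fac := fun j => Wop_factorization q nu mu a b f _ r Hq Ha Hb Ht (WR j) Hr (Dec j)).
  split; [apply Fac |].
  set (lam := (sigma + / sigma) / 2).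
  set (a' := a * / c). set (b' := b * / m).
  assert (Ha' : a' <> 0) by (apply (Cdiv_neq_0 a c); auto).
  assert (Hb' : b' <> 0) by (apply (Cdiv_neq_0 b m); auto).
  set (ct := W_norm q mu a b (RtoC y) * cpow (RtoC y) (mu + nu) *
    (qpochs_inf q [A; b * sigma] / qpochs_inf q [a' * sigma; b' * sigma])).
  set (x := fun j => RtoC y * CpowZ q j).
  assert (Hx : forall j, x j <> 0)
    by (intro; apply Cmult_neq_0; auto; now apply CpowZ_neq_0).
  set (al := fun j => a' / 2 * (1 + 1 / x j)).
  set (be := fun j => lam + (a' / (2 * x j) + q / (2 * b' * x j))).
  set (ga := fun j => - (1 / (2 * a') * (1 + a' * q / (b' * x j)))).
  assert (xu : forall j, q * x j = x (j + 1)%Z)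
    by (intro; unfold x; rewrite CpowZ_succ by auto; ring).
  assert (xd : forall j, x j / q = x (j - 1)%Z)
    by (intro; unfold x; rewrite CpowZ_pred by auto; field; auto).
  assert (small : exists N : nat, forall n, (N <= n)%nat ->
     (Cmod (- (q * m / RtoC y) * q ^ n) < 1)%R /\
     (Cmod (- (q * m * a / (c * b * RtoC y)) * q ^ n) < 1)%R /\
     (Cmod (- (q / RtoC y) * q ^ n) < 1)%R).
  { destruct (qpow_mult_small q (- (q * m / RtoC y)) 1 Hq Rlt_0_1) as [N1 H1].
    destruct (qpow_mult_small q (- (q * m * a / (c * b * RtoC y))) 1 Hq Rlt_0_1)
      as [N2 H2].
    destruct (qpow_mult_small q (- (q / RtoC y)) 1 Hq Rlt_0_1) as [N3 H3].
    exists (N1 + N2 + N3)%nat. intros n Hn.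
    repeat split; [apply H1 | apply H2 | apply H3]; lia. }
  destruct small as [N HN].
  change (Wop q nu mu a b f (x k) = ct * Phi q a' b' sigma (RtoC y) k).
  apply (three_term_unique al be ga (fun j => Wop q nu mu a b f (x j))
           (fun j => ct * Phi q a' b' sigma (RtoC y) j) (- Z.of_nat N)).
  - intro j. unfold al. destruct (CpowZ_pos q j (proj1 Hq)) as [t [Ht0 Et]].
    unfold x. rewrite Et, <- RtoC_mult.
    assert (Hyt : (0 < y * t)%R) by now apply Rmult_lt_0_compat.
    apply Cmult_neq_0; [apply Cdiv_neq_0; auto; apply RtoC_neq_0; lra |].
    rewrite <- RtoC_div, <- RtoC_plus by lra. apply RtoC_neq_0.
    assert (0 < 1 / (y * t))%R by (apply Rdiv_lt_0_compat; lra). lra.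
  - intro j. assert (I := Wop_intertwines q nu mu a b f (x j) r Hq Ha Hb Ht (WR j) Hr (Dec j)).
    rewrite !cpow_opp in I. fold c m a' b' in I.
    assert (EL : Wop q nu mu a b (Lop q a b f) (x j) = lam * Wop q nu mu a b f (x j)).
    { unfold Wop. rewrite (CSeries_ext _ (fun p => lam * W_term q nu mu a b f (x j) p)).
      - rewrite CSeries_scal by apply Fac. ring.
      - intro p. destruct (W_regular_qregular q mu (x j) Hq (WR j)) as [RV _].
        rewrite !W_term_conv by auto. fold c m.
        assert (Hp := Cpow_nz q p Hq0). assert (Hj := CpowZ_neq_0 q j Hq0).
        set (n := (j - Z.of_nat p)%Z).
        assert (En : x j / (m * q ^ p) = y0 * CpowZ q n)
          by (unfold x, n; rewrite CpowZ_sub_nat by auto; unfold y0; field; auto).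
        rewrite En.
        assert (T := Phi_three_term q a b sigma y0 n Hq Ha Hb Hs Hy00 RC cut0).
        cbv zeta in T. fold lam in T. rewrite <- !Hf in T.
        rewrite CpowZ_succ, CpowZ_pred in T by auto.
        replace (y0 * (q * CpowZ q n)) with (q * (y0 * CpowZ q n))
          in T by ring.
        replace (y0 * (CpowZ q n / q)) with (y0 * CpowZ q n / q)
          in T by (field; auto).
        unfold Lop. rewrite T. ring. }
    rewrite EL in I. unfold Lop in I. rewrite xu, xd in I.
    unfold al, be, ga. rewrite Cmult_plus_distr_r, I. ring.
  - intro j. assert (T := Phi_three_term q a' b' sigma (RtoC y) j Hq Ha' Hb' Hs Hy0 RC cut1).
    cbv zeta in T. fold lam (x j) in T. unfold al, be, ga.
    set (P1 := Phi q a' b' sigma (RtoC y) (j + 1)) in *.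
    set (P0 := Phi q a' b' sigma (RtoC y) j) in *.
    set (Pm := Phi q a' b' sigma (RtoC y) (j - 1)) in *.
    set (k0 := a' / (2 * x j) + q / (2 * b' * x j)) in *.
    set (km := 1 / (2 * a') * (1 + a' * q / (b' * x j))) in *.
    transitivity (ct * (a' / 2 * (1 + 1 / x j) * P1 - k0 * P0 + km * Pm)
                  + ct * (k0 * P0 - km * Pm)); [ring |].
    rewrite T. ring.
  - intros j Hj. cbv beta.
    assert (Fj := proj2 (Fac j)). fold c m in Fj. fold (x j) in Fj. rewrite Fj.
    set (n := Z.to_nat (- j)).
    destruct (HN n ltac:(unfold n; lia)) as [S1 [S2 S3]].
    assert (Eq : CpowZ q j = / q ^ n).
    { rewrite <- CpowZ_opp_of_nat. f_equal. unfold n. lia. }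
    assert (Hn := Cpow_nz q n Hq0).
    assert (EV : - (q * m / x j) = - (q * m / RtoC y) * q ^ n)
      by (unfold x; rewrite Eq; field; auto).
    assert (EZ : - (q * m * a / (c * b * x j)) =
                 - (q * m * a / (c * b * RtoC y)) * q ^ n)
      by (unfold x; rewrite Eq; field; auto 10).
    assert (EX : - (q / x j) = - (q / RtoC y) * q ^ n)
      by (unfold x; rewrite Eq; field; auto).
    assert (RXm : qregular q (- (x j / m))).
    { destruct (WR j) as [_ W]. intros i E. apply (W (- Z.of_nat i)%Z).
      rewrite CpowZ_opp_of_nat, cpow_opp. fold m. fold (x j).
      assert (Hi := Cpow_nz q i Hq0).
      transitivity (- (x j / m) * q ^ i / q ^ i); [field; auto | rewrite E; field; auto]. }
    fold (x j).
    assert (Hbm : (Cmod (b * sigma / m) < 1)%R).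
    { replace (b * sigma / m) with (b / (m * a) * A) by (unfold A; field; auto).
      rewrite Cmod_mult. fold r. pose proof (Cmod_ge_0 (b / (m * a))). nra. }
    assert (HAc : (Cmod (A / c) < 1)%R).
    { unfold Cdiv. rewrite Cmod_mult, Rmult_comm. now apply inv_ratio_lt_1. }
    rewrite (Uop_Vop_free_solution q a b c m sigma (CpowZ A (- j)) (x j) f); auto.
    2: now rewrite EV.
    2: now rewrite EZ.
    2: now rewrite EX.
    2: { intro p. unfold x. rewrite Ff. f_equal. apply qhyp_small; auto.
         fold (x j). rewrite EV. now apply Cmod_mult_qpow_lt. }
    fold A C0.
    assert (Th := theta_quotient_lattice q m (RtoC y) j Hq Hm Hy0 regy).
    cbv zeta in Th. fold (x j) in Th. rewrite Th.
    assert (Cp := cpow_lattice q y (mu + nu) j (proj1 Hq) Hy). fold (x j) in Cp.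
    rewrite Cp, (cpow_plus q). fold c m.
    unfold Phi.
    assert (EA : a' * sigma = A / c) by (unfold a', A; field; auto).
    assert (EB : q * sigma / b' = q * sigma * m / b)
      by (unfold b'; field; auto).
    assert (Earg : - (CpowZ q (1 - j) / RtoC y) = - (q / x j)).
    { replace (1 - j)%Z with (- j + 1)%Z by lia. rewrite CpowZ_succ, CpowZ_opp by auto.
      unfold x. assert (Hjj := CpowZ_neq_0 q j Hq0). field. auto. }
    rewrite EA, EB, Earg. fold C0.
    rewrite qhyp_small; auto.
    2-3: auto using Cdiv_neq_0, Cmult_neq_0.
    2: now rewrite EX.
    unfold ct, W_norm, qpochs_inf. simpl map. simpl fold_right. rewrite EA.
    replace (b' * sigma) with (b * sigma / m) by (unfold b'; field; auto).
    rewrite !cpow_opp, (cpow_plus q 1), cpow_1 by lra. fold m.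
    set (ph := phi21 q (A / c) (q * sigma * m / b) C0 (- (q / x j))).
    replace (- (RtoC y * / m)) with (- (RtoC y / m)) by reflexivity.
    assert (EAj : CpowZ A (- j) = CpowZ (A / c) (- j) * CpowZ c (- j)).
    { rewrite <- CpowZ_mult by auto using Cdiv_neq_0. f_equal. field. auto. }
    rewrite EAj, CpowZ_mult, !(CpowZ_opp m), !(CpowZ_opp c) by auto.
    assert (Hmj := CpowZ_neq_0 m j Hm). assert (Hcj := CpowZ_neq_0 c j Hc).
    set (D1 := qpoch_inf q (- (RtoC y / m))).
    set (D2 := qpoch_inf q (- (q * m / RtoC y))).
    assert (ND1 : D1 <> 0).
    { apply qpoch_inf_neq_0; auto. intros i E. apply (regy (- Z.of_nat i)%Z).
      rewrite CpowZ_opp_of_nat. assert (Hi := Cpow_nz q i Hq0).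
      transitivity (- (RtoC y / m) * q ^ i / q ^ i); [field; auto | rewrite E; field; auto]. }
    assert (ND2 : D2 <> 0).
    { apply qpoch_inf_neq_0; auto. intros i E. apply (regy (Z.of_nat (S i))%Z).
      rewrite CpowZ_of_nat.
      transitivity (- (RtoC y / m) * (- (q * m / RtoC y) * q ^ i));
        [rewrite E; ring | simpl; field; auto]. }
    assert (N5 := qpoch_inf_neq_0 q _ Hq (qregular_small q _ Hq HAc)).
    assert (N6 := qpoch_inf_neq_0 q _ Hq (qregular_small q _ Hq Hbm)).
    assert (Nmm := cpow_neq_0 q (mu * mu)).
    field. auto 12.
Qed.

(** * The operator A *)

(** The nu-part of A, with parameters a and b, and its mu-part, where s is the product
    of the parameters a q^nu and b. *)
Definition A1op (q : R) (c a b : C) (f : C -> C) (w : C) : C :=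
  qpoch_inf q (- (b * w / a)) / qpoch_inf q (- (b * w / (a * c))) *
  CSeries (fun i => qbin q c i * (qpoch q (- w) i / qpoch q (- (b * w / a)) i) *
                    (a * b) ^ i * f (w * q ^ i)).

Definition A2op (q : R) (m s : C) (g : C -> C) (x : C) : C :=
  CSeries (fun j => qbin q m j * s ^ j * g (x * m * q ^ j)).

(** The nu-part is evaluated at the points x m q^j; its prefactor there is the one at
    x m times (z;q)_j/(ze;q)_j, which restores the weights of the kernel. *)
Lemma Aop_factorization (q nu : R) (mu a b : C) (f : C -> C) (x : C) (M : R) :
  (0 < q < 1)%R -> a <> 0 -> b <> 0 -> (Cmod (a * b) < 1)%R -> (0 < nu)%R ->
  let c := cpow q (RtoC nu) in let m := cpow q mu in
  qregular q (- (x * m)) -> qregular q (- (b * x * m / a)) ->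
  (forall p : nat, (Cmod (f (x * m * q ^ p)%C) <= M)%R) ->
  Cabs (A_term q (RtoC nu) mu a b f x) /\
  (qregular q (- (b * x * m / (a * c))) ->
   Aop q (RtoC nu) mu a b f x = A2op q m (a * c * b) (A1op q c a b f) x).
Proof.
  intros Hq Ha Hb Hab Hnu c m RV RZ HM. assert (Hq0 := q_neq_0 q Hq).
  assert (Hc : c <> 0) by apply cpow_neq_0. assert (Hm : m <> 0) by apply cpow_neq_0.
  assert (Hc1 : (Cmod c < 1)%R).
  { unfold c. rewrite Cmod_cpow by lra. now apply Rpower_lt_1. }
  set (V := - (x * m)) in *. set (ze := - (b * x * m / a)) in *.
  set (z := - (b * x * m / (a * c))).
  set (w := fun j => qpoch q z j / qpoch q V j).
  set (u := fun p => qpoch q V p / qpoch q ze p).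
  set (A := fun j i => qbin q m j * w j * c ^ j * qbin q c i *
                       ((a * b) ^ (j + i) * u (j + i)%nat * f (x * m * q ^ (j + i)))).
  assert (E : forall p, A_term q (RtoC nu) mu a b f x p = diag A p).
  { intro p. rewrite A_term_conv by auto. fold c m V ze z. unfold kernel_conv, diag.
    rewrite <- psum_scal. apply psum_ext. intros j Hj. unfold A, w, u.
    replace (j + (p - j))%nat with p by lia. ring. }
  destruct (qbin_bounded q m Hq) as [M1 [P1 H1]].
  destruct (qbin_bounded q c Hq) as [M2 [P2 H2]].
  destruct (qpoch_div_bounded q z V Hq RV) as [M3 [P3 H3]].
  destruct (qpoch_div_bounded q V ze Hq RZ) as [M4 [P4 H4]].
  assert (M0 : (0 <= M)%R) by (eapply Rle_trans; [apply Cmod_ge_0 | apply (HM O)]).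
  set (s := Cmod (a * b)). assert (Hs : (0 <= s < 1)%R) by (split; [apply Cmod_ge_0 | auto]).
  assert (Pc := Cmod_ge_0 c).
  assert (HA : forall j i, (Cmod (A j i) <= (M1 * M3 * M2 * (M4 * M) * (Cmod c * s) ^ j) * s ^ i)%R).
  { intros j i. unfold A. rewrite !Cmod_mult, !Cmod_pow. fold s.
    replace (M1 * M3 * M2 * (M4 * M) * (Cmod c * s) ^ j * s ^ i)%R with
      (M1 * M3 * Cmod c ^ j * M2 * (s ^ (j + i) * M4 * M))%R
      by (rewrite !Rpow_mult_distr, !pow_add; ring).
    assert (0 <= Cmod c ^ j)%R by now apply pow_le.
    assert (0 <= s ^ (j + i))%R by (apply pow_le; lra). fold s.
    assert (B1 : (0 <= Cmod (qbin q m j) * Cmod (w j) <= M1 * M3)%R).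
    { split; [apply Rmult_le_pos; apply Cmod_ge_0 |].
      apply Rmult_le_compat; [apply Cmod_ge_0 | apply Cmod_ge_0 | apply H1 | apply H3]. }
    assert (B2 : (0 <= Cmod (qbin q m j) * Cmod (w j) * Cmod c ^ j <= M1 * M3 * Cmod c ^ j)%R).
    { split; [apply Rmult_le_pos; lra |]. apply Rmult_le_compat_r; lra. }
    assert (B3 : (0 <= s ^ (j + i) * Cmod (u (j + i)%nat) <= s ^ (j + i) * M4)%R).
    { split; [apply Rmult_le_pos; [lra | apply Cmod_ge_0] |].
      apply Rmult_le_compat_l; [lra | apply H4]. }
    apply Rmult_le_compat.
    - apply Rmult_le_pos; [lra | apply Cmod_ge_0].
    - apply Rmult_le_pos; [lra | apply Cmod_ge_0].
    - apply Rmult_le_compat; [lra | apply Cmod_ge_0 | lra | auto].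
    - apply Rmult_le_compat; [lra | apply Cmod_ge_0 | lra | auto]. }
  assert (Hcs : (0 <= Cmod c * s < 1)%R) by nra.
  assert (S1 : ex_series (fun j => (M1 * M3 * M2 * (M4 * M) * (Cmod c * s) ^ j)%R))
    by now apply ex_series_geom_scal.
  assert (S2 : ex_series (fun i => (s ^ i)%R)).
  { apply ex_series_geom. rewrite Rabs_pos_eq; lra. }
  assert (Q1 : forall j, (0 <= M1 * M3 * M2 * (M4 * M) * (Cmod c * s) ^ j)%R).
  { intro j. assert (0 <= (Cmod c * s) ^ j)%R by (apply pow_le; lra).
    repeat apply Rmult_le_pos; auto. }
  assert (Q2 : forall i, (0 <= s ^ i)%R) by (intro; apply pow_le; lra).
  assert (AD : Cabs (diag A)) by exact (Cabs_diag A _ _ HA S1 S2 Q1 Q2).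
  split; [exact (Cabs_ext _ _ (fun p => eq_sym (E p)) AD) |]. intro Rz. fold z in Rz.
  unfold Aop. rewrite (CSeries_ext _ _ E).
  rewrite (hasum_CSeries _ _ (fubini_diag A _ _ HA S1 S2 Q1 Q2)).
  replace (- (b * x * cpow q (mu - RtoC nu) / a)) with z
    by (unfold z; rewrite cpow_minus; fold c m; field; auto).
  fold m ze. unfold A2op.
  assert (AA : Cabs (fun j => CSeries (A j))).
  { apply Cabs_le with (fun j => (M1 * M3 * M2 * (M4 * M) * (Cmod c * s) ^ j * Series (fun i => s ^ i))%R).
    - intro j. rewrite <- Series_scal_l. apply Cmod_CSeries_le; [apply HA |].
      now apply ex_series_scal_R.
    - apply (ex_series_ext (K := R_AbsRing) (V := R_NormedModule)
        (fun j => (Series (fun i => s ^ i) * (M1 * M3 * M2 * (M4 * M) * (Cmod c * s) ^ j))%R));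
        [intro; simpl; ring |].
      now apply ex_series_scal_R. }
  rewrite <- CSeries_scal by auto. apply CSeries_ext. intro j.
  unfold A1op. set (wj := x * m * q ^ j).
  assert (EV : - wj = V * q ^ j) by (unfold wj, V; ring).
  assert (Eze : - (b * wj / a) = ze * q ^ j) by (unfold wj, ze; field; auto).
  assert (Ez : - (b * wj / (a * c)) = z * q ^ j) by (unfold wj, z; field; auto).
  rewrite EV, Eze, Ez.
  rewrite (qpoch_inf_split q ze j), (qpoch_inf_split q z j) by auto.
  set (I1 := qpoch_inf q (ze * q ^ j)). set (I2 := qpoch_inf q (z * q ^ j)).
  assert (N1 := qpoch_neq_0 q z j Rz). assert (N2 : I2 <> 0)
    by (apply qpoch_inf_neq_0; auto; now apply qregular_shift).
  assert (N3 := qpoch_neq_0 q V j RV). assert (N4 := qpoch_neq_0 q ze j RZ).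
  rewrite (CSeries_ext (A j) (fun i => (qbin q m j * (qpoch q z j / qpoch q ze j) * (a * c * b) ^ j) *
     (qbin q c i * (qpoch q (V * q ^ j) i / qpoch q (ze * q ^ j) i) * (a * b) ^ i *
      f (wj * q ^ i)))).
  - rewrite CSeries_scal.
    + field. auto.
    + destruct (qpoch_div_bounded q (V * q ^ j) (ze * q ^ j) Hq
                  (qregular_shift q ze j RZ)) as [M5 [P5 H5]].
      apply (Cabs_ext (fun i => (qbin q c i * (qpoch q (V * q ^ j) i /
         qpoch q (ze * q ^ j) i) * f (wj * q ^ i)) * (a * b) ^ i)); [intro; ring |].
      apply Cabs_bounded_mult with (M2 * M5 * M)%R; [| now apply Cmod_pow_lt_1].
      intro i. rewrite !Cmod_mult.
      apply Rmult_le_compat; [apply Rmult_le_pos; apply Cmod_ge_0 | apply Cmod_ge_0 | |].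
      * apply Rmult_le_compat; auto using Cmod_ge_0.
      * unfold wj. rewrite <- Cmult_assoc, <- Cpow_add_r. apply HM.
  - intro i. unfold A, w, u, wj. rewrite !qpoch_add, !Cpow_add_r.
    assert (N5 := qpoch_neq_0 q _ i (qregular_shift q ze j RZ)).
    replace (a * c * b) with (c * (a * b)) by ring. rewrite (Cpow_mult_l c).
    replace (x * m * (q ^ j * q ^ i)) with (x * m * q ^ j * q ^ i) by ring.
    field. auto.
Qed.

(** Towards the origin the coefficients of L grow like q^-k, hence the assumption that g
    vanishes there. *)
Lemma A2op_intertwines (q : R) (a b m : C) (g : C -> C) (x : C) (N : nat) :
  (0 < q < 1)%R -> a <> 0 -> b <> 0 -> m <> 0 -> x <> 0 ->
  (forall k, (N <= k)%nat -> g (x * m * q ^ k) = 0) ->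
  A2op q m (a * b) (Lop q a b g) x = Lop q a (b * m) (A2op q m (a * b) g) x.
Proof.
  intros Hq Ha Hb Hm Hx HN. assert (Hq0 := q_neq_0 q Hq).
  set (G := fun p => g (x * m / q * q ^ p)).
  assert (G1 : forall p, g (x * m * q ^ p) = G (S p)).
  { intro p. unfold G. f_equal. simpl. field. auto. }
  assert (G2 : forall p, g (q * x * m * q ^ p) = G (S (S p))).
  { intro p. unfold G. f_equal. simpl. field. auto. }
  assert (G0 : forall p, g (x / q * m * q ^ p) = G p).
  { intro p. unfold G. f_equal. field. auto. }
  assert (GN : forall p, (S N <= p)%nat -> G p = 0).
  { intros [| p] Hp; [lia |]. rewrite <- G1. apply HN. lia. }
  assert (fin : forall (u : nat -> C) k, Cabs (fun p => u p * G (k + p)%nat)).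
  { intros u k. apply (Cabs_finite (S N)). intros n Hn. rewrite GN by lia. ring. }
  set (u := fun p => qbin q m p * (a * b) ^ p).
  set (X := fun p => q / (2 * b * m * x) * (1 - / q ^ p) * u p).
  set (Y := fun p => 1 / (2 * x) * (- (a + q / (b * m)) + (a + q / b) / (m * q ^ p))
                     * u p).
  set (Z := fun p => a / (2 * x) * (1 - 1 / (m * q ^ p)) * u p).
  assert (Sum : CSeries (fun p => X p * G p + Y p * G (S p) + Z p * G (S (S p))) = 0).
  { apply three_term_sum_zero.
    - unfold X. simpl. field. auto.
    - unfold X, Y, u. rewrite qbin_0. assert (B := qbin_S q m 0 Hq). rewrite qbin_0 in B.
      simpl in *.
      transitivity (- (a / (2 * m * x)) * (qbin q m 1 * (1 - q * 1) - 1 * (1 - m * 1)));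
        [field; auto 10 | rewrite B; ring].
    - intro p. assert (B := qbin_S q m p Hq). assert (B' := qbin_S q m (S p) Hq).
      assert (Hp := Cpow_nz q p Hq0). unfold X, Y, Z, u. simpl Cpow in *.
      set (v := q ^ p) in *. set (t := (a * b) ^ p).
      transitivity (- (a * a * b * t / (2 * m * x * (q * v))) *
           (qbin q m (S (S p)) * (1 - q * (q * v)) -
            qbin q m (S p) * (1 - m * (q * v)))
         - a * t / (2 * m * x * v) *
           (qbin q m p * (1 - m * v) - qbin q m (S p) * (1 - q * v))).
      + field. auto 10.
      + rewrite B', B. ring.
    - apply (fin X 0%nat).
    - apply (fin Y 1%nat).
    - apply (fin Z 2%nat). }
  symmetry. apply Ceq_minus. rewrite <- Sum. unfold A2op. unfold Lop at 1.
  rewrite (CSeries_ext (fun j => qbin q m j * (a * b) ^ j * g (q * x * m * q ^ j))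
             (fun p => u p * G (S (S p)))) by (intro; now rewrite G2).
  rewrite (CSeries_ext (fun j => qbin q m j * (a * b) ^ j * g (x * m * q ^ j))
             (fun p => u p * G (S p))) by (intro; now rewrite G1).
  rewrite (CSeries_ext (fun j => qbin q m j * (a * b) ^ j * g (x / q * m * q ^ j))
             (fun p => u p * G p)) by (intro; now rewrite G0).
  assert (A0 : Cabs (fun p => u p * G p)) by apply (fin u 0%nat).
  assert (A1 : Cabs (fun p => u p * G (S p))) by apply (fin u 1%nat).
  assert (A2 : Cabs (fun p => u p * G (S (S p)))) by apply (fin u 2%nat).
  set (k1 := a / 2 * (1 + 1 / x)).
  set (k2 := a / (2 * x) + q / (2 * (b * m) * x)).
  set (k3 := 1 / (2 * a) * (1 + a * q / (b * m * x))).
  set (L := fun j => qbin q m j * (a * b) ^ j * Lop q a b g (x * m * q ^ j)).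
  assert (AL : Cabs L).
  { apply (Cabs_finite (S N)). intros n Hn. unfold L, Lop.
    replace (q * (x * m * q ^ n)) with (x * m * q ^ S n) by (simpl; ring).
    replace (x * m * q ^ n / q) with (x * m * q ^ (n - 1))
      by (replace n with (S (n - 1)) at 2 by lia; simpl; field; auto).
    rewrite !HN by lia. ring. }
  fold L.
  transitivity (k1 * CSeries (fun p => u p * G (S (S p)))
     + ((- k2) * CSeries (fun p => u p * G (S p))
        + (k3 * CSeries (fun p => u p * G p) + (- (1)) * CSeries L))); [ring |].
  rewrite <- !CSeries_scal by auto.
  rewrite <- !CSeries_plus by auto 6 using Cabs_plus, Cabs_scal.
  apply CSeries_ext. intro p. assert (Hp := Cpow_nz q p Hq0).
  unfold L, Lop. rewrite G1.
  replace (g (q * (x * m * q ^ p))) with (G (S (S p)))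
    by (rewrite <- G2; f_equal; ring).
  replace (g (x * m * q ^ p / q)) with (G p) by (unfold G; f_equal; field; auto).
  fold (u p). unfold X, Y, Z, k1, k2, k3. fold (u p). field. auto 10.
Qed.

Lemma A1op_intertwines (q : R) (a b c : C) (f : C -> C) (w : C) (N : nat) :
  (0 < q < 1)%R -> a <> 0 -> b <> 0 -> c <> 0 -> w <> 0 ->
  qregular q (- (b * w / a) / q) -> qregular q (- (b * w / (a * c)) / q) ->
  (forall k, (N <= k)%nat -> f (w * q ^ k) = 0) ->
  A1op q c a b (Lop q a b f) w = Lop q (a * c) b (A1op q c a b f) w.
Proof.
  intros Hq Ha Hb Hc Hw RZ1 Rz1 HN. assert (Hq0 := q_neq_0 q Hq).
  set (ze := - (b * w / a)) in *. set (z := - (b * w / (a * c))) in *.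
  assert (up : forall t : C, qregular q (t / q) -> qregular q t).
  { intros t Ht. assert (H := qregular_shift q _ 1 Ht).
    now replace (t / q * q ^ 1) with t in H by (simpl; field; auto). }
  assert (RZ := up _ RZ1). assert (Rz := up _ Rz1).
  assert (RZ2 := qregular_shift q _ 1 RZ). assert (Rz2 := qregular_shift q _ 1 Rz).
  rewrite Cpow_1_r in RZ2, Rz2.
  assert (fac : forall t : C, qregular q t -> 1 - t <> 0).
  { intros t Ht. assert (H := qregular_factor q t 0 Ht). simpl in H.
    now replace (t * 1) with t in H by ring. }
  assert (N0 := fac _ RZ). assert (N1 := fac _ RZ1). assert (n0 := fac _ Rz).
  assert (n1 := fac _ Rz1).
  set (v := fun j => qpoch q (- w) j / qpoch q ze j).
  set (vu := fun j => qpoch q (- w * q) j / qpoch q (ze * q) j).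
  set (vd := fun j => qpoch q (- w / q) j / qpoch q (ze / q) j).
  assert (v0 : v O = 1) by (unfold v; simpl; field).
  assert (vd0 : vd O = 1) by (unfold vd; simpl; field).
  assert (vS : forall j, v (S j) * (1 - ze * q ^ j) = v j * (1 + w * q ^ j)).
  { intro j. unfold v. rewrite !qpoch_S. assert (H1 := qregular_factor q _ j RZ).
    assert (H2 := qpoch_neq_0 q _ j RZ). field. auto. }
  assert (vdS : forall j, (1 - ze / q) * vd (S j) = (1 + w / q) * v j).
  { intro j. unfold v, vd. rewrite !qpoch_S_l.
    replace (- w / q * q) with (- w) by (field; auto).
    replace (ze / q * q) with ze by (field; auto).
    assert (N1' : q - ze <> 0).
    { replace (q - ze) with (q * (1 - ze / q)) by (field; auto).
      now apply Cmult_neq_0. }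
    assert (H2 := qpoch_neq_0 q _ j RZ). field. auto. }
  assert (vuE : forall j, (1 + w) / (1 - ze) * vu j = v (S j)).
  { intro j. unfold v, vu. rewrite !qpoch_S_l. assert (H2 := qpoch_neq_0 q _ j RZ2).
    field. auto. }
  set (s := a * b).
  set (G := fun p => f (w / q * q ^ p)).
  assert (G1 : forall p, f (w * q ^ p) = G (S p)).
  { intro p. unfold G. f_equal. simpl. field. auto. }
  assert (G2 : forall p, f (q * w * q ^ p) = G (S (S p))).
  { intro p. unfold G. f_equal. simpl. field. auto. }
  assert (GN : forall p, (S N <= p)%nat -> G p = 0).
  { intros [| p] Hp; [lia |]. rewrite <- G1. apply HN. lia. }
  assert (fin : forall (u : nat -> C) k, Cabs (fun p => u p * G (k + p)%nat)).
  { intros u k. apply (Cabs_finite (S N)). intros n Hn. rewrite GN by lia. ring. }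
  set (X := fun p => qbin q c p * s ^ p *
     (1 / (2 * a) * (1 - q / (ze * q ^ p)) * v p
      + 1 / (2 * a) * (q / ze) * (1 - ze / q) * vd p)).
  set (Y := fun p => qbin q c p * s ^ p * v p *
     (1 / (2 * w) * ((a * c + q / b) - (a + q / b) / q ^ p))).
  set (W := fun p => qbin q c p * s ^ p *
     (a / 2 * (1 + 1 / (w * q ^ p)) * v p
      - a * c / 2 * (1 + 1 / w) * ((1 - z) / (1 - ze)) * vu p)).
  assert (Hze : ze <> 0).
  { intro E. apply (Cmult_neq_0 _ _ Hb Hw). transitivity (- ze * a); [unfold ze; field; auto |].
    rewrite E; ring. }
  assert (XS : forall p, X (S p) = qbin q c (S p) * s ^ S p *
     (1 / (2 * a) * (q / ze) * v p * (1 - / q ^ S p))).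
  { intro p. unfold X. assert (Hp := Cpow_nz q p Hq0).
    transitivity (qbin q c (S p) * s ^ S p * (1 / (2 * a) / ze) *
      (- / q ^ p * (v (S p) * (1 - ze * q ^ p))
       + q * ((1 - ze / q) * vd (S p)))).
    - simpl. field. auto.
    - rewrite vS, vdS. simpl. field. auto. }
  assert (WE : forall p, W p = qbin q c p * s ^ p * (a / (2 * w)) * v (S p) * (/ q ^ p - c)).
  { intro p. unfold W. assert (Hp := Cpow_nz q p Hq0).
    transitivity (qbin q c p * s ^ p * (a / (2 * w)) *
      (/ q ^ p * (v p * (1 + w * q ^ p)) - c * (1 - z) * ((1 + w) / (1 - ze) * vu p))).
    - field. auto.
    - rewrite <- vS, vuE. unfold z, ze. field. auto. }
  assert (Sum : CSeries (fun p => X p * G p + Y p * G (S p) + W p * G (S (S p))) = 0).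
  { apply three_term_sum_zero.
    - unfold X. rewrite v0, vd0. simpl. field. auto.
    - rewrite XS. unfold Y. rewrite v0, qbin_0. assert (B := qbin_S q c 0 Hq).
      rewrite qbin_0 in B. simpl in *.
      transitivity (a / (2 * w) * (qbin q c 1 * (1 - q * 1) - 1 * (1 - c * 1)));
        [unfold s, ze; field; auto 10 | rewrite B; ring].
    - intro p. rewrite XS, WE. unfold Y. assert (B := qbin_S q c p Hq).
      assert (B' := qbin_S q c (S p) Hq).
      assert (Hp := Cpow_nz q p Hq0). simpl Cpow in *.
      set (y := q ^ p) in *. set (t := s ^ p).
      transitivity (v (S p) * (a * s * t / (2 * w * (q * y))) *
           (qbin q c (S (S p)) * (1 - q * (q * y)) -
            qbin q c (S p) * (1 - c * (q * y)))
         + v (S p) * (a * t / (2 * w * y)) *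
           (qbin q c p * (1 - c * y) - qbin q c (S p) * (1 - q * y))).
      + unfold s, ze. field. auto 10.
      + rewrite B', B. ring.
    - apply (fin X 0%nat).
    - apply (fin Y 1%nat).
    - apply (fin W 2%nat). }
  set (P := qpoch_inf q ze / qpoch_inf q z).
  assert (I0 := qpoch_inf_neq_0 q _ Hq Rz). assert (I2 := qpoch_inf_neq_0 q _ Hq Rz2).
  assert (Pu : qpoch_inf q (ze * q) / qpoch_inf q (z * q) = P * ((1 - z) / (1 - ze))).
  { unfold P. rewrite (qpoch_inf_S q ze), (qpoch_inf_S q z) by auto. field. auto. }
  assert (Pd : qpoch_inf q (ze / q) / qpoch_inf q (z / q) =
               P * ((1 - ze / q) / (1 - z / q))).
  { unfold P. rewrite (qpoch_inf_S q (ze / q)), (qpoch_inf_S q (z / q)) by auto.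
    replace (ze / q * q) with ze by (field; auto).
    replace (z / q * q) with z by (field; auto).
    assert (N1' : q - z <> 0).
    { replace (q - z) with (q * (1 - z / q)) by (field; auto).
      now apply Cmult_neq_0. }
    field. auto. }
  unfold A1op. unfold Lop at 2. fold ze z.
  replace (- (b * (q * w) / a)) with (ze * q) by (unfold ze; field; auto).
  replace (- (b * (w / q) / a)) with (ze / q) by (unfold ze; field; auto).
  replace (- (b * (q * w) / (a * c))) with (z * q) by (unfold z; field; auto).
  replace (- (b * (w / q) / (a * c))) with (z / q) by (unfold z; field; auto).
  replace (- (q * w)) with (- w * q) by ring.
  replace (- (w / q)) with (- w / q) by (field; auto).
  rewrite Pu, Pd. fold P s.
  set (Su := CSeries (fun i => qbin q c i * (qpoch q (- w * q) i / qpoch q (ze * q) i) *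
     s ^ i * f (q * w * q ^ i))).
  set (S0 := CSeries (fun i => qbin q c i * (qpoch q (- w) i / qpoch q ze i) *
     s ^ i * f (w * q ^ i))).
  set (Sd := CSeries (fun i => qbin q c i * (qpoch q (- w / q) i / qpoch q (ze / q) i) *
     s ^ i * f (w / q * q ^ i))).
  set (L := fun i => qbin q c i * (qpoch q (- w) i / qpoch q ze i) *
     s ^ i * Lop q a b f (w * q ^ i)).
  assert (AL : Cabs L).
  { apply (Cabs_finite (S N)). intros n Hn. unfold L, Lop.
    replace (q * (w * q ^ n)) with (w * q ^ S n) by (simpl; ring).
    replace (w * q ^ n / q) with (w * q ^ (n - 1))
      by (replace n with (S (n - 1)) at 2 by lia; simpl; field; auto).
    rewrite !HN by lia. ring. }
  set (k1 := a * c / 2 * (1 + 1 / w) * ((1 - z) / (1 - ze))).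
  set (k2 := a * c / (2 * w) + q / (2 * b * w)).
  set (k3 := 1 / (2 * a) * (q / ze) * (1 - ze / q)).
  assert (K : CSeries L = k1 * Su + ((- k2) * S0 + (- k3) * Sd)).
  { assert (A0 : Cabs (fun p => qbin q c p * vd p * s ^ p * G p)) by apply (fin _ 0%nat).
    assert (A1 : Cabs (fun p => qbin q c p * v p * s ^ p * G (S p))) by apply (fin _ 1%nat).
    assert (A2 : Cabs (fun p => qbin q c p * vu p * s ^ p * G (S (S p)))) by apply (fin _ 2%nat).
    assert (AX := fin X 0%nat). assert (AY := fin Y 1%nat). assert (AW := fin W 2%nat).
    simpl Nat.add in AX, AY, AW.
    transitivity (CSeries (fun p => X p * G p + Y p * G (S p) + W p * G (S (S p)))
                  + (k1 * Su + ((- k2) * S0 + (- k3) * Sd))); [| rewrite Sum; ring].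
    unfold Su, S0, Sd.
    rewrite (CSeries_ext (fun i => qbin q c i * (qpoch q (- w * q) i / qpoch q (ze * q) i) *
       s ^ i * f (q * w * q ^ i)) (fun p => qbin q c p * vu p * s ^ p * G (S (S p))))
      by (intro; now rewrite G2).
    rewrite (CSeries_ext (fun i => qbin q c i * (qpoch q (- w) i / qpoch q ze i) *
       s ^ i * f (w * q ^ i)) (fun p => qbin q c p * v p * s ^ p * G (S p)))
      by (intro; now rewrite G1).
    change (fun i => qbin q c i * (qpoch q (- w / q) i / qpoch q (ze / q) i) *
       s ^ i * f (w / q * q ^ i)) with (fun p => qbin q c p * vd p * s ^ p * G p).
    rewrite <- !CSeries_scal by auto.
    rewrite <- !CSeries_plus by auto 6 using Cabs_plus, Cabs_scal.
    apply CSeries_ext. intro p. assert (Hp := Cpow_nz q p Hq0).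
    unfold L, Lop. rewrite G1.
    replace (f (q * (w * q ^ p))) with (G (S (S p)))
      by (rewrite <- G2; f_equal; ring).
    replace (f (w * q ^ p / q)) with (G p) by (unfold G; f_equal; field; auto).
    change (qpoch q (- w) p / qpoch q ze p) with (v p).
    unfold X, Y, W, k1, k2, k3. 
    set (zz := (1 - z) / (1 - ze)). unfold ze. field. repeat split; auto. }
  fold L. rewrite K. unfold k1, k2, k3.
  assert (E3 : 1 / (2 * (a * c)) * (1 + a * c * q / (b * w)) *
     (P * ((1 - ze / q) / (1 - z / q)) * Sd) =
     - (1 / (2 * a) * (q / ze) * (1 - ze / q)) * P * Sd).
  { set (y := 1 - ze / q).
    replace (1 + a * c * q / (b * w)) with
      (- (a * c * q / (b * w)) * - (1 - z / q)) by (unfold z; field; auto).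
    set (y' := 1 - z / q) in *. unfold ze. field. auto 10. }
  rewrite E3. ring.
Qed.

Lemma qregular_negative (q t : R) : (0 < q < 1)%R -> (0 < t)%R -> qregular q (- RtoC t).
Proof.
  intros Hq Ht. apply cut_plane_qregular; auto. intros [_ H]. simpl in H. lra.
Qed.

(** If the lattice x q^mu q^Z meets the positive half-line, it lies on it, and none of
    the denominators can vanish.  Otherwise f vanishes on the lattice and both sides
    are 0. *)
Theorem Aop_intertwines (q a b nu : R) (mu : C) (f : C -> C) (x : C) :
  (0 < q < 1)%R -> (0 < a)%R -> (0 < b)%R -> (a * b < 1)%R -> (0 < nu)%R ->
  compactly_supported_pos f -> x <> 0 ->
  Lop q (RtoC a * cpow q (RtoC nu)) (RtoC b * cpow q mu)
    (Aop q (RtoC nu) mu (RtoC a) (RtoC b) f) x =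
  Aop q (RtoC nu) mu (RtoC a) (RtoC b) (Lop q (RtoC a) (RtoC b) f) x.
Proof.
  intros Hq Ha Hb Hab Hnu [r [M [Hr Hf]]] Hx. assert (Hq0 := q_neq_0 q Hq).
  assert (Ha0 : RtoC a <> 0) by (apply RtoC_neq_0; lra).
  assert (Hb0 : RtoC b <> 0) by (apply RtoC_neq_0; lra).
  set (cr := Rpower q nu). assert (Hcr : (0 < cr)%R) by apply exp_pos.
  assert (Ec : cpow q (RtoC nu) = RtoC cr) by (apply cpow_RtoC; lra).
  assert (Hc : RtoC cr <> 0) by (apply RtoC_neq_0; lra).
  set (m := cpow q mu) in *. assert (Hm : m <> 0) by apply cpow_neq_0.
  destruct (classic (Im (x * m) = 0%R /\ (0 < Re (x * m))%R)) as [[HI HR] | Hpos].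
  - set (w := Re (x * m)) in *.
    assert (Ew : x * m = RtoC w) by (apply C_eq; [reflexivity | exact HI]).
    assert (Habs : (Cmod (RtoC a * RtoC b) < 1)%R).
    { rewrite <- RtoC_mult, Cmod_R, Rabs_pos_eq; auto. apply Rmult_le_pos; lra. }
    assert (reg : forall t (s : C), (0 < t)%R -> s = - RtoC t -> qregular q s)
      by (intros t s Ht ->; now apply qregular_negative).
    assert (fact : forall (h : C -> C) x' w' N, x' * m = RtoC w' -> (0 < w')%R ->
       (forall k, (N <= k)%nat -> h (RtoC w' * q ^ k) = 0) ->
       Aop q (RtoC nu) mu (RtoC a) (RtoC b) h x' =
       A2op q m (RtoC a * RtoC cr * RtoC b) (A1op q (RtoC cr) (RtoC a) (RtoC b) h) x').
    { intros h x' w' N E Hw' HN.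
      destruct (eventually_bounded (fun p => h (x' * m * q ^ p)) 0 N) as [K [K0 HK]].
      { intros n Hn. rewrite E, HN, Cmod_0 by auto. lra. }
      assert (Ebx : RtoC b * x' * m = RtoC (b * w')).
      { rewrite RtoC_mult, <- E. ring. }
      rewrite <- Ec.
      apply (Aop_factorization q nu mu (RtoC a) (RtoC b) h x' K); auto.
      - fold m. rewrite E. now apply (reg w').
      - fold m. rewrite Ebx, <- RtoC_div by lra.
        apply (reg (b * w' / a)%R); auto. apply Rdiv_lt_0_compat; [nra | lra].
      - fold m. rewrite Ec, Ebx, <- RtoC_mult, <- RtoC_div by nra.
        apply (reg (b * w' / (a * cr))%R); auto. apply Rdiv_lt_0_compat; nra. }
    assert (van : exists N, forall k, (N <= k)%nat -> f (RtoC w * q ^ k) = 0).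
    { destruct (qpow_mult_small q (RtoC w) r Hq Hr) as [N HN]. exists N. intros k Hk.
      specialize (HN k Hk). destruct (Ceq_dec (f (RtoC w * q ^ k)) 0) as [E | E]; auto.
      exfalso. destruct (Hf _ E) as [_ [F _]].
      pose proof (re_le_Cmod (RtoC w * q ^ k)).
      pose proof (Rle_abs (Re (RtoC w * q ^ k))). lra. }
    destruct van as [N HN].
    assert (HNL : forall k, (S N <= k)%nat -> Lop q (RtoC a) (RtoC b) f (RtoC w * q ^ k) = 0).
    { intros [| k] Hk; [lia |]. unfold Lop.
      replace (q * (RtoC w * q ^ S k)) with (RtoC w * q ^ S (S k))
        by (simpl; ring).
      replace (RtoC w * q ^ S k / q) with (RtoC w * q ^ k)
        by (simpl; field; auto).
      rewrite !HN by lia. ring. }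
    rewrite (fact (Lop q (RtoC a) (RtoC b) f) x w (S N) Ew HR HNL).
    assert (F0 := fact f x w N Ew HR HN).
    assert (F1 : Aop q (RtoC nu) mu (RtoC a) (RtoC b) f (q * x) =
       A2op q m (RtoC a * RtoC cr * RtoC b) (A1op q (RtoC cr) (RtoC a) (RtoC b) f) (q * x)).
    { apply (fact f _ (q * w)%R N).
      - rewrite RtoC_mult, <- Ew. ring.
      - apply Rmult_lt_0_compat; lra.
      - intros k Hk. replace (RtoC (q * w) * q ^ k) with (RtoC w * q ^ S k)
          by (rewrite RtoC_mult; simpl; ring). apply HN. lia. }
    assert (F2 : Aop q (RtoC nu) mu (RtoC a) (RtoC b) f (x / q) =
       A2op q m (RtoC a * RtoC cr * RtoC b) (A1op q (RtoC cr) (RtoC a) (RtoC b) f) (x / q)).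
    { apply (fact f _ (w / q)%R (S N)).
      - rewrite RtoC_div, <- Ew by lra. field. auto.
      - apply Rdiv_lt_0_compat; lra.
      - intros [| k] Hk; [lia |].
        replace (RtoC (w / q) * q ^ S k) with (RtoC w * q ^ k)
          by (rewrite RtoC_div by lra; simpl; field; auto). apply HN. lia. }
    unfold Lop at 1. rewrite F0, F1, F2.
    set (g := A1op q (RtoC cr) (RtoC a) (RtoC b) f).
    assert (Hac : RtoC a * RtoC cr <> 0) by now apply Cmult_neq_0.
    rewrite Ec.
    assert (I2 := A2op_intertwines q (RtoC a * RtoC cr) (RtoC b) m g x N Hq Hac Hb0 Hm Hx).
    unfold Lop at 2 in I2. rewrite <- I2.
    + unfold A2op. apply CSeries_ext. intro j. f_equal. symmetry.
      rewrite Ew. assert (Pj := qpow_le_1 q j Hq).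
      assert (Pwj : (0 < w * q ^ j)%R) by (apply Rmult_lt_0_compat; lra).
      rewrite <- RtoC_pow, <- RtoC_mult.
      apply A1op_intertwines with N; auto.
      * apply RtoC_neq_0; lra.
      * apply (reg (b * (w * q ^ j) / a / q)%R).
        -- repeat apply Rdiv_lt_0_compat; nra.
        -- rewrite !RtoC_div, !RtoC_mult by lra. field. auto.
      * apply (reg (b * (w * q ^ j) / (a * cr) / q)%R).
        -- repeat apply Rdiv_lt_0_compat; nra.
        -- rewrite !RtoC_div, !RtoC_mult by nra. field. auto.
      * intros k Hk. replace (RtoC (w * q ^ j) * q ^ k) with (RtoC w * q ^ (j + k))
          by (rewrite RtoC_mult, RtoC_pow, Cpow_add_r; ring). apply HN. lia.
    + intros k Hk. rewrite Ew. unfold g, A1op. rewrite CSeries_0; [ring |]. intro i.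
      replace (RtoC w * q ^ k * q ^ i) with (RtoC w * q ^ (k + i))
        by (rewrite Cpow_add_r; ring).
      rewrite HN by lia. ring.
  - assert (Z : forall t : R, (0 < t)%R -> f (x * m * RtoC t) = 0).
    { intros t Ht. destruct (Ceq_dec (f (x * m * RtoC t)) 0) as [E | E]; auto.
      exfalso. apply Hpos. destruct (Hf _ E) as [F1 [F2 _]].
      assert (G1 : Im (x * m * RtoC t) = (Im (x * m) * t)%R)
        by (destruct (x * m); simpl; ring).
      assert (G2 : Re (x * m * RtoC t) = (Re (x * m) * t)%R)
        by (destruct (x * m); simpl; ring).
      rewrite G1 in F1. rewrite G2 in F2. split.
      - apply Rmult_integral in F1. destruct F1; [auto | lra].
      - destruct (Rlt_le_dec 0 (Re (x * m))); auto. nra. }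
    assert (Z' : forall (s : C) (k : nat) t, (0 < t)%R -> s = x * RtoC t ->
              f (s * cpow q (mu + RtoC (INR k))) = 0).
    { intros s k t Ht ->. rewrite cpow_plus, cpow_INR by lra. fold m.
      pose proof (qpow_le_1 q k Hq).
      replace (x * RtoC t * (m * q ^ k)) with (x * m * RtoC (t * q ^ k))
        by (rewrite RtoC_mult, RtoC_pow; ring).
      apply Z. apply Rmult_lt_0_compat; lra. }
    assert (A0 : forall (h : C -> C) s,
              (forall k, h (s * cpow q (mu + RtoC (INR k))) = 0) ->
              Aop q (RtoC nu) mu (RtoC a) (RtoC b) h s = 0).
    { intros h s Hh. unfold Aop. rewrite CSeries_0; [ring |]. intro k. unfold A_term.
      rewrite Hh. ring. }
    assert (iq : (0 < / q)%R) by (apply Rinv_0_lt_compat; lra).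
    assert (E1 : x = x * RtoC 1) by ring.
    assert (E2 : q * x = x * q) by ring.
    assert (E3 : x / q = x * RtoC (/ q)) by (rewrite RtoC_inv by lra; reflexivity).
    unfold Lop at 1. rewrite (A0 f (q * x)), (A0 f x), (A0 f (x / q)).
    2: intro k; now apply Z' with (/ q)%R.
    2: intro k; apply Z' with 1%R; auto; lra.
    2: intro k; apply Z' with q; auto; lra.
    rewrite A0; [ring |]. intro k. unfold Lop.
    replace (q * (x * cpow q (mu + RtoC (INR k)))) with
      (q * x * cpow q (mu + RtoC (INR k))) by ring.
    replace (x * cpow q (mu + RtoC (INR k)) / q) with
      (x / q * cpow q (mu + RtoC (INR k))) by (field; auto).
    rewrite (Z' (q * x) k q), (Z' x k 1%R), (Z' (x / q) k (/ q)%R) by (auto; lra).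
    ring.
Qed.

(** ** The little q-Jacobi functions *)

(** The number kap keeps track of the value at the origin, which together with the
    equation determines the solution. *)
Definition hyp_solution (q : R) (A B C0 z kap : C) (F : nat -> C) : Prop :=
  hyp_eq q A B C0 z F /\
  exists N, forall n, (N <= n)%nat -> F n = kap * phi21 q A B C0 (z * q ^ n).

(** Downward recursion: 1 - z q^n, the coefficient of F n, does not vanish. *)
Lemma hyp_solution_unique (q : R) (A B C0 z kap : C) (F G : nat -> C) :
  qregular q z -> hyp_solution q A B C0 z kap F -> hyp_solution q A B C0 z kap G ->
  forall n, F n = G n.
Proof.
  intros Rz [HF [N1 H1]] [HG [N2 H2]].
  assert (D : forall k n, (N1 + N2 <= n + k)%nat -> F n = G n).
  { induction k; intros n Hn.
    - rewrite H1, H2 by lia. reflexivity.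
    - assert (E1 := IHk (S n) ltac:(lia)). assert (E2 := IHk (S (S n)) ltac:(lia)).
      assert (Nz := qregular_factor q z n Rz).
      specialize (HF n). specialize (HG n). rewrite <- E1, <- E2 in HG.
      apply Ceq_minus.
      destruct (Ceq_dec (F n - G n) 0) as [E | E]; auto. exfalso.
      apply (Cmult_neq_0 _ _ Nz E).
      apply -> Ceq_minus in HF. apply -> Ceq_minus in HG.
      replace (RtoC 0) with (RtoC 0 - RtoC 0) by ring. rewrite <- HF at 1. rewrite <- HG. ring. }
  intro n. apply (D (N1 + N2)%nat). lia.
Qed.

Lemma hyp_solution_gauge (q : R) (A B C0 z v kap : C) (F : nat -> C) :
  (0 < q < 1)%R -> A <> 0 -> B <> 0 -> C0 <> 0 -> qregular q C0 -> v = A * B * z / C0 ->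
  qregular q v -> hyp_solution q A B C0 z kap F ->
  hyp_solution q (C0 / A) (C0 / B) C0 v kap
    (fun n => F n * (qpoch_inf q (z * q ^ n) / qpoch_inf q (v * q ^ n))).
Proof.
  intros Hq HA HB HC RC Hv Rv [HF [N HN]]. split; [now apply hyp_eq_gauge |].
  destruct (qpow_mult_small q z 1 Hq Rlt_0_1) as [N1 H1].
  destruct (qpow_mult_small q v 1 Hq Rlt_0_1) as [N2 H2].
  exists (N + N1 + N2)%nat. intros n Hn. rewrite HN by lia.
  rewrite <- Cmult_assoc. f_equal.
  apply euler_transformation; auto.
  - rewrite Hv. field. auto.
  - apply H1; lia.
  - apply H2; lia.
Qed.

Lemma hyp_solution_increments (q : R) (A B C0 z kap : C) (F : nat -> C) :
  (0 < q < 1)%R -> qregular q C0 -> hyp_solution q A B C0 z kap F ->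
  exists K, (0 <= K)%R /\ forall n, (Cmod (F n - F (S n)) <= K * q ^ n)%R.
Proof.
  intros Hq RC [_ [N HN]]. assert (Hq0 := q_neq_0 q Hq).
  destruct (qpow_mult_small q z 1 Hq Rlt_0_1) as [N1 H1].
  set (z' := z * q ^ N1).
  destruct (phi21_lattice_bounded q A B C0 z' Hq RC (H1 N1 (le_n N1))) as [M [M0 HM]].
  destruct (eventually_bounded (fun n => (F n - F (S n)) / q ^ n)
     (Cmod kap * (2 * M / q ^ N1)) (N + N1)) as [K [K0 HK]].
  - intros n Hn. assert (Pn := qpow_le_1 q n Hq). assert (PN := qpow_le_1 q N1 Hq).
    rewrite Cmod_div by now apply Cpow_nz. rewrite Cmod_qpow by auto.
    rewrite !HN by lia.
    assert (E : forall k, (N1 <= k)%nat -> z * q ^ k = z' * q ^ (k - N1)).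
    { intros k Hk. unfold z'. rewrite <- Cmult_assoc, <- Cpow_add_r. do 2 f_equal. lia. }
    rewrite !E by lia.
    set (P0 := phi21 q A B C0 (z' * q ^ (n - N1))).
    set (P1 := phi21 q A B C0 (z' * q ^ (S n - N1))).
    replace (kap * P0 - kap * P1) with (kap * ((P0 - 1) + - (P1 - 1))) by ring.
    rewrite Cmod_mult. unfold Rdiv at 1. rewrite Rmult_assoc.
    apply Rmult_le_compat_l; [apply Cmod_ge_0 |].
    assert (Bd : (Cmod (P0 - 1 + - (P1 - 1)) <= 2 * M * q ^ (n - N1))%R).
    { eapply Rle_trans; [apply Cmod_triangle |]. rewrite Cmod_opp.
      assert (B0 := HM (n - N1)%nat). assert (B1 := HM (S n - N1)%nat).
      fold P0 in B0. fold P1 in B1.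
      replace (S n - N1)%nat with (S (n - N1)) in B1 by lia. simpl in B1.
      assert (0 <= q ^ (n - N1))%R by (apply pow_le; lra).
      assert (M * (q * q ^ (n - N1)) <= M * q ^ (n - N1))%R
        by (apply Rmult_le_compat_l; nra). lra. }
    apply Rmult_le_reg_r with (q ^ n)%R; [lra |].
    rewrite Rmult_assoc, Rinv_l, Rmult_1_r by lra. eapply Rle_trans; [exact Bd |].
    right. replace n with (N1 + (n - N1))%nat at 2 by lia. rewrite pow_add. field. lra.
  - exists K. split; auto. intro n. specialize (HK n). assert (Pn := qpow_le_1 q n Hq).
    rewrite Cmod_div in HK by now apply Cpow_nz. rewrite Cmod_qpow in HK by auto.
    apply Rmult_le_reg_r with (/ q ^ n)%R; [apply Rinv_0_lt_compat; lra |].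
    rewrite Rmult_assoc, Rinv_r by lra. lra.
Qed.

Lemma hyp_solution_bounded (q : R) (A B C0 z kap : C) (F : nat -> C) :
  (0 < q < 1)%R -> qregular q C0 -> hyp_solution q A B C0 z kap F ->
  exists K, (0 <= K)%R /\ forall n, (Cmod (F n) <= K)%R.
Proof.
  intros Hq RC [_ [N HN]].
  destruct (qpow_mult_small q z 1 Hq Rlt_0_1) as [N1 H1].
  destruct (phi21_lattice_bounded q A B C0 (z * q ^ N1) Hq RC (H1 N1 (le_n N1)))
    as [M [M0 HM]].
  apply (eventually_bounded F (Cmod kap * (M + 1)) (N + N1)).
  intros n Hn. rewrite HN, Cmod_mult by lia. apply Rmult_le_compat_l; [apply Cmod_ge_0 |].
  specialize (HM (n - N1)%nat).
  replace (z * q ^ N1 * q ^ (n - N1)) with (z * q ^ n) in HM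
    by (rewrite <- Cmult_assoc, <- Cpow_add_r; do 2 f_equal; lia).
  replace (phi21 q A B C0 (z * q ^ n)) with (phi21 q A B C0 (z * q ^ n) - 1 + 1)
    by ring.
  eapply Rle_trans; [apply Cmod_triangle |]. rewrite Cmod_1.
  pose proof (qpow_le_1 q (n - N1) Hq). nra.
Qed.

(** Let M be the sum over k of (m;q)_k/(q;q)_k (C T)^k, and M' the same series with C
    replaced by C/q.  Then M' (1 - C T/q) = (1 - m C T/q) M and M' z = z M, so applying
    M' to the equation for F gives the one for M F with C replaced by m C.  As M' may
    diverge on constants, it is only applied to (1 - T) F, which is O(q^n). *)
Lemma hyp_eq_dilation_series (q : R) (A B C0 m z K K' : C) (F : nat -> C) :
  (0 < q < 1)%R -> (Cmod C0 < 1)%R ->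
  (forall n, (Cmod (F n - F (S n)) <= Cmod K * q ^ n)%R) ->
  (forall n, (Cmod (F n) <= Cmod K')%R) ->
  hyp_eq q A B C0 z F ->
  hyp_eq q A B (C0 * m) z (fun n => CSeries (fun k => qbin q m k * C0 ^ k * F (n + k)%nat)).
Proof.
  intros Hq HC HK HK' HF n. assert (Hq0 := q_neq_0 q Hq).
  destruct (qbin_bounded q m Hq) as [M [M0 HM]].
  set (u := fun k => qbin q m k * C0 ^ k).
  assert (AF : forall j, Cabs (fun k => u k * F (j + n + k)%nat)).
  { intro j. apply (Cabs_ext (fun k => (qbin q m k * F (j + n + k)%nat) * C0 ^ k));
      [intro; unfold u; ring |].
    apply Cabs_bounded_mult with (M * Cmod K')%R; [| now apply Cmod_pow_lt_1].
    intro k. rewrite Cmod_mult. apply Rmult_le_compat; auto using Cmod_ge_0. }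
  set (h := fun k => F (n + k)%nat - F (S (n + k))).
  set (X := fun k => u k * (1 - / q ^ k)).
  set (Y := fun k => u k * (C0 / q) * (/ q ^ k - m)).
  assert (AH : forall j (l : nat -> C) L, (forall k, (Cmod (l k) <= L)%R) ->
     Cabs (fun k => u k * (l k / q ^ k) * h (j + k)%nat)).
  { intros j l L HL.
    apply (Cabs_ext (fun k => (qbin q m k * (l k * (h (j + k)%nat / q ^ k))) * C0 ^ k)).
    { intro k. assert (Hk := Cpow_nz q k Hq0). unfold u. field. auto. }
    apply Cabs_bounded_mult with (M * (L * Cmod K))%R; [| now apply Cmod_pow_lt_1].
    intro k. rewrite !Cmod_mult.
    assert (L0 : (0 <= L)%R) by (eapply Rle_trans; [apply Cmod_ge_0 | apply (HL k)]).
    apply Rmult_le_compat; auto using Cmod_ge_0.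
    { apply Rmult_le_pos; apply Cmod_ge_0. }
    apply Rmult_le_compat; auto using Cmod_ge_0.
    rewrite Cmod_div by now apply Cpow_nz. rewrite Cmod_qpow by auto.
    assert (Pk := qpow_le_1 q k Hq).
    apply Rmult_le_reg_r with (q ^ k)%R; [lra |].
    unfold Rdiv. rewrite Rmult_assoc, Rinv_l, Rmult_1_r by lra.
    unfold h. eapply Rle_trans; [apply HK |]. apply Rmult_le_compat_l; [apply Cmod_ge_0 |].
    rewrite !pow_add. assert (P1 := qpow_le_1 q n Hq). assert (P2 := qpow_le_1 q j Hq).
    assert (0 <= q ^ j * q ^ k)%R by nra.
    assert (q ^ j * q ^ k <= q ^ k)%R by nra. nra. }
  assert (qb : forall (k l : C) (i : nat), (Cmod (k * q ^ i + l) <= Cmod k + Cmod l)%R).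
  { intros k l i. eapply Rle_trans; [apply Cmod_triangle |].
    pose proof (Cmod_mult_qpow_le q k i Hq). lra. }
  assert (AX : Cabs (fun k => X k * h k)).
  { apply (Cabs_ext (fun k => u k * ((1 * q ^ k + - (1)) / q ^ k) * h (0 + k)%nat)).
    - intro k. assert (Hk := Cpow_nz q k Hq0). unfold X. simpl Nat.add. field. auto.
    - eapply AH. intro k. apply qb. }
  assert (AY : Cabs (fun k => Y k * h (S k))).
  { apply (Cabs_ext (fun k => u k * ((- (C0 / q * m) * q ^ k + C0 / q) / q ^ k)
                              * h (1 + k)%nat)).
    - intro k. assert (Hk := Cpow_nz q k Hq0). unfold Y. simpl Nat.add. field. auto.
    - eapply AH. intro k. apply qb. }
  assert (Sum : CSeries (fun k => X k * h k + Y k * h (S k) + 0 * h (S (S k))) = 0).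
  { assert (XY : forall k, X (S k) + Y k = 0).
    { intro k. assert (Hk := Cpow_nz q k Hq0). assert (Bq := qbin_S q m k Hq).
      unfold X, Y, u. simpl Cpow in *. set (y := q ^ k) in *.
      transitivity (- (C0 * C0 ^ k / (q * y)) *
         (qbin q m (S k) * (1 - q * y) - qbin q m k * (1 - m * y))); [field; auto |].
      rewrite Bq. ring. }
    apply three_term_sum_zero; auto.
    - unfold X. simpl. field.
    - intro k. rewrite XY. ring.
    - apply (Cabs_finite 0). intros; ring. }
  set (S0 := CSeries (fun k => u k * F (n + k)%nat)).
  set (S1 := CSeries (fun k => u k * F (S n + k)%nat)).
  set (S2 := CSeries (fun k => u k * F (S (S n) + k)%nat)).
  change (S0 - S1 - C0 * m / q * (S1 - S2) =
          z * q ^ n * (S0 - (A + B) * S1 + A * B * S2)).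
  apply Ceq_minus. rewrite <- Sum.
  assert (A0 := AF 0%nat). assert (A1 := AF 1%nat). assert (A2 := AF 2%nat).
  simpl Nat.add in A0, A1, A2.
  set (k0 := 1 - z * q ^ n). set (k1 := - (1) - C0 * m / q + z * q ^ n * (A + B)).
  set (k2 := C0 * m / q - z * q ^ n * (A * B)).
  transitivity (k0 * S0 + (k1 * S1 + k2 * S2)); [unfold k0, k1, k2; ring |].
  unfold S0, S1, S2. rewrite <- !CSeries_scal by auto.
  rewrite <- !CSeries_plus by auto 6 using Cabs_plus, Cabs_scal.
  apply CSeries_ext. intro k. simpl Nat.add.
  assert (E := HF (n + k)%nat). rewrite Cpow_add_r in E.
  assert (Hk := Cpow_nz q k Hq0).
  set (F0 := F (n + k)%nat) in *. set (F1 := F (S (n + k))) in *. set (F2 := F (S (S (n + k)))) in *.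
  unfold X, Y, h. rewrite !Nat.add_succ_r. fold F0 F1 F2.
  unfold k0, k1, k2. set (x := q ^ n) in *. set (y := q ^ k) in *.
  apply -> Ceq_minus in E. apply Ceq_minus.
  transitivity (u k / y * (F0 - F1 - C0 / q * (F1 - F2) -
       z * (x * y) * (F0 - (A + B) * F1 + A * B * F2))).
  - field. auto.
  - rewrite E. ring.
Qed.

Lemma hyp_solution_dilation_series (q : R) (A B C0 m z kap : C) (F : nat -> C) :
  (0 < q < 1)%R -> (Cmod C0 < 1)%R -> qregular q (C0 * m) ->
  hyp_solution q A B C0 z kap F ->
  hyp_solution q A B (C0 * m) z (kap * (qpoch_inf q (C0 * m) / qpoch_inf q C0))
    (fun n => CSeries (fun k => qbin q m k * C0 ^ k * F (n + k)%nat)).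
Proof.
  intros Hq HC RCm HF. assert (RC := qregular_small q C0 Hq HC).
  destruct (hyp_solution_increments q A B C0 z kap F Hq RC HF) as [K [K0 HK]].
  destruct (hyp_solution_bounded q A B C0 z kap F Hq RC HF) as [K' [K0' HK']].
  destruct HF as [HF [N HN]]. split.
  - apply hyp_eq_dilation_series with (RtoC K) (RtoC K'); auto;
      intro n; rewrite Cmod_R, Rabs_pos_eq; auto.
  - destruct (qpow_mult_small q z 1 Hq Rlt_0_1) as [N1 H1].
    exists (N + N1)%nat. intros n Hn.
    assert (Hzn : (Cmod (z * q ^ n) < 1)%R) by (apply H1; lia).
    rewrite <- Cmult_assoc, <- dilation_series_raise_lower_parameter by auto.
    rewrite <- CSeries_scal by now apply Cabs_dilation_series.
    apply CSeries_ext. intro k. rewrite HN by lia.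
    replace (z * q ^ (n + k)) with (z * q ^ n * q ^ k)
      by (rewrite Cpow_add_r; ring). ring.
Qed.

Lemma qhyp_solution (q : R) (A B C0 z : C) :
  (0 < q < 1)%R -> A <> 0 -> B <> 0 -> qregular q C0 -> cut_plane z ->
  hyp_solution q A B C0 z 1 (fun n => qhyp q [A; B] [C0] (z * q ^ n)).
Proof.
  intros Hq HA HB RC Hz. split; [now apply qhyp_hyp_eq |].
  destruct (qpow_mult_small q z 1 Hq Rlt_0_1) as [N HN]. exists N. intros n Hn.
  rewrite qhyp_small by auto. ring.
Qed.

Lemma hyp_solution_scal (q : R) (A B C0 z k kap : C) (F : nat -> C) :
  hyp_solution q A B C0 z kap F -> hyp_solution q A B C0 z (k * kap) (fun n => k * F n).
Proof.
  intros [HF [N HN]]. split.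
  - intro n. specialize (HF n). apply -> Ceq_minus in HF. apply Ceq_minus.
    rewrite <- (Cmult_0_r k), <- HF. ring.
  - exists N. intros n Hn. rewrite HN by auto. ring.
Qed.

(** A first dilation series, applied between two gauge transformations, multiplies
    a by q^nu; a second one multiplies b by q^mu.  The result solves the
    hypergeometric equation with the new parameters and has the right behaviour
    at the origin. *)
Theorem Aop_little_q_jacobi (q a b nu : R) (mu sigma x : C) :
  (0 < q < 1)%R -> (0 < a)%R -> (0 < b)%R -> (a * b < 1)%R -> (0 < nu)%R -> sigma <> 0 ->
  qregular q (RtoC a * RtoC b * cpow q (RtoC nu + mu)) ->
  qregular q (- (x * cpow q mu)) ->
  cut_plane (- (RtoC b * x * cpow q (mu - RtoC nu) / RtoC a)) ->
  Cabs (A_term q (RtoC nu) mu (RtoC a) (RtoC b)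
          (little_q_jacobi q (RtoC a) (RtoC b) sigma) x) /\
  Aop q (RtoC nu) mu (RtoC a) (RtoC b) (little_q_jacobi q (RtoC a) (RtoC b) sigma) x =
  qpoch_inf q (RtoC a * RtoC b * cpow q (RtoC nu + mu)) /
    qpoch_inf q (RtoC a * RtoC b) *
  little_q_jacobi q (RtoC a * cpow q (RtoC nu)) (RtoC b * cpow q mu) sigma x.
Proof.
  intros Hq Ha Hb Hab Hnu Hs Rabcm Ru Cz. assert (Hq0 := q_neq_0 q Hq).
  assert (Hcr := Rpower_lt_1 q nu Hq Hnu).
  assert (Ec : cpow q (RtoC nu) = RtoC (Rpower q nu)) by (apply cpow_RtoC; lra).
  rewrite cpow_plus in *. rewrite cpow_minus in Cz.
  set (c := cpow q (RtoC nu)) in *. set (m := cpow q mu) in *.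
  assert (Hc : c <> 0) by apply cpow_neq_0. assert (Hm : m <> 0) by apply cpow_neq_0.
  assert (Ha0 : RtoC a <> 0) by (apply RtoC_neq_0; lra).
  assert (Hb0 : RtoC b <> 0) by (apply RtoC_neq_0; lra).
  assert (Hab1 : (Cmod (RtoC a * RtoC b) < 1)%R).
  { rewrite <- RtoC_mult, Cmod_R, Rabs_pos_eq; auto. apply Rmult_le_pos; lra. }
  set (al := RtoC a) in *. set (be := RtoC b) in *.
  assert (Habc1 : (Cmod (al * be * c) < 1)%R).
  { rewrite Cmod_mult, Ec, Cmod_R, Rabs_pos_eq by lra.
    pose proof (Cmod_ge_0 (al * be)). nra. }
  set (u := - (x * m)) in *. set (ze := - (be * x * m / al)).
  set (z := - (be * x * m / (al * c))).
  assert (Cz' : cut_plane z).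
  { replace z with (- (be * x * (m / c) / al)) by (unfold z; field; auto). exact Cz. }
  assert (Cze : cut_plane ze).
  { replace ze with (RtoC (Rpower q nu) * z) by (rewrite <- Ec; unfold z, ze; field; auto).
    apply cut_plane_scale; auto. lra. }
  assert (Rz := cut_plane_qregular q z Hq Cz'). assert (Rze := cut_plane_qregular q ze Hq Cze).
  assert (HA : al * sigma <> 0) by now apply Cmult_neq_0.
  assert (HB : al / sigma <> 0) by now apply Cdiv_neq_0.
  assert (HC : al * be <> 0) by now apply Cmult_neq_0.
  assert (RC := qregular_small q _ Hq Hab1).
  set (f := little_q_jacobi q al be sigma).
  set (F := fun n => qhyp q [al * sigma; al / sigma] [al * be] (ze * q ^ n)).
  assert (Ff : forall n, f (x * m * q ^ n) = F n).
  { intro n. unfold f, F, little_q_jacobi. f_equal. unfold ze. field. auto. }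
  destruct (qhyp_lattice_bounded q _ _ _ ze Hq HA HB RC Cze) as [M [M0 HM]].
  destruct (Aop_factorization q nu mu al be f x M Hq Ha0 Hb0 Hab1 Hnu Ru Rze) as [Ab Fac].
  { intro p. fold m. rewrite Ff. apply HM. }
  split; [exact Ab |]. rewrite (Fac Rz). clear Fac Ab. fold c m.
  assert (S1 : hyp_solution q (al * sigma) (al / sigma) (al * be) ze 1 F)
    by now apply qhyp_solution.
  assert (S2 := hyp_solution_gauge q _ _ _ ze u 1 F Hq HA HB HC RC
     ltac:(unfold u, ze; field; auto) Ru S1).
  set (F' := fun n => F n * (qpoch_inf q (ze * q ^ n) / qpoch_inf q (u * q ^ n))) in *.
  set (A1 := al * be / (al * sigma)) in *. set (B1 := al * be / (al / sigma)) in *.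
  assert (HA1 : A1 <> 0) by now apply Cdiv_neq_0. assert (HB1 : B1 <> 0) by now apply Cdiv_neq_0.
  assert (RC1 := qregular_small q _ Hq Habc1).
  assert (HC1 : al * be * c <> 0) by now apply Cmult_neq_0.
  (* F' and G live on the points u q^n, where a and b have exchanged their roles *)
  assert (S3 := hyp_solution_dilation_series q A1 B1 (al * be) c u 1 F' Hq Hab1 RC1 S2).
  set (G := fun n => CSeries (fun k => qbin q c k * (al * be) ^ k * F' (n + k)%nat)) in *.
  set (k1 := 1 * (qpoch_inf q (al * be * c) / qpoch_inf q (al * be))) in *.
  assert (S4 := hyp_solution_gauge q A1 B1 (al * be * c) u z k1 G Hq HA1 HB1 HC1 RC1
     ltac:(unfold u, z, A1, B1; field; auto 10) Rz S3).
  set (H := fun n => G n * (qpoch_inf q (u * q ^ n) / qpoch_inf q (z * q ^ n))) in *.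
  set (A2 := al * be * c / A1) in *. set (B2 := al * be * c / B1) in *.
  assert (HA2 : A2 <> 0) by now apply Cdiv_neq_0. assert (HB2 : B2 <> 0) by now apply Cdiv_neq_0.
  assert (RC2 : qregular q (al * be * c * m))
    by (replace (al * be * c * m) with (al * be * (c * m)) by ring; exact Rabcm).
  assert (S5 := hyp_solution_dilation_series q A2 B2 (al * be * c) m z k1 H Hq Habc1 RC2 S4).
  set (k2 := k1 * (qpoch_inf q (al * be * c * m) / qpoch_inf q (al * be * c))) in *.
  assert (S6 := hyp_solution_scal q _ _ _ z k2 1 _ (qhyp_solution q A2 B2 _ z Hq HA2 HB2 RC2 Cz')).
  rewrite Cmult_1_r in S6.
  assert (E := hyp_solution_unique q _ _ _ z k2 _ _ Rz S5 S6 0%nat).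
  cbv beta in E. simpl Nat.add in E. simpl Cpow in E.
  transitivity (CSeries (fun k => qbin q m k * (al * be * c) ^ k * H k)).
  - unfold A2op. apply CSeries_ext. intro j.
    replace (al * c * be) with (al * be * c) by ring. f_equal.
    unfold A1op. set (w := x * m * q ^ j).
    replace (- w) with (u * q ^ j) by (unfold w, u; ring).
    replace (- (be * w / al)) with (ze * q ^ j) by (unfold w, ze; field; auto).
    replace (- (be * w / (al * c))) with (z * q ^ j) by (unfold w, z; field; auto).
    unfold H, G.
    assert (N1 := qpoch_inf_neq_0 q _ Hq (qregular_shift q z j Rz)).
    assert (N2 := qpoch_inf_neq_0 q _ Hq (qregular_shift q u j Ru)).
    assert (N3 := qpoch_inf_neq_0 q _ Hq (qregular_shift q ze j Rze)).
    destruct (hyp_solution_bounded q _ _ _ u 1 F' Hq RC S2) as [K [K0 HK]].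
    destruct (qbin_bounded q c Hq) as [Mc [Mc0 HMc]].
    assert (AF : Cabs (fun k => qbin q c k * (al * be) ^ k * F' (j + k)%nat)).
    { apply (Cabs_ext (fun k => (qbin q c k * F' (j + k)%nat) * (al * be) ^ k));
        [intro; ring |].
      apply Cabs_bounded_mult with (Mc * K)%R; [| now apply Cmod_pow_lt_1].
      intro k. rewrite Cmod_mult. apply Rmult_le_compat; auto using Cmod_ge_0. }
    rewrite (CSeries_ext (fun i => qbin q c i *
       (qpoch q (u * q ^ j) i / qpoch q (ze * q ^ j) i) *
       (al * be) ^ i * f (w * q ^ i))
      (fun k => (qpoch_inf q (u * q ^ j) / qpoch_inf q (ze * q ^ j)) *
                (qbin q c k * (al * be) ^ k * F' (j + k)%nat))).
    + rewrite CSeries_scal by exact AF. field. auto.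
    + intro i.
      replace (w * q ^ i) with (x * m * q ^ (j + i))
        by (unfold w; rewrite Cpow_add_r; ring).
      rewrite Ff. unfold F'.
      rewrite (qpoch_inf_split q (u * q ^ j) i), (qpoch_inf_split q (ze * q ^ j) i)
        by auto.
      rewrite !Cpow_add_r, !Cmult_assoc.
      assert (N4 := qpoch_neq_0 q _ i (qregular_shift q ze j Rze)).
      assert (N5 := qpoch_inf_neq_0 q _ Hq (qregular_shift q _ i (qregular_shift q ze j Rze))).
      assert (N6 := qpoch_inf_neq_0 q _ Hq (qregular_shift q _ i (qregular_shift q u j Ru))).
      field. auto.
  - rewrite E. unfold little_q_jacobi.
    replace (z * 1) with (- (be * m * x / (al * c))) by (unfold z; field; auto).
    replace A2 with (al * c * sigma) by (unfold A2, A1; field; auto 10).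
    replace B2 with (al * c / sigma) by (unfold B2, B1; field; auto 10).
    replace (al * c * (be * m)) with (al * be * c * m) by ring.
    replace (al * be * (c * m)) with (al * be * c * m) by ring.
    unfold k2, k1.
    assert (N1 := qpoch_inf_neq_0 q _ Hq RC1). assert (N2 := qpoch_inf_neq_0 q _ Hq RC).
    field. auto.
Qed.

Theorem theorem2p3 (q : R) (hq : (0 < q < 1)%R) :
  (forall (a b nu mu : C),
     a <> 0 -> b <> 0 ->
     (Cmod (cpow q (nu - mu) * b / a) < 1)%R ->
     (forall (f : C -> C) (x : C),
        W_decay q nu f -> W_regular q mu x ->
        Cex_series (W_term q nu mu a b f x)) /\
     (forall (f : C -> C) (x : C),
        compactly_supported f -> W_regular q mu x ->
        Wop q nu mu a b (Lop q a b f) x =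
        Lop q (a * cpow q (- nu)) (b * cpow q (- mu)) (Wop q nu mu a b f) x) /\
     (forall (sigma : C) (y : R) (k : Z) (f : C -> C),
        sigma <> 0 ->
        (forall n : Z, sigma * sigma <> CpowZ q n) ->
        (Cmod (a * sigma) < Cmod (cpow q nu))%R ->
        (0 < y)%R ->
        ~ (Im (y * cpow q (- mu)) = 0%R /\ (Re (y * cpow q (- mu)) < 0)%R) ->
        (forall m : Z, f (y * cpow q (- mu) * CpowZ q m) =
                       Phi q a b sigma (y * cpow q (- mu)) m) ->
        Cex_series (W_term q nu mu a b f (y * CpowZ q k)) /\
        Wop q nu mu a b f (y * CpowZ q k) =
        W_norm q mu a b y * cpow y (mu + nu) *
        (qpochs_inf q [a * sigma; b * sigma] /
         qpochs_inf q [a * cpow q (- nu) * sigma; b * cpow q (- mu) * sigma]) *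
        Phi q (a * cpow q (- nu)) (b * cpow q (- mu)) sigma y k))
  /\
  (forall (a b nu : R) (mu : C),
     (0 < a)%R -> (0 < b)%R -> (a * b < 1)%R -> (0 < nu)%R ->
     (forall n : nat, mu <> - INR n) ->
     (forall (f : C -> C) (x : C),
        bounded_fun f ->
        qregular q (- (x * cpow q mu)) ->
        qregular q (- (b * x * cpow q mu / a)) ->
        qregular q (- (b * x * cpow q (mu - nu) / a)) ->
        Cex_series (A_term q nu mu a b f x)) /\
     (forall (f : C -> C) (x : C),
        compactly_supported_pos f -> x <> 0 ->
        Lop q (a * cpow q nu) (b * cpow q mu) (Aop q nu mu a b f) x =
        Aop q nu mu a b (Lop q a b f) x) /\
     (forall (sigma x : C),
        sigma <> 0 ->
        qregular q (a * b * cpow q (nu + mu)) ->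
        qregular q (- (x * cpow q mu)) ->
        cut_plane (- (b * x * cpow q (mu - nu) / a)) ->
        Cex_series (A_term q nu mu a b (little_q_jacobi q a b sigma) x) /\
        Aop q nu mu a b (little_q_jacobi q a b sigma) x =
        qpoch_inf q (a * b * cpow q (nu + mu)) / qpoch_inf q (a * b) *
        little_q_jacobi q (a * cpow q nu) (b * cpow q mu) sigma x)).

Proof.
  split.
  - intros a b nu mu Ha Hb Ht.
    set (c := cpow q nu). assert (Hc : c <> 0) by apply cpow_neq_0.
    set (m := cpow q mu). assert (Hm : m <> 0) by apply cpow_neq_0.
    assert (Pc := proj1 (Cmod_gt_0 c) Hc).
    split; [| split].
    + intros f x [eps [Heps Hf]] HW.
      assert (Hxm := Cdiv_neq_0 x m (proj1 HW) Hm).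
      destruct (Hf _ Hxm) as [M HM].
      assert (He := Rpower_lt_1 q eps hq Heps).
      apply Cabs_Cex_series.
      apply (Wop_factorization q nu mu a b f x (Rpower q eps * Cmod c)); auto.
      * fold c. nra.
      * exists M. fold m. split.
        -- specialize (HM O). simpl in HM. rewrite Cmult_0_l, cpow_0, Cmod_1 in HM.
           eapply Rle_trans; [apply Cmod_ge_0 |]. rewrite Rmult_1_r in HM. exact HM.
        -- intro p. specialize (HM p).
           rewrite cpow_opp, cpow_INR, cpow_mult_INR, cpow_plus, cpow_RtoC in HM by lra.
           fold c in HM. rewrite Cmod_pow, Cmod_mult, Cmod_R, Rabs_pos_eq in HM by lra.
           exact HM.
    + intros f x [M HM] HW.
      apply (Wop_intertwines q nu mu a b f x (Cmod c / 2)); auto; fold c m; [lra |].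
      assert (Hxm := Cdiv_neq_0 x m (proj1 HW) Hm).
      set (g := fun p => f (x / m / q ^ p) / RtoC (Cmod c / 2) ^ p).
      assert (Hr0 : RtoC (Cmod c / 2) <> 0) by (apply RtoC_neq_0; lra).
      destruct (qpow_small q (Cmod (x / m) / (Rabs M + 1)) hq) as [N HN].
      { apply Rdiv_lt_0_compat; [now apply Cmod_gt_0 |]. pose proof (Rabs_pos M). lra. }
      destruct (eventually_bounded g 0 N) as [K [K0 HK]].
      { intros n Hn. unfold g. rewrite HM.
        - unfold Cdiv. rewrite Cmult_0_l, Cmod_0. lra.
        - specialize (HN n Hn). pose proof (qpow_le_1 q n hq) as Pn.
          assert (Hqn := Cpow_nz q n (q_neq_0 q hq)).
          rewrite Cmod_div, Cmod_qpow by auto. pose proof (Rabs_pos M) as PM.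
          apply Rle_lt_trans with (Rabs M); [apply Rle_abs |].
          apply Rmult_lt_reg_r with (q ^ n)%R; [lra |].
          unfold Rdiv. rewrite Rmult_assoc, Rinv_l, Rmult_1_r by lra.
          apply (Rmult_lt_compat_r (Rabs M + 1)) in HN; [| lra].
          unfold Rdiv in HN. rewrite Rmult_assoc, Rinv_l, Rmult_1_r in HN by lra. nra. }
      exists K. split; auto. intro p. specialize (HK p). unfold g in HK.
      rewrite Cmod_div, Cmod_pow, Cmod_R, Rabs_pos_eq in HK by (try apply Cpow_nz; auto; lra).
      assert (Pp : (0 < (Cmod c / 2) ^ p)%R) by (apply pow_lt; lra).
      apply Rmult_le_reg_r with (/ (Cmod c / 2) ^ p)%R; [now apply Rinv_0_lt_compat |].
      rewrite Rmult_assoc, Rinv_r, Rmult_1_r by lra. exact HK.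
    + intros sigma y k f Hs Hss Has Hy Hneg Hf.
      destruct (Wop_free_solution q nu mu a b sigma y k f) as [A E]; auto.
      split; [now apply Cabs_Cex_series | exact E].
  - intros a b nu mu Ha Hb Hab Hnu _.
    assert (Ha0 : RtoC a <> 0) by (apply RtoC_neq_0; lra).
    assert (Hb0 : RtoC b <> 0) by (apply RtoC_neq_0; lra).
    split; [| split].
    + intros f x [M HM] RV RZ _. apply Cabs_Cex_series.
      apply (Aop_factorization q nu mu (RtoC a) (RtoC b) f x M); auto.
      rewrite <- RtoC_mult, Cmod_R, Rabs_pos_eq; auto. apply Rmult_le_pos; lra.
    + intros f x Hf Hx. now apply Aop_intertwines.
    + intros sigma x Hs R1 R2 Hz.
      destruct (Aop_little_q_jacobi q a b nu mu sigma x) as [A E]; auto.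
      split; [now apply Cabs_Cex_series | exact E].
Qed.
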